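(* For any $0<\varepsilon<1$ the $C^*$-algebra $\mathcal{E}(\varepsilon)$ is isomorphic to the $C^*$-algebra of all $f\in C(D_\varepsilon\times\mathbf{T}^3\to M_4(\mathbb{C}))$ satisfying, for all values of the variables, $$f(r,0,x_2,e^{i\phi},e^{i\phi_1},e^{i\phi_2})=f(r,0,x_2,e^{i\phi},1,e^{i\phi_2}),$$ $$f(r,x_1,0,e^{i\phi},e^{i\phi_1},e^{i\phi_2})=f(r,x_1,0,e^{i\phi},e^{i\phi_1},1),$$ $$f\bigl(r,\tfrac{1-r}{2},x_2,e^{i\phi},e^{i\phi_1},e^{i\phi_2}\bigr)=f\bigl(r,\tfrac{1-r}{2},0,e^{i\phi},e^{i\phi_1},1\bigr)\in M_2(\mathbb{C})\otimes\mathbf{1},$$ $$f(1,0,x_2,e^{i\phi},e^{i\phi_1},e^{i\phi_2})=f(1,0,0,e^{i\phi},1,1),$$ $$\nu_2^*(\phi_2)f(r,x_1,\tfrac12,e^{i\phi},e^{i\phi_1},e^{i\phi_2})\nu_2(\phi_2)\in M_2(\mathbb{C})\oplus M_2(\mathbb{C}),\quad\forall\phi_2\in[0,2\pi].$$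
   Context: Consider the relations (WCAR with two degrees of freedom) $a_i^*a_i+a_ia_i^*=1$ ($i=1,2$), $a_1^*a_2=-a_2a_1^*$. In every irreducible representation of them $a_1a_2+a_2a_1$ is a scalar $y\in\mathbb{C}$ with $|y|\le1$. For $0<\varepsilon<1$, $\mathcal{E}(\varepsilon)$ is the enveloping $C^*$-algebra of these relations together with $a_2a_1+a_1a_2=y$, where $y$ is allowed to take any value with $\varepsilon\le|y|\le1$; i.e. the $C^*$-algebra generated by $a_1,a_2$ universal for those irreducible representations of WCAR in which the scalar $y$ satisfies $\varepsilon\le|y|\le1$. $\mathbf{T}=\{z\in\mathbb{C}:|z|=1\}$; $D_\varepsilon=\{(r,x_1,x_2):\varepsilon\le r\le1,\ 0\le x_1\le\frac{1-r}{2},\ 0\le x_2\le\frac12\}$; points of $D_\varepsilon\times\mathbf{T}^3$ are written $(r,x_1,x_2,e^{i\phi},e^{i\phi_1},e^{i\phi_2})$. $C(X\to M_n(\mathbb{C}))$ is the $C^*$-algebra of continuous $M_n(\mathbb C)$-valued functions on $X$ with pointwise operations. $\nu_2(\phi)=T(V(\phi)\otimes\mathbf{1}_2)\in U(4)$ for $\phi\in[0,2\pi]$, where $T(x\otimes y)=y\otimes x$ on $\mathbb{C}^2\otimes\mathbb{C}^2$ and $V(\phi)=\frac{1}{\sqrt2}\begin{pmatrix} e^{i\phi/2} & -e^{i\phi/2}\\ 1&1\end{pmatrix}$. The identification $\mathbb{C}^2\otimes\mathbb{C}^2=\mathbb{C}^4$ is such that $A\otimes B=(a_{ij}B)$ (Kronecker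 product), and $M_2(\mathbb{C})\oplus M_2(\mathbb{C})\subset M_4(\mathbb{C})$ denotes block-diagonal matrices with two $2\times2$ blocks. *)

(* Defs.v *)
From HB Require Import structures.
From mathcomp Require Import all_boot all_order all_algebra.
From mathcomp Require Import complex mxtens sesquilinear spectral.
From mathcomp Require Import all_classical all_reals all_analysis.

Set Implicit Arguments.
Unset Strict Implicit.
Unset Printing Implicit Defensive.

Import Order.TTheory GRing.Theory Num.Theory.
Import numFieldNormedType.Exports.

Local Open Scope classical_set_scope.
Local Open Scope complex_scope.
Local Open Scope sesquilinear_scope.
Local Open Scope ring_scope.

(* The complex numbers as a [numClosedFieldType]: the topology and normed-module
   instances of the library are attached to such structures, not to the bare
   type [R[i]]. Norms take their values in the scalar field, as everywhere in
   the library; [0 <= M] in [Cplx R] forces [M] to be real. *)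
Definition Cplx (R : realType) : numClosedFieldType := R[i].

(* Hierarchy-Builder admits no join of the ring structures with the normed
   modules below [numDomainType], so the multiplication of a C*-algebra is a
   separate operation [amul] on a complete normed module. *)
HB.mixin Record isCStarAlgebra (C : numClosedFieldType) A
    & CompleteNormedModule C A := {
  amul : A -> A -> A;
  aone : A;
  star : A -> A;
  amulA : associative amul;
  amul1a : left_id aone amul;
  amula1 : right_id aone amul;
  amulDl : left_distributive amul +%R;
  amulDr : right_distributive amul +%R;
  amulZl : forall (c : C) x y, amul (c *: x) y = c *: amul x y;
  amulZr : forall (c : C) x y, amul x (c *: y) = c *: amul x y;
  starK : involutive star;
  starD : {morph star : x y / x + y};
  starZ : forall (c : C) x, star (c *: x) = c^* *: star x;
  starM : forall x y, star (amul x y) = amul (star y) (star x);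
  ler_norm_amul : forall x y, `|amul x y| <= `|x| * `|y|;
  cstar_id : forall x, `|amul (star x) x| = `|x| ^+ 2
}.

(* unital C*-algebras *)
#[short(type="cstarAlgType")]
HB.structure Definition CStarAlgebra (C : numClosedFieldType) :=
  {A of isCStarAlgebra C A & CompleteNormedModule C A}.

(* The inner product is linear in its first argument. *)
HB.mixin Record isHilbert (C : numClosedFieldType) H & CompleteNormedModule C H := {
  dot : {dot H for Num.conj};
  sqr_normE : forall x : H, `|x| ^+ 2 = dot x x
}.

#[short(type="hilbertType")]
HB.structure Definition Hilbert (C : numClosedFieldType) :=
  {H of isHilbert C H & CompleteNormedModule C H}.

Section enveloping.
Variables (C : numClosedFieldType) (I : Type).

(* Elements of the free unital *-algebra on generators indexed by [I], as
   formal sums of scalar multiples of words; [(i, false)] is the i-th generator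
   and [(i, true)] its adjoint. *)
Definition starpoly := seq (C * seq (I * bool)).

Definition starpoly_eval (A : cstarAlgType C) (a : I -> A) (p : starpoly) : A :=
  \sum_(m <- p)
    m.1 *: foldr (fun l y => amul (if l.2 then star (a l.1) else a l.1) y) aone m.2.

(* bounded operators on a Hilbert space, with their adjoints *)
Record op_family (H : hilbertType C) := OpFamily {
  op : I -> {linear H -> H};
  adj : I -> {linear H -> H};
  op_continuous : forall i, continuous (op i);
  op_adj : forall i x y, dot (op i x) y = dot x (adj i y)
}.

Definition op_eval (H : hilbertType C) (T : op_family H) (p : starpoly) (x : H) : H :=
  \sum_(m <- p)
    m.1 *: foldr (fun l y => if l.2 then adj T l.1 y else op T l.1 y) x m.2.

Definition irreducible (H : hilbertType C) (T : op_family H) :=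
  (exists x : H, x != 0) /\
  forall W : set H,
    closed W -> W 0 -> (forall (c : C) x y, W x -> W y -> W (c *: x + y)) ->
    (forall i x, W x -> W (op T i x) /\ W (adj T i x)) ->
    W = [set 0] \/ W = setT.

Variable K : forall H : hilbertType C, op_family H -> Prop.

(* ||T(p)|| <= M for all representations T in the class K *)
Definition bounded_on_class (p : starpoly) (M : C) :=
  forall (H : hilbertType C) (T : op_family H), K T ->
  forall x, `|op_eval T p x| <= M * `|x|.

(* [E], with the images [a] of the generators, is the enveloping C*-algebra of
   the class [K]: the Hausdorff completion of the free *-algebra for the
   seminorm p |-> sup_{T in K} ||T(p)||. *)
Definition enveloping (E : cstarAlgType C) (a : I -> E) :=
  [/\ closure (range (starpoly_eval a)) = setT,
      forall p, bounded_on_class p `|starpoly_eval a p|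
    & forall p (M : C), 0 <= M -> bounded_on_class p M ->
        `|starpoly_eval a p| <= M].

End enveloping.

Section wcar.
Variable R : realType.
Local Notation C := (Cplx R).

Definition wcar (H : hilbertType C) (T : op_family 'I_2 H) :=
  (forall i x, adj T i (op T i x) + op T i (adj T i x) = x) /\
  (forall x, adj T 0 (op T 1 x) = - op T 1 (adj T 0 x)).

Definition wcar_annulus (eps : R) (H : hilbertType C) (T : op_family 'I_2 H) :=
  [/\ wcar T, irreducible T
    & exists2 y : C, (eps%:C : C) <= `|y| <= 1
        & forall x, op T 1 (op T 0 x) + op T 0 (op T 1 x) = y *: x].

Definition is_E (eps : R) (E : cstarAlgType C) (a : 'I_2 -> E) :=
  enveloping (@wcar_annulus eps) a.

End wcar.

Section function_algebra.
Variable R : realType.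
Local Notation C := (Cplx R).

(* D_eps x T^3, with its topology as a subset of R^3 x C^3 *)
Definition DT3 (eps : R) : set (R * R * R * C * C * C) :=
  [set p | let: (r, x1, x2, u, u1, u2) := p in
    [/\ eps <= r <= 1, 0 <= x1 <= (1 - r) / 2,
        0 <= x2 <= 1 / 2
      & [/\ `|u| = 1, `|u1| = 1 & `|u2| = 1]]].

Definition expi (t : R) : C := (cos t +i* sin t : R[i]).

Definition V (phi : R) : 'M[C]_2 :=
  (((Num.sqrt 2)^-1)%:C : C) *:
  \matrix_(i, j) (if i == 0 then if j == 0 then expi (phi / 2) else - expi (phi / 2)
                  else 1).

(* the flip x (x) y |-> y (x) x of C^2 (x) C^2 *)
Definition flip : 'M[C]_(2 * 2) :=
  \sum_(i < 2) \sum_(j < 2) delta_mx i j *t delta_mx j i.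

Definition nu2 (phi : R) : 'M[C]_4 := flip *m (V phi *t 1%:M).

Definition M2_tensor_1 : set 'M[C]_4 :=
  [set X | exists A : 'M[C]_2, X = A *t (1%:M : 'M[C]_2)].

Definition M2_plus_M2 : set 'M[C]_4 :=
  [set X | exists A B : 'M[C]_2, X = block_mx A 0 0 B].

Definition fun_algebra (eps : R) : set (DT3 eps -> 'M[C]_4) :=
  [set f | continuous f /\
   forall (r x1 x2 : R) (u u1 u2 : C) (p q : DT3 eps),
   [/\ val p = (r, 0, x2, u, u1, u2) -> val q = (r, 0, x2, u, 1, u2) -> f p = f q,
       val p = (r, x1, 0, u, u1, u2) -> val q = (r, x1, 0, u, u1, 1) -> f p = f q,
       val p = (r, (1 - r) / 2, x2, u, u1, u2) ->
         val q = (r, (1 - r) / 2, 0, u, u1, 1) -> f p = f q /\ M2_tensor_1 (f p),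
       val p = (1, 0, x2, u, u1, u2) -> val q = (1, 0, 0, u, 1, 1) -> f p = f q
     & forall phi2 : R, 0 <= phi2 <= 2 * pi ->
         val p = (r, x1, 1 / 2, u, u1, expi phi2) ->
         M2_plus_M2 ((nu2 phi2)^t* *m f p *m nu2 phi2)]].

End function_algebra.

(* [E] is *-isomorphic to the *-algebra [S] of matrix-valued functions with
   pointwise operations. A *-isomorphism of C*-algebras is automatically
   isometric. *)
Definition star_isomorphic (C : numClosedFieldType) (E : cstarAlgType C) (X : Type)
    (n : nat) (S : set (X -> 'M[C]_n)) :=
  exists Phi : E -> X -> 'M[C]_n,
    [/\ forall (c : C) a b x, Phi (c *: a + b) x = c *: Phi a x + Phi b x,
        forall a b x, Phi (amul a b) x = Phi a x *m Phi b x,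
        forall a x, Phi (star a) x = (Phi a x)^t*,
        injective Phi
      & range Phi = S].

(* Main.v *)
From HB Require Import structures.
Require Import Defs.
From mathcomp Require Import all_boot all_order all_algebra.
From mathcomp Require Import complex mxtens sesquilinear spectral ring lra.
From mathcomp Require Import all_classical all_reals all_analysis.


Set Implicit Arguments.
Unset Strict Implicit.
Unset Printing Implicit Defensive.

Import Order.TTheory GRing.Theory Num.Theory.
Import numFieldNormedType.Exports.

Local Open Scope classical_set_scope.
Local Open Scope sesquilinear_scope.
Local Open Scope ring_scope.

(** Write y = r u with r = |y| and |u| = 1, and rotate the generators to b_1 and b_2, where sqrt 2
    b_1 = a_1 + u a_2^* and sqrt 2 b_2 = a_1 - u a_2^*. In an irreducible representation the squares
    of a_1 and a_2 commute with everything, hence are scalars by Schur's lemma ([schur],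
    [wcar_square]), and then all anticommutators among b_1, b_2 and their adjoints are scalars. A
    Bogoliubov transformation gives b_1 = A e + B e^* with a fermion e. Subtracting from b_2 its
    part in e and e^* leaves an operator h that anticommutes with both. In general h is a
    combination of a second fermion f and its adjoint; in the degenerate cases h is zero or
    proportional to its own adjoint ([residual_factor]). The scalars that occur are r u, a number t
    with |t|^2 = 2 x_1 / (1 + r) and phase u_1, the anticommutator {h, h^*} = del = 1 - r - 2 x_1,
    and h^2 = del x_2 u_2. They are coordinatised by D_eps x T^3, and each point p of that set
    carries a model [ev p] by 4 x 4 matrices, continuous in p.

    The proof works with the algebra [E0] of [good] functions: continuous matrix functions that
    depend on p only through the scalar invariants [pkey p] and that commute at p with 1 (x)
    [fib p], which encodes the commutant of the model. With p |-> [ev p] as generators it is the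
    enveloping algebra ([E0_enveloping]). Its norm dominates all representations of the class
    because each of them embeds isometrically into an ampliation of a model ([rep_at_point],
    [op_eval_bound]). Its norm is no larger than necessary because the model is irreducible where
    del > 0 and x_2 < 1/2 ([interior_wcar]), and such points are dense ([interior_dense]). Density
    of the polynomials is a Stone-Weierstrass argument ([good_apx]): at a single point they attain
    every value open to a good function ([fiber_value]), the invariants are themselves scalar-valued
    polynomials, and bump functions of the invariants glue local approximations.

    Enveloping algebras of one class are isomorphic ([enveloping_iso]), so it remains to see that
    goodness is the list of boundary conditions ([good_fun_algebra], [fun_algebra_good]). The points
    glued together are those with equal invariants, M_2 (x) 1 is the commutant of 1 (x) M_2, and
    [nu2] carries the block-diagonal matrices onto the commutant of 1 (x) G, where grading (x) G is
    what h becomes, up to a scalar, at x_2 = 1/2. *)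

(** * Inner products *)

Section hilbert.
Variables (C : numClosedFieldType) (H : hilbertType C).
Implicit Types (x y z : H) (c : C).
Local Notation "<| x , y |>" := (@dot C H x y) (at level 0).

Lemma dotC x y : <|y, x|> = (<|x, y|>)^*.
Proof. by rewrite (hermC dot) expr0 mul1r. Qed.

Lemma dotDl x y z : <|x + y, z|> = <|x, z|> + <|y, z|>. Proof. exact: linearDl. Qed.
Lemma dotDr x y z : <|z, x + y|> = <|z, x|> + <|z, y|>. Proof. exact: linearDr. Qed.
Lemma dotZl c x y : <|c *: x, y|> = c * <|x, y|>. Proof. exact: linearZl_LR. Qed.
Lemma dotZr c x y : <|x, c *: y|> = c^* * <|x, y|>. Proof. exact: linearZr_LR. Qed.
Lemma dotNl x y : <|- x, y|> = - <|x, y|>. Proof. exact: linearNl. Qed.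
Lemma dotNr x y : <|x, - y|> = - <|x, y|>. Proof. exact: linearNr. Qed.
Lemma dotBl x y z : <|x - y, z|> = <|x, z|> - <|y, z|>. Proof. exact: linearBl. Qed.
Lemma dotBr x y z : <|z, x - y|> = <|z, x|> - <|z, y|>. Proof. exact: linearBr. Qed.

Lemma dot_ge0 x : 0 <= <|x, x|>.
Proof. by rewrite -sqr_normE exprn_ge0. Qed.

Lemma dot_self_eq0 x : <|x, x|> = 0 -> x = 0.
Proof. by rewrite -sqr_normE => /eqP; rewrite expf_eq0 /= normr_eq0 => /eqP. Qed.

End hilbert.

(** * The reals inside the complex numbers *)

Section real_embedding.
Variable R : realType.
Local Notation C := (Cplx R).

Definition Cr (x : R) : C := x%:C%C.

Fact Cr_additive : additive Cr. Proof. exact: (rmorphB (@real_complex_def R (Phant R))). Qed.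
Fact Cr_multiplicative : multiplicative Cr.
Proof. by split; [exact: (rmorphM (@real_complex_def R (Phant R)))|exact: (rmorph1 (@real_complex_def R (Phant R)))]. Qed.
HB.instance Definition _ := GRing.isAdditive.Build R C Cr Cr_additive.
HB.instance Definition _ := GRing.isMultiplicative.Build R C Cr Cr_multiplicative.

Lemma CrD x y : Cr (x + y) = Cr x + Cr y. Proof. exact: rmorphD. Qed.
Lemma CrB x y : Cr (x - y) = Cr x - Cr y. Proof. exact: rmorphB. Qed.
Lemma CrN x : Cr (- x) = - Cr x. Proof. exact: rmorphN. Qed.
Lemma CrM x y : Cr (x * y) = Cr x * Cr y. Proof. exact: rmorphM. Qed.
Lemma CrX x n : Cr (x ^+ n) = Cr x ^+ n. Proof. exact: rmorphXn. Qed.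
Lemma CrV x : Cr x^-1 = (Cr x)^-1. Proof. exact: fmorphV. Qed.
Lemma Cr0 : Cr 0 = 0. Proof. exact: rmorph0. Qed.
Lemma Cr1 : Cr 1 = 1. Proof. exact: rmorph1. Qed.
Lemma Cr_nat n : Cr n%:R = n%:R. Proof. exact: rmorph_nat. Qed.

Definition re (z : C) : R := complex.Re z.
Definition im (z : C) : R := complex.Im z.

Lemma ler_Cr x y : (Cr x <= Cr y) = (x <= y). Proof. exact: lecR. Qed.
Lemma ltr_Cr x y : (Cr x < Cr y) = (x < y). Proof. exact: ltcR. Qed.
Lemma Cr_inj : injective Cr. Proof. by move=> x y []. Qed.
Lemma conj_Cr x : (Cr x)^* = Cr x. Proof. exact: conjc_real. Qed.
Lemma re_Cr x : re (Cr x) = x. Proof. by []. Qed.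
Lemma im_Cr x : im (Cr x) = 0. Proof. by []. Qed.
Lemma Cr_re z : z \is Num.real -> Cr (re z) = z. Proof. exact: RRe_real. Qed.
Lemma Cr_re_ge0 z : 0 <= z -> Cr (re z) = z. Proof. by move=> /ger0_real/Cr_re. Qed.
Lemma re_ge0 z : 0 <= z -> 0 <= re z.
Proof. by move=> z0; rewrite -ler_Cr Cr_re_ge0 ?rmorph0. Qed.
Lemma re_gt0 z : 0 < z -> 0 < re z.
Proof. by move=> z0; rewrite -ltr_Cr Cr_re_ge0 ?rmorph0 // ltW. Qed.
Lemma Cr_ge0 x : (0 <= Cr x) = (0 <= x). Proof. by rewrite -ler_Cr rmorph0. Qed.
Lemma Cr_gt0 x : (0 < Cr x) = (0 < x). Proof. by rewrite -ltr_Cr rmorph0. Qed.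
Lemma norm_Cr x : `|Cr x| = Cr `|x|.
Proof.
have [x0|x0] := leP 0 x; first by rewrite !ger0_norm ?Cr_ge0.
by rewrite !ltr0_norm ?rmorphN // -oppr_gt0 -rmorphN Cr_gt0 oppr_gt0.
Qed.
Lemma re_imE z : z = Cr (re z) + 'i * Cr (im z).
Proof. by rewrite -complexiE; exact: complexE. Qed.
Lemma sqr_normCE z : `|z| ^+ 2 = Cr (re z ^+ 2 + im z ^+ 2).
Proof. by rewrite /Cr add_Re2_Im2. Qed.
Lemma ler_norm_re z : Cr `|re z| <= `|z|. Proof. exact: normc_ge_Re. Qed.

End real_embedding.

(** * Square roots of positive operators by iteration *)

Section sqrt_iteration.
Variable R : realType.

(* Partial sums of the binomial series of [1 - sqrt (1 - b)] at [b = 1]. *)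
Fixpoint sqrt_iter (n : nat) : R :=
  if n is m.+1 then (1 + sqrt_iter m ^+ 2) / 2 else 0.

Lemma sqrt_iter_ge0 n : 0 <= sqrt_iter n.
Proof.
by case: n => [|n] //=; rewrite divr_ge0 // addr_ge0 // sqr_ge0.
Qed.

Lemma sqrt_iter_le1 n : sqrt_iter n <= 1.
Proof. by elim: n => [|n IH] //=; have := sqrt_iter_ge0 n; nra. Qed.

Lemma sqrt_iter_leS n : sqrt_iter n <= sqrt_iter n.+1.
Proof. by rewrite /=; have := sqr_ge0 (1 - sqrt_iter n); nra. Qed.

(** The gap g = 1 - s satisfies g' = g - g^2 / 2, whence the decay g_n <= 2 / (n + 2). *)
Lemma sqrt_iter_rate n : (1 - sqrt_iter n) * (n.+2)%:R <= 2.
Proof.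
elim: n => [|n IH]; first by rewrite /= subr0 mul1r.
have := sqrt_iter_ge0 n; have := sqrt_iter_le1 n.
move: IH; rewrite /= -[n.+3]addn1 natrD -[n.+2]addn2 natrD.
have := ler0n R n; move: (n%:R : R) (sqrt_iter n) => a s a0 h s1 s0.
set g := 1 - s in h *.
have g0 : 0 <= g by rewrite subr_ge0.
have -> : 1 - (1 + s ^+ 2) / 2 = g - g ^+ 2 / 2 by rewrite /g; field.
have g1 : g <= 1 by rewrite /g; lra.
nra.
Qed.

Lemma sqrt_iter_cvg1 (e : R) : 0 < e -> exists n, 1 - sqrt_iter n < e.
Proof.
move=> e0; pose n := Num.bound (2 / e); exists n.
have : 2 / e < n%:R by apply: archi_boundP; rewrite divr_ge0 // ltW.
rewrite ltr_pdivrMr // => h.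
have := sqrt_iter_rate n; rewrite -[n.+2]addn2 natrD.
have : 0 <= n%:R :> R by [].
nra.
Qed.

End sqrt_iteration.

Section hilbert2.
Variable C : numClosedFieldType.

Lemma Cauchy_Schwarz (H : hilbertType C) (x y : H) : `|dot x y| <= `|x| * `|y|.
Proof.
have [->|y0] := eqVneq y 0; first by rewrite linear0r !normr0 mulr0.
have yy0 : `|y| ^+ 2 != 0 by rewrite expf_neq0 // normr_eq0.
pose a := dot x y.
have : 0 <= dot (`|y| ^+ 2 *: x - a *: y) (`|y| ^+ 2 *: x - a *: y) by exact: dot_ge0.
rewrite dotBl !dotBr !dotZl !dotZr -!sqr_normE -/a (dotC x y) -/a.
rewrite [(_ ^+ 2)^*]geC0_conj ?exprn_ge0 //.
have -> : `|y| ^+ 2 * (`|y| ^+ 2 * `|x| ^+ 2) - `|y| ^+ 2 * (a^* * a) -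
          (a * (`|y| ^+ 2 * a^*) - a * (a^* * `|y| ^+ 2)) =
          `|y| ^+ 2 * ((`|x| * `|y|) ^+ 2 - a * a^*) by ring.
rewrite pmulr_rge0 ?exprn_gt0 ?normr_gt0 // -normCK subr_ge0.
by rewrite ler_sqr ?nnegrE // mulr_ge0.
Qed.

Lemma bounded_linear_continuous (V W : normedModType C) (g : V -> W) (M : C) :
  linear g -> (forall x, `|g x| <= M * `|x|) -> continuous g.
Proof.
move=> lg gM x.
have gB u v : g (u - v) = g u - g v.
  by rewrite addrC -scaleN1r lg scaleN1r addrC.
apply/cvgrPdist_le => e e0.
have M0 : 0 <= `|M| by [].
have M1 : 0 < `|M| + 1 by rewrite ltr_wpDl.
near=> y.
rewrite -gB (le_trans (gM _)) // (@le_trans _ _ ((`|M| + 1) * `|x - y|)) //.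
  have := normr_ge0 (M * `|x - y|).
  have [->|xy0] := eqVneq (x - y) 0; first by rewrite normr0 !mulr0.
  have xy1 : 0 < `|x - y| by rewrite normr_gt0.
  have Mge : 0 <= M by have := le_trans (normr_ge0 _) (gM (x - y)); rewrite pmulr_lge0.
  by rewrite ler_wpM2r // ger0_norm // lerDl.
rewrite mulrC -ler_pdivlMr //.
near: y; apply: cvgr_dist_le; first exact: cvg_id.
by rewrite divr_gt0.
Unshelve. all: by end_near. Qed.

Lemma closed_eq_ker (V W : normedModType C) (g : V -> W) (M : C) :
  linear g -> (forall x, `|g x| <= M * `|x|) -> closed [set x | g x = 0].
Proof.
move=> lg gM; have cg := bounded_linear_continuous lg gM.
rewrite (_ : [set x | g x = 0] = g @^-1` [set 0]) //.
by apply: closed_comp => [x _|]; [exact: cg|apply: accessible_closed_set1; apply: hausdorff_accessible; exact: norm_hausdorff].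
Qed.

End hilbert2.

Section iteration_limits.
Variable R : realType.
Local Notation C := (Cplx R).
Local Notation s := (sqrt_iter R).

(** The gap [1 - s n] serves as universal modulus of convergence below: identities between limits
    are proved by bounding their defect by a multiple of it. *)
Lemma sqrt_iter_squeeze (V : normedModType C) (z : V) (K : C) :
  0 <= K -> (forall n, `|z| <= Cr (1 - s n) * K) -> z = 0.
Proof.
move=> K0 h; apply/eqP; rewrite -normr_eq0; apply/eqP/le_anti; rewrite normr_ge0 andbT.
apply/ler_addgt0Pr => e e0; rewrite add0r.
have K1 : 0 < re K + 1 by rewrite ltr_wpDl // re_ge0.
have [|n hn] := @sqrt_iter_cvg1 R (re e / (re K + 1)).
  by rewrite divr_gt0 // re_gt0.
rewrite (le_trans (h n)) // -[K]Cr_re_ge0 // -[e in leRHS]Cr_re_ge0 ?(ltW e0) // -rmorphM ler_Cr.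
move: hn; rewrite ltr_pdivlMr // => hn.
have := sqrt_iter_le1 R n; nra.
Qed.

(** The increments are majorised by those of the convergent scalar sequence [s], so telescoping
    gives a Cauchy sequence with an explicit error. *)
Lemma sqrt_iter_limit (V : completeNormedModType C) (x_ : nat -> V) (K : C) :
  0 <= K -> (forall n, `|x_ n.+1 - x_ n| <= Cr (s n.+1 - s n) * K) ->
  exists l, forall n, `|l - x_ n| <= Cr (1 - s n) * K.
Proof.
move=> K0 h.
have hk n k : `|x_ (n + k)%N - x_ n| <= Cr (1 - s n) * K.
  have : `|x_ (n + k)%N - x_ n| <= Cr (s (n + k)%N - s n) * K.
    elim: k => [|k IH]; first by rewrite addn0 !subrr normr0 rmorph0 mul0r.
    rewrite addnS.
    have -> : x_ (n + k).+1 - x_ n = (x_ (n + k).+1 - x_ (n + k)%N) + (x_ (n + k)%N - x_ n).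
      by rewrite addrA subrK.
    have -> : s (n + k).+1 - s n = (s (n + k).+1 - s (n + k)%N) + (s (n + k)%N - s n).
      by rewrite addrA subrK.
    by rewrite rmorphD mulrDl (le_trans (ler_normD _ _)) // lerD.
  move=> /le_trans; apply; rewrite ler_wpM2r // ler_Cr lerB // sqrt_iter_le1 //.
have : cauchy (x_ @ \oo).
  apply: cauchy_exP => e e0.
  have K1 : 0 < re K + 1 by rewrite ltr_wpDl // re_ge0.
  have [|n hn] := @sqrt_iter_cvg1 R (re e / (re K + 1)).
    by rewrite divr_gt0 // re_gt0.
  exists (x_ n); exists n => // m /= nm; rewrite -ball_normE /= distrC.
  rewrite -(subnKC nm) (le_lt_trans (hk _ _)) // -[K]Cr_re_ge0 // -[e in ltRHS]Cr_re_ge0 ?(ltW e0) //.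
  rewrite -rmorphM ltr_Cr; move: hn; rewrite ltr_pdivlMr // => hn.
  have := sqrt_iter_le1 R n; nra.
move/cauchy_cvg => /cvg_ex [l xl]; exists l => n.
apply/ler_addgt0Pr => e e0.
have /cvgrPdist_lt /(_ e e0) [N _ hN] := xl.
have := hN (N + n)%N (leq_addr _ _) => /= hl.
have -> : l - x_ n = (x_ (n + N)%N - x_ n) + (l - x_ (N + n)%N).
  by rewrite [in RHS]addrC addnC addrA subrK.
by rewrite (le_trans (ler_normD _ _)) // lerD // ltW.
Qed.

End iteration_limits.

Section operator_sqrt.
Variables (R : realType).
Local Notation C := (Cplx R).
Local Notation s := (sqrt_iter R).
Variables (H : hilbertType C) (B : H -> H).
Hypothesis linB : linear B.
Hypothesis normB : forall x, `|B x| <= `|x|.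
Hypothesis adjB : forall x y, dot (B x) y = dot x (B y).

(** The scalar recursion with the operator [B] in place of 1; the iterates tend strongly to 1 - sqrt
    (1 - B). *)
Fixpoint op_sqrt_iter (n : nat) (x : H) : H :=
  if n is m.+1 then 2^-1 *: (B x + op_sqrt_iter m (op_sqrt_iter m x)) else 0.
Local Notation Y := op_sqrt_iter.

Lemma op_sqrt_iter_linear n : linear (Y n).
Proof.
elim: n => [|n IH] c x y /=; first by rewrite scaler0 addr0.
rewrite linB !IH scalerA mulrC -scalerA -scalerDr; congr (_ *: _).
by rewrite scalerDr addrACA.
Qed.

Lemma op_sqrt_iterB n x y : Y n (x - y) = Y n x - Y n y.
Proof. by rewrite addrC -scaleN1r op_sqrt_iter_linear scaleN1r addrC. Qed.

Lemma op_sqrt_iter_norm n x : `|Y n x| <= Cr (s n) * `|x|.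
Proof.
elim: n x => [|n IH] x /=; first by rewrite normr0 rmorph0 mul0r.
rewrite normrZ ger0_norm ?invr_ge0 ?ler0n //.
rewrite rmorphM fmorphV rmorph_nat -mulrA mulrCA ler_wpM2l ?invr_ge0 ?ler0n //.
rewrite (le_trans (ler_normD _ _)) // rmorphD rmorph1 mulrDl mul1r lerD //.
rewrite (le_trans (IH _)) // rmorphXn expr2 -mulrA ler_wpM2l //.
by rewrite Cr_ge0 sqrt_iter_ge0.
Qed.

Lemma op_sqrt_iter_comm (S : H -> H) : linear S -> (forall x, S (B x) = B (S x)) ->
  forall n x, S (Y n x) = Y n (S x).
Proof.
move=> linS SB; have S0 : S 0 = 0 by rewrite -[0 in LHS](addNr (0 : H)) -scaleN1r linS scaleN1r addNr.
have SZ c x : S (c *: x) = c *: S x by rewrite -[c *: x]addr0 linS S0 addr0.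
have SD x y : S (x + y) = S x + S y by rewrite -[x]scale1r linS !scale1r.
by elim=> [|n IH] x //=; rewrite SZ SD SB !IH.
Qed.

Lemma op_sqrt_iter_commB n x : B (Y n x) = Y n (B x).
Proof. exact: op_sqrt_iter_comm. Qed.

Lemma op_sqrt_iter_comm2 m n x : Y m (Y n x) = Y n (Y m x).
Proof.
by apply: op_sqrt_iter_comm (op_sqrt_iter_linear m) _ n x => y; rewrite op_sqrt_iter_commB.
Qed.

(** The iterates commute, so consecutive differences factor as d_{n+1} = (Y_{n+1} + Y_n) d_n / 2.
    The scalar sequence obeys the same identity, and the bound passes from one to the other by
    induction. *)
Lemma op_sqrt_iter_step n x : `|Y n.+1 x - Y n x| <= Cr (s n.+1 - s n) * `|x|.
Proof.
elim: n x => [|n IH] x.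
  rewrite /= !subr0 addr0 normrZ ger0_norm ?invr_ge0 ?ler0n //.
  rewrite expr0n /= addr0 mul1r fmorphV rmorph_nat ler_wpM2l ?invr_ge0 ?ler0n //.
set d := Y n.+1 x - Y n x.
have -> : Y n.+2 x - Y n.+1 x = 2^-1 *: (Y n.+1 d + Y n d).
  rewrite /d !op_sqrt_iterB [Y n (Y n.+1 x)]op_sqrt_iter_comm2 addrA subrK.
  rewrite [in LHS]/= -/(Y n.+1) -scalerBr; congr (_ *: _).
  by rewrite opprD addrACA subrr add0r.
have -> : s n.+2 - s n.+1 = 2^-1 * ((s n.+1 + s n) * (s n.+1 - s n)).
  rewrite [s n.+2]/= -/(s n.+1).
  by rewrite [s n.+1 in X in _ - X]/= ; field.
rewrite normrZ ger0_norm ?invr_ge0 ?ler0n // rmorphM fmorphV rmorph_nat -mulrA.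
rewrite ler_wpM2l ?invr_ge0 ?ler0n // (le_trans (ler_normD _ _)) //.
have hd := IH x; rewrite -/d in hd.
rewrite rmorphM rmorphD -mulrA mulrDl.
by rewrite lerD // (le_trans (op_sqrt_iter_norm _ _)) // ler_wpM2l // Cr_ge0 sqrt_iter_ge0.
Qed.

Lemma op_sqrt_iter_adj n x y : dot (Y n x) y = dot x (Y n y).
Proof.
elim: n x y => [|n IH] x y /=; first by rewrite linear0l linear0r.
by rewrite dotZl dotZr dotDl dotDr adjB !IH geC0_conj // invr_ge0.
Qed.

(** The strong limit Z of the iterates solves 2 Z = B + Z^2, so Q = 1 - Z has square 1 - B.
    Positivity of Q comes from |Z x| <= |x| together with the reality of <Z x, x>; commutation with
    S passes from the iterates to the limit. *)
Lemma op_sqrt_one_minus : exists Q : H -> H,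
  [/\ linear Q, forall x, `|Q x| <= `|x| *+ 2,
      forall x, 0 <= dot (Q x) x,
      forall x, Q (Q x) = x - B x &
      forall (S : H -> H) (M : C), linear S -> (forall x, `|S x| <= M * `|x|) ->
        (forall x, S (B x) = B (S x)) -> forall x, S (Q x) = Q (S x)].
Proof.
have /choice [Z hZ] : forall x, exists l, forall n, `|l - Y n x| <= Cr (1 - s n) * `|x|.
  by move=> x; apply: sqrt_iter_limit => // n; exact: op_sqrt_iter_step.
have s1 n : 0 <= Cr (1 - s n) by rewrite Cr_ge0 subr_ge0 sqrt_iter_le1.
have linZ : linear Z.
  move=> c x y; apply/eqP; rewrite -subr_eq0; apply/eqP.
  apply: (@sqrt_iter_squeeze R _ _ (`|c *: x + y| + (`|c| * `|x| + `|y|))).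
    by rewrite !addr_ge0 // mulr_ge0.
  move=> n; have -> : Z (c *: x + y) - (c *: Z x + Z y) =
    (Z (c *: x + y) - Y n (c *: x + y)) - (c *: (Z x - Y n x) + (Z y - Y n y)).
    by rewrite op_sqrt_iter_linear scalerBr addrACA -opprD opprB addrA subrK.
  rewrite (le_trans (ler_normB _ _)) // mulrDr lerD // (le_trans (ler_normD _ _)) //.
  by rewrite mulrDr lerD // normrZ mulrCA ler_wpM2l.
have ZB x y : Z (x - y) = Z x - Z y by rewrite addrC -scaleN1r linZ scaleN1r addrC.
have normZ x : `|Z x| <= `|x|.
  rewrite -(subrK (Y 0 x) (Z x)) (le_trans (ler_normD _ _)) // [Y 0 x]/= normr0 addr0.
  by rewrite (le_trans (hZ x 0)) // subr0 rmorph1 mul1r.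
have commZ (S : H -> H) (M : C) : linear S -> (forall x, `|S x| <= M * `|x|) ->
    (forall x, S (B x) = B (S x)) -> forall x, S (Z x) = Z (S x).
  move=> linS normS SB x; apply/eqP; rewrite -subr_eq0; apply/eqP.
  have SBl u v : S (u - v) = S u - S v by rewrite addrC -scaleN1r linS scaleN1r addrC.
  apply: (@sqrt_iter_squeeze R _ _ (`|M| * `|x| + `|S x|)).
    by rewrite addr_ge0 // mulr_ge0.
  move=> n; have -> : S (Z x) - Z (S x) = S (Z x - Y n x) - (Z (S x) - Y n (S x)).
    by rewrite SBl op_sqrt_iter_comm // opprB addrA subrK.
  rewrite (le_trans (ler_normB _ _)) // mulrDr lerD //.
  rewrite (le_trans (normS _)) // mulrCA (@le_trans _ _ (`|M| * `|Z x - Y n x|)) ?ler_wpM2l //.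
  have [->|z0] := eqVneq (Z x - Y n x) 0; first by rewrite normr0 !mulr0.
  have zp : 0 < `|Z x - Y n x| by rewrite normr_gt0.
  have Mge : 0 <= M by have := le_trans (normr_ge0 _) (normS (Z x - Y n x)); rewrite pmulr_lge0.
  by rewrite ger0_norm.
have quadZ x : Z x *+ 2 = B x + Z (Z x).
  apply/eqP; rewrite -subr_eq0; apply/eqP.
  apply: (@sqrt_iter_squeeze R _ _ (`|x| *+ 4)); first by rewrite mulrn_wge0.
  move=> n.
  have -> : Z x *+ 2 - (B x + Z (Z x)) =
    (Z x - Y n.+1 x) *+ 2 - ((Z (Z x) - Y n (Z x)) + Y n (Z x - Y n x)).
    rewrite op_sqrt_iterB addrA subrK mulrnBl.
    have -> : Y n.+1 x *+ 2 = B x + Y n (Y n x).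
      by rewrite /= -scaler_nat scalerA divff ?pnatr_eq0 // scale1r.
    by rewrite -[RHS]addrA -opprD [Z (Z x) - _]addrC [_ + (_ + Z (Z x))]addrA addrK.
  have -> : `|x| *+ 4 = `|x| *+ 2 + `|x| *+ 2 by rewrite -mulrnDr.
  rewrite (le_trans (ler_normB _ _)) // mulrDr lerD //.
    rewrite normrMn mulrnAr; apply: ler_wMn2r.
    by rewrite (le_trans (hZ _ _)) // ler_wpM2r // ler_Cr lerB // sqrt_iter_leS.
  rewrite (le_trans (ler_normD _ _)) // mulr2n mulrDr lerD //.
    by rewrite (le_trans (hZ _ _)) // ler_wpM2l.
  rewrite (le_trans (op_sqrt_iter_norm _ _)) // (le_trans _ (hZ x n)) // ler_piMl //.
  by rewrite -(rmorph1 (@Cr R)) ler_Cr sqrt_iter_le1.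
have adjZ x : dot (Z x) x \is Num.real.
  rewrite CrealE -subr_eq0 -dotC; apply/eqP.
  apply: (@sqrt_iter_squeeze R C _ (`|x| * `|x| *+ 2)); first by rewrite mulrn_wge0 // mulr_ge0.
  move=> n; have -> : dot x (Z x) - dot (Z x) x = dot x (Z x - Y n x) - dot (Z x - Y n x) x.
    by rewrite dotBl dotBr op_sqrt_iter_adj opprB addrA subrK.
  rewrite (le_trans (ler_normB _ _)) // mulr2n mulrDr.
  rewrite lerD // (le_trans (Cauchy_Schwarz _ _)) //; last by rewrite mulrA ler_wpM2r.
  by rewrite mulrC mulrA ler_wpM2r.
exists (fun x => x - Z x); split.
- by move=> c x y; rewrite linZ scalerBr opprD addrACA.
- by move=> x; rewrite (le_trans (ler_normB _ _)) // mulr2n lerD.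
- move=> x; rewrite dotBl subr_ge0 -sqr_normE.
  rewrite (le_trans (real_ler_norm (adjZ x))) // (le_trans (Cauchy_Schwarz _ _)) //.
  by rewrite expr2 ler_wpM2r.
- move=> x; rewrite ZB.
  have -> : Z x - Z (Z x) = B x - Z x.
    have -> : Z (Z x) = Z x *+ 2 - B x by rewrite quadZ addrC addKr.
    by rewrite mulr2n -addrA opprD addrA subrr add0r opprB.
  by rewrite opprB addrA subrK.
- move=> S M linS normS SB x.
  have SBl u v : S (u - v) = S u - S v by rewrite addrC -scaleN1r linS scaleN1r addrC.
  by rewrite SBl (commZ S M).
Qed.

End operator_sqrt.

(** * Schur's lemma for irreducible families *)

Section schur.
Variables (R : realType).
Local Notation C := (Cplx R).
Variables (I : Type) (H : hilbertType C) (T : op_family I H).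
Hypothesis irrT : irreducible T.
Hypothesis normT : forall i x, `|op T i x| <= `|x| /\ `|adj T i x| <= `|x|.

Definition commutes_with (S : H -> H) :=
  forall i x, S (op T i x) = op T i (S x) /\ S (adj T i x) = adj T i (S x).

(** The kernel of a bounded operator commuting with the family is a closed invariant subspace. *)
Lemma irreducible_ker (S : H -> H) (M : C) : linear S -> (forall x, `|S x| <= M * `|x|) ->
  commutes_with S -> (forall x, S x = 0 -> x = 0) \/ (forall x, S x = 0).
Proof.
move=> linS normS commS.
have S0 : S 0 = 0 by rewrite -[0 in LHS](addNr (0 : H)) -scaleN1r linS scaleN1r addNr.
have [| | | |W0|WT] := irrT.2 [set x | S x = 0].
- exact: closed_eq_ker normS.
- exact: S0.
- by move=> c x y /= Sx Sy; rewrite linS Sx Sy scaler0 addr0.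
- by move=> i x /= Sx; have [-> ->] := commS i x; rewrite Sx !linear0.
- left=> x Sx; have : [set x | S x = 0] x by [].
  by rewrite W0.
- right=> x; have : [set: H] x by [].
  by rewrite -WT.
Qed.

Section selfadjoint.
Variable S : H -> H.
Hypothesis linS : linear S.
Hypothesis normS : forall x, `|S x| <= `|x|.
Hypothesis adjS : forall x y, dot (S x) y = dot x (S y).
Hypothesis commS : commutes_with S.

(** Let Q = |S| be the root of S^2. Then Q + S commutes with the family and (Q + S)(Q - S) = 0. By
    irreducibility Q + S is injective, and then S = Q is positive, or it vanishes, and then S = -Q
    is negative. This replaces the spectral theorem. *)
Lemma schur_sign : (forall x, 0 <= dot (S x) x) \/ (forall x, dot (S x) x <= 0).
Proof.
have SB u v : S (u - v) = S u - S v by rewrite addrC -scaleN1r linS scaleN1r addrC.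
have SD u v : S (u + v) = S u + S v by rewrite -[u]scale1r linS !scale1r.
(* With this [B] the available root of 1 - B is |S|. *)
pose B x := x - S (S x).
have linB : linear B by move=> c x y; rewrite /B !linS scalerBr opprD addrACA.
have normB x : `|B x| <= `|x|.
  rewrite -ler_sqr ?nnegrE // !sqr_normE /B dotBl !dotBr -!sqr_normE.
  rewrite !adjS [dot x (S (S x))]dotC adjS -[(dot _ _)^*]dotC -!sqr_normE.
  rewrite opprB addrA.
  have h1 : `|S (S x)| ^+ 2 <= `|S x| ^+ 2 by rewrite ler_sqr ?nnegrE.
  rewrite -subr_ge0.
  have -> : `|x| ^+ 2 - (`|x| ^+ 2 - `|S x| ^+ 2 + `|S (S x)| ^+ 2 - `|S x| ^+ 2) =
            `|S x| ^+ 2 + (`|S x| ^+ 2 - `|S (S x)| ^+ 2) by ring.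
  by rewrite addr_ge0 ?exprn_ge0 // subr_ge0.
have adjB x y : dot (B x) y = dot x (B y) by rewrite /B dotBl dotBr !adjS.
have [Q [linQ normQ posQ QQ commQ]] := op_sqrt_one_minus linB normB adjB.
have QQ' x : Q (Q x) = S (S x) by rewrite QQ /B opprB addrC subrK.
have QS x : S (Q x) = Q (S x).
  apply: (commQ S 1) => // y; first by rewrite mul1r.
  by rewrite /B SB.
have QB u v : Q (u - v) = Q u - Q v by rewrite addrC -scaleN1r linQ scaleN1r addrC.
pose W x := Q x + S x.
have linW : linear W by move=> c x y; rewrite /W linQ linS scalerDr addrACA.
have normW x : `|W x| <= 3%:R * `|x|.
  by rewrite mulr_natl mulrSr (le_trans (ler_normD _ _)) // lerD.
have commW : commutes_with W.
  move=> i x; have [h1 h2] := commS i x; have [n1 n2] := (fun y => (normT i y).1, fun y => (normT i y).2).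
  have l1 : linear (op T i) by exact: linearP.
  have l2 : linear (adj T i) by exact: linearP.
  split; rewrite /W linearD ?h1 ?h2; congr (_ + _); symmetry; apply: commQ 1 _ _ _ _ => //.
  - by move=> y; rewrite mul1r.
  - by move=> y; rewrite /B linearB !(commS i _).1.
  - by move=> y; rewrite mul1r.
  - by move=> y; rewrite /B linearB !(commS i _).2.
have [W0|W0] := irreducible_ker linW normW commW; [left|right] => x.
  have : W (Q x - S x) = 0.
    by rewrite /W QB SB QQ' QS addrC -addrA [Q (S x) + _]addrC ?addrA subrK addrC subrr.
  by move=> /W0 /eqP; rewrite subr_eq0 => /eqP <-.
have /eqP := W0 x; rewrite /W addr_eq0 => /eqP.
by move=> /(congr1 -%R); rewrite opprK => <-; rewrite dotNl oppr_le0.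
Qed.

End selfadjoint.

(** Expand 0 <= <G (x - G x), x - G x> and bound <G (G x), G x> by |G x|^2. It turns a zero of the
    quadratic form into a vector of the kernel. *)
Lemma psd_sqr_norm_le (G : H -> H) : linear G -> (forall x, `|G x| <= `|x|) ->
  (forall x y, dot (G x) y = dot x (G y)) -> (forall x, 0 <= dot (G x) x) ->
  forall x, `|G x| ^+ 2 <= dot (G x) x.
Proof.
move=> linG normG adjG posG x.
have GB u v : G (u - v) = G u - G v by rewrite addrC -scaleN1r linG scaleN1r addrC.
have := posG (x - G x); rewrite GB dotBl !dotBr -!sqr_normE (adjG (G x) x) -sqr_normE.
have : dot (G (G x)) (G x) <= `|G x| ^+ 2.
  rewrite (le_trans (real_ler_norm _)) ?ger0_real // (le_trans (Cauchy_Schwarz _ _)) //.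
  by rewrite expr2 ler_wpM2r.
move: (dot (G (G x)) _) (dot (G x) x) (`|G x| ^+ 2) => a b d ad h.
rewrite -subr_ge0; apply: le_trans (_ : b - d - (d - a) + (d - a) <= _); first by rewrite addr_ge0 // subr_ge0.
by rewrite subrK.
Qed.

(** Take for c the expectation of S at a unit multiple of x0. Then S - c has a definite sign and its
    form vanishes at x0, so x0 lies in its kernel, which by irreducibility is everything. *)
Lemma schur_selfadjoint (S : H -> H) : linear S -> (forall x, `|S x| <= `|x|) ->
  (forall x y, dot (S x) y = dot x (S y)) -> commutes_with S ->
  exists c : C, forall x, S x = c *: x.
Proof.
move=> linS normS adjS commS; have [x0 x0N0] := irrT.1.
have nx0 : `|x0| ^+ 2 != 0 by rewrite expf_neq0 // normr_eq0.
pose c := dot (S x0) x0 / `|x0| ^+ 2; exists c.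
have creal : c^* = c.
  by rewrite /c rmorphM fmorphV /= [(_ ^+ 2)^*]geC0_conj ?exprn_ge0 // -dotC adjS.
have c1 : `|c| <= 1.
  rewrite normrM normfV [`| _ ^+ 2|]ger0_norm ?exprn_ge0 // ler_pdivrMr; last first.
    by rewrite lt_def nx0 exprn_ge0.
  by rewrite mul1r (le_trans (Cauchy_Schwarz _ _)) // expr2 ler_wpM2r.
(* The factor 1/2 keeps S - c a contraction, since |c| <= 1. *)
pose G x := 2^-1 *: (S x - c *: x).
have linG : linear G.
  move=> a x y; rewrite /G linS [c *: _]scalerDr scalerA [c * a]mulrC -scalerA.
  by rewrite opprD addrACA -scalerBr scalerDr !scalerA [2^-1 * a]mulrC.
have normG x : `|G x| <= `|x|.
  rewrite /G normrZ ger0_norm ?invr_ge0 ?ler0n // ler_pdivrMl ?ltr0n // mulr_natl mulr2n.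
  by rewrite (le_trans (ler_normB _ _)) // lerD // normrZ ler_piMl.
have adjG x y : dot (G x) y = dot x (G y).
  by rewrite /G dotZl dotZr dotBl dotBr adjS dotZl dotZr creal geC0_conj //.
have commG : commutes_with G.
  move=> i x; have [h1 h2] := commS i x; rewrite /G h1 h2.
  by split; rewrite [in RHS]linearZ_LR [in RHS]linearB [in RHS]linearZ_LR.
have G0 : dot (G x0) x0 = 0.
  by rewrite /G dotZl dotBl dotZl -sqr_normE /c divfK // subrr mulr0.
have Gx0 : G x0 = 0.
  have [pG|pG] := schur_sign linG normG adjG commG.
    have := psd_sqr_norm_le linG normG adjG pG x0; rewrite G0 => h.
    apply/eqP; rewrite -normr_eq0 -sqrf_eq0; apply/eqP/le_anti.
    by rewrite h exprn_ge0.
  have linNG : linear (fun x => - G x).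
    by move=> a x y; rewrite linG scalerN opprD.
  have h : `|- G x0| ^+ 2 <= dot (- G x0) x0.
    apply: (psd_sqr_norm_le linNG) => [x|x y|x].
    - by rewrite normrN.
    - by rewrite dotNl dotNr adjG.
    - by rewrite dotNl oppr_ge0.
  move: h; rewrite dotNl G0 oppr0 normrN => h.
  apply/eqP; rewrite -normr_eq0 -sqrf_eq0; apply/eqP/le_anti.
  by rewrite h exprn_ge0.
have [G1|G1] : (forall x, G x = 0 -> x = 0) \/ (forall x, G x = 0).
    by apply: (@irreducible_ker G 1) => // x; rewrite mul1r.
  by move: x0N0; rewrite (G1 _ Gx0) eqxx.
move=> x; have /eqP := G1 x.
by rewrite /G scaler_eq0 invr_eq0 pnatr_eq0 /= subr_eq0 => /eqP.
Qed.

(** The self-adjoint case applies to a N + a^* N' with a = 1/2 and a = i/2, which are the real part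
    of N and minus its imaginary part. *)
Lemma schur (N N' : H -> H) : linear N -> linear N' ->
  (forall x, `|N x| <= `|x|) -> (forall x, `|N' x| <= `|x|) ->
  (forall x y, dot (N x) y = dot x (N' y)) ->
  commutes_with N -> commutes_with N' -> exists c : C, forall x, N x = c *: x.
Proof.
move=> lN lN' nN nN' adjN cN cN'.
have adjN' x y : dot (N' x) y = dot x (N y) by rewrite dotC -adjN -dotC.
pose G (a : C) x := a *: N x + a^* *: N' x.
have hG (a : C) : `|a| <= 2^-1 -> exists c : C, forall x, G a x = c *: x.
  move=> a2; apply: schur_selfadjoint.
  - move=> b x y; rewrite /G lN lN' !scalerDr !scalerA [a * b]mulrC [a^* * b]mulrC.
    by rewrite addrACA.
  - move=> x; rewrite /G (le_trans (ler_normD _ _)) // !normrZ norm_conjC.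
    have -> : `|x| = 2^-1 * `|x| + 2^-1 * `|x| by field.
    by rewrite lerD // ler_pM.
  - by move=> x y; rewrite /G dotDl dotDr !dotZl !dotZr conjCK adjN adjN' addrC.
  - move=> i x; have [h1 h2] := cN i x; have [h3 h4] := cN' i x.
    by rewrite /G h1 h2 h3 h4; split; rewrite [in RHS]linearD ![in RHS]linearZ_LR.
have n2 : `|2^-1 : C| <= 2^-1 by rewrite ger0_norm // invr_ge0 ler0n.
have [c1 h1] := hG 2^-1 n2.
have [|c2 h2] := hG ('i * 2^-1); first by rewrite normrM normCi mul1r.
exists (c1 - 'i * c2) => x.
have c2E : (2^-1 : C)^* = 2^-1 by rewrite geC0_conj // invr_ge0 ler0n.
have ci : ('i * 2^-1 : C)^* = - ('i * 2^-1) by rewrite rmorphM /= conjCi c2E mulNr.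
rewrite scalerBl -h1 -scalerA -h2 /G ci c2E.

rewrite scalerDr !scalerA mulrN !mulrA -expr2 sqrCi mulN1r opprK.
rewrite opprD -!scaleNr opprK addrACA -!scalerDl subrr scale0r addr0.
by rewrite -[LHS]scale1r; congr (_ *: _); field.
Qed.

End schur.

(** * Elementary identities in C*-algebras *)

Section cstar_algebra.
Variables (C : numClosedFieldType) (A : cstarAlgType C).
Implicit Types x y z : A.

Lemma amul0a x : amul 0 x = 0.
Proof. by have := amulZl 0 (0 : A) x; rewrite !scale0r. Qed.
Lemma amula0 x : amul x 0 = 0.
Proof. by have := amulZr 0 x (0 : A); rewrite !scale0r. Qed.
Lemma amulNl x y : amul (- x) y = - amul x y.
Proof. by rewrite -scaleN1r amulZl scaleN1r. Qed.
Lemma amulNr x y : amul x (- y) = - amul x y.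
Proof. by rewrite -scaleN1r amulZr scaleN1r. Qed.
Lemma amulBl x y z : amul (x - y) z = amul x z - amul y z.
Proof. by rewrite amulDl amulNl. Qed.
Lemma amulBr x y z : amul z (x - y) = amul z x - amul z y.
Proof. by rewrite amulDr amulNr. Qed.
Lemma star0 : star (0 : A) = 0.
Proof. by have := starZ 0 (0 : A); rewrite !scale0r rmorph0 scale0r. Qed.
Lemma starN x : star (- x) = - star x.
Proof. by rewrite -scaleN1r starZ rmorphN rmorph1 scaleN1r. Qed.
Lemma starB x y : star (x - y) = star x - star y.
Proof. by rewrite starD starN. Qed.
Lemma star1 : star (aone : A) = aone.
Proof. by rewrite -[LHS]amul1a -{1}[aone]starK -starM amul1a starK. Qed.

Lemma norm_star x : `|star x| = `|x|.
Proof.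
suff h z : `|z| <= `|star z| by apply/le_anti; rewrite -[X in _ <= `|X|]starK !h.
have [->|z0] := eqVneq z 0; first by rewrite normr0.
have zp : 0 < `|z| by rewrite normr_gt0.
by rewrite -(ler_pM2r zp) -expr2 -cstar_id ler_norm_amul.
Qed.

Lemma amul_suml (J : Type) (s : seq J) (F : J -> A) y :
  amul (\sum_(j <- s) F j) y = \sum_(j <- s) amul (F j) y.
Proof. by elim/big_rec2: _ => [|j a b _ <-]; rewrite ?amul0a // amulDl. Qed.
Lemma amul_sumr (J : Type) (s : seq J) (F : J -> A) y :
  amul y (\sum_(j <- s) F j) = \sum_(j <- s) amul y (F j).
Proof. by elim/big_rec2: _ => [|j a b _ <-]; rewrite ?amula0 // amulDr. Qed.
Lemma star_sum (J : Type) (s : seq J) (F : J -> A) :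
  star (\sum_(j <- s) F j) = \sum_(j <- s) star (F j).
Proof. by elim/big_rec2: _ => [|j a b _ <-]; rewrite ?star0 // starD. Qed.
End cstar_algebra.

(** * Evaluation of noncommutative polynomials *)

Section starpoly.
Variables (C : numClosedFieldType) (I : Type).
Implicit Types p q : starpoly C I.
Local Notation word := (seq (I * bool)).

Definition word_eval (A : cstarAlgType C) (a : I -> A) (w : word) : A :=
  foldr (fun l y => amul (if l.2 then star (a l.1) else a l.1) y) aone w.

Lemma word_eval_cat (A : cstarAlgType C) (a : I -> A) v w :
  word_eval a (v ++ w) = amul (word_eval a v) (word_eval a w).
Proof. by elim: v => [|l v IH] /=; rewrite ?amul1a // IH amulA. Qed.

Definition star_word (w : word) : word := rev [seq (l.1, ~~ l.2) | l <- w].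

Lemma word_eval_star (A : cstarAlgType C) (a : I -> A) w :
  word_eval a (star_word w) = star (word_eval a w).
Proof.
elim: w => [|l w IH]; first by rewrite /= star1.
rewrite /star_word /= rev_cons -cats1 word_eval_cat [in RHS]/= starM -IH.
by congr amul; rewrite /= amula1; case: l.2; rewrite /= ?starK.
Qed.

(** The formal sums are never normalised or quotiented; these operations matter only through their
    evaluations, which make the range of [starpoly_eval] a subalgebra closed under adjoints. *)
Definition starpoly_lin (c : C) p q : starpoly C I := [seq (c * m.1, m.2) | m <- p] ++ q.
Definition starpoly_mul p q : starpoly C I :=
  [seq (m.1 * n.1, m.2 ++ n.2) | m <- p, n <- q].
Definition starpoly_star p : starpoly C I := [seq (m.1^*, star_word m.2) | m <- p].

Lemma starpoly_evalE (A : cstarAlgType C) (a : I -> A) p :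
  starpoly_eval a p = \sum_(m <- p) m.1 *: word_eval a m.2.
Proof. by []. Qed.

Lemma starpoly_eval_lin (A : cstarAlgType C) (a : I -> A) c p q :
  starpoly_eval a (starpoly_lin c p q) = c *: starpoly_eval a p + starpoly_eval a q.
Proof.
rewrite !starpoly_evalE big_cat big_map scaler_sumr; congr (_ + _).
by apply: eq_bigr => m _; rewrite scalerA.
Qed.

Lemma starpoly_eval_mul (A : cstarAlgType C) (a : I -> A) p q :
  starpoly_eval a (starpoly_mul p q) = amul (starpoly_eval a p) (starpoly_eval a q).
Proof.
rewrite !starpoly_evalE big_allpairs_dep amul_suml; apply: eq_bigr => m _.
rewrite amul_sumr; apply: eq_bigr => n _.
by rewrite amulZl amulZr scalerA -word_eval_cat.
Qed.

Lemma starpoly_eval_star (A : cstarAlgType C) (a : I -> A) p :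
  starpoly_eval a (starpoly_star p) = star (starpoly_eval a p).
Proof.
rewrite !starpoly_evalE big_map star_sum; apply: eq_bigr => m _.
by rewrite starZ word_eval_star.
Qed.

Lemma starpoly_eval_gen (A : cstarAlgType C) (a : I -> A) i :
  starpoly_eval a [:: (1, [:: (i, false)])] = a i.
Proof. by rewrite starpoly_evalE big_seq1 scale1r /= amula1. Qed.

Lemma starpoly_eval_one (A : cstarAlgType C) (a : I -> A) :
  starpoly_eval a [:: (1, [::])] = aone.
Proof. by rewrite starpoly_evalE big_seq1 scale1r. Qed.

Lemma starpoly_eval_nil (A : cstarAlgType C) (a : I -> A) : starpoly_eval a [::] = 0.
Proof. by rewrite starpoly_evalE big_nil. Qed.
End starpoly.

(** The order is partial, but positive elements are real and therefore comparable. *)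
Lemma common_radius (C : numDomainType) (e e' : C) : 0 < e -> 0 < e' ->
  exists2 d, 0 < d & d <= e /\ d <= e'.
Proof.
move=> e0 e'0; have [h|/ltW h] := real_leP (gtr0_real e0) (gtr0_real e'0).
  by exists e.
by exists e'.
Qed.

(** * Uniqueness of the enveloping algebra *)

Section isometric_extension.
Variables (C : numClosedFieldType) (I : Type) (A B : cstarAlgType C).
Variables (a : I -> A) (b : I -> B).
Hypothesis dense_a : closure (range (starpoly_eval a)) = setT.
Hypothesis isom : forall p, `|starpoly_eval a p| = `|starpoly_eval b p|.

(** The graph of the isometric extension: x and y are approximated by evaluations of the same
    polynomials. The algebraic properties are proved for this relation, which is symmetric in the
    two algebras, before a map is chosen. *)
Definition corresponds (x : A) (y : B) := forall e : C, 0 < e ->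
  exists p, `|x - starpoly_eval a p| < e /\ `|y - starpoly_eval b p| < e.

Lemma dense_starpoly x (e : C) : 0 < e -> exists p, `|x - starpoly_eval a p| < e.
Proof.
move=> e0; have : closure (range (starpoly_eval a)) x by rewrite dense_a.
move=> /(_ (ball x e) (nbhsx_ballx _ _ e0)) [_ [[p _ <-]]].
by rewrite -ball_normE => h; exists p.
Qed.

Lemma corresponds_norm x y : corresponds x y -> `|x| = `|y|.
Proof.
have aux (V W : normedModType C) (u P : V) (v Q : W) (e : C) :
    `|u - P| < e / 2 -> `|v - Q| < e / 2 -> `|P| = `|Q| -> `|u| <= `|v| + e.
  move=> uP vQ PQ; rewrite -(subrK P u) (le_trans (ler_normD _ _)) // PQ -(subKr v Q).
  have -> : `|v| + e = e / 2 + (`|v| + e / 2) by rewrite addrCA -splitr.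
  rewrite lerD // ?(ltW uP) // (le_trans (ler_normB _ _)) // lerD //.
  exact: ltW.
move=> h; apply/le_anti/andP; split; apply/ler_addgt0Pr => e e0;
  have [|p [h1 h2]] := h (e / 2); rewrite ?divr_gt0 //.
- exact: aux h1 h2 (isom p).
- exact: aux h2 h1 (esym (isom p)).
Qed.

Lemma corresponds_lin c x y x' y' : corresponds x y -> corresponds x' y' ->
  corresponds (c *: x + x') (c *: y + y').
Proof.
move=> h h' e e0.
have c1 : 0 < `|c| + 1 by rewrite ltr_wpDl.
have [|p [p1 p2]] := h (e / 2 / (`|c| + 1)); first by rewrite !divr_gt0.
have [|q [q1 q2]] := h' (e / 2); first by rewrite !divr_gt0.
have aux (V : normedModType C) (u u' v v' : V) : `|u - v| < e / 2 / (`|c| + 1) ->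
    `|u' - v'| < e / 2 -> `|c *: u + u' - (c *: v + v')| < e.
  move=> uv uv'; rewrite opprD addrACA -scalerBr (splitr e).
  rewrite (le_lt_trans (ler_normD _ _)) // ler_ltD // normrZ.
  move: uv; rewrite ltr_pdivlMr // => /ltW; apply: le_trans.
  by rewrite mulrC ler_wpM2l // lerDl.
by exists (starpoly_lin c p q); rewrite !starpoly_eval_lin; split; apply: aux.
Qed.

Lemma corresponds_star x y : corresponds x y -> corresponds (star x) (star y).
Proof.
move=> h e /h [p [h1 h2]]; exists (starpoly_star p).
by rewrite !starpoly_eval_star -!starB !norm_star.
Qed.

Lemma corresponds_mul x y x' y' : corresponds x y -> corresponds x' y' ->
  corresponds (amul x x') (amul y y').
Proof.
move=> h h' e e0.
have c1 : 0 < `|x'| + 1 by rewrite ltr_wpDl.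
have c2 : 0 < `|x| + 1 by rewrite ltr_wpDl.
(* The bound [d <= 1] keeps the norm of the first approximants below [|x| + 1]. *)
have [||d d0 [de d1]] := @common_radius C (e / 2 / (`|x'| + 1)) 1; rewrite ?divr_gt0 //.
have [p [p1 p2]] := h _ d0.
have [|q [q1 q2]] := h' (e / 2 / (`|x| + 1)); first by rewrite !divr_gt0.
have nx := corresponds_norm h; have nx' := corresponds_norm h'.
have aux (V : cstarAlgType C) (u u' v v' : V) : `|u| = `|x| -> `|u'| = `|x'| ->
    `|u - v| < d ->
    `|u' - v'| < e / 2 / (`|x| + 1) -> `|amul u u' - amul v v'| < e.
  move=> nu nu' uvd uv'; have uv := lt_le_trans uvd de; have uv1 := lt_le_trans uvd d1.
  have -> : amul u u' - amul v v' = amul (u - v) u' + amul v (u' - v').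
    by rewrite amulBl amulBr addrA subrK.
  rewrite (le_lt_trans (ler_normD _ _)) // (splitr e) ler_ltD //.
    rewrite (le_trans (ler_norm_amul _ _)) // nu'.
    move: uv; rewrite ltr_pdivlMr // => /ltW; apply: le_trans.
    by rewrite ler_wpM2l // lerDl.
  rewrite (le_lt_trans (ler_norm_amul _ _)) //.
  move: uv'; rewrite ltr_pdivlMr //; apply: le_lt_trans.
  rewrite mulrC ler_wpM2l // -(subKr u v) (le_trans (ler_normB _ _)) // nu lerD //.
  exact: ltW.
exists (starpoly_mul p q); rewrite !starpoly_eval_mul.
by split; apply: aux => //; rewrite ?nx ?nx'.
Qed.

(** The evaluations in B of the polynomials close to x in A form a Cauchy filter base, because
    evaluations have equal norms in both algebras; completeness of B gives the partner of x. *)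
Lemma corresponds_ex x : exists y, corresponds x y.
Proof.
pose F := filter_from [set e : C | 0 < e]
  (fun e => [set starpoly_eval b p | p in [set p | `|x - starpoly_eval a p| < e]]).
have FF : ProperFilter F.
  apply: filter_from_proper; last first.
    by move=> e /dense_starpoly -/(_ x) [p hp]; exists (starpoly_eval b p), p.
  apply: filter_from_filter; first by exists 1 => /=.
  move=> e e' /= e0 e'0; have [d d0 [de de']] := common_radius e0 e'0; exists d => //.
  move=> _ [p /= hp <-].
  by split; exists p => //=; [exact: lt_le_trans de|exact: lt_le_trans de'].
have /cauchy_cvg /cvg_ex [y Fy] : cauchy F.
  apply: cauchy_exP => e e0.
  have [|p hp] := @dense_starpoly x (e / 2); first by rewrite divr_gt0.
  exists (starpoly_eval b p), (e / 2) => /=; first by rewrite divr_gt0.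
  move=> _ [q /= hq <-]; rewrite -ball_normE /=.
  have -> : starpoly_eval b p - starpoly_eval b q = starpoly_eval b (starpoly_lin (-1) q p).
    by rewrite starpoly_eval_lin scaleN1r addrC.
  rewrite -isom starpoly_eval_lin scaleN1r addrC.
  rewrite -(subrK x (starpoly_eval a p)) -addrA (splitr e).
  by rewrite (le_lt_trans (ler_normD _ _)) // ltrD // distrC.
exists y => e e0.
have [e' /= e'0 he'] := Fy (ball y e) (nbhsx_ballx _ _ e0).
have [d d0 [de de']] := common_radius e0 e'0.
have [p hp] := dense_starpoly x d0; exists p; split; first exact: lt_le_trans de.
have : ball y e (starpoly_eval b p) by apply: he'; exists p => //=; exact: lt_le_trans de'.
by rewrite -ball_normE.
Qed.

Lemma corresponds_uniq x y y' : corresponds x y -> corresponds x y' -> y = y'.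
Proof.
move=> h h'; have /corresponds_norm := corresponds_lin (-1) h h'.
by rewrite !scaleN1r addNr normr0 => /esym/eqP; rewrite normr_eq0 addrC subr_eq0 => /eqP.
Qed.

End isometric_extension.

(** The two norm conditions fix the norm of each evaluated polynomial as the least bound over the
    class, so it is the same in A and B. The identity on polynomials is then isometric between dense
    subalgebras and extends. *)
Lemma enveloping_iso (C : numClosedFieldType) (I : Type)
  (K : forall H : hilbertType C, op_family I H -> Prop) (A B : cstarAlgType C)
  (a : I -> A) (b : I -> B) : enveloping K a -> enveloping K b ->
  exists Phi : A -> B,
    [/\ forall c x y, Phi (c *: x + y) = c *: Phi x + Phi y,
        forall x y, Phi (amul x y) = amul (Phi x) (Phi y),
        forall x, Phi (star x) = star (Phi x),
        injective Phi & forall y, exists x, Phi x = y].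
Proof.
move=> [da ua la] [db ub lb].
have iso p : `|starpoly_eval a p| = `|starpoly_eval b p|.
  by apply/le_anti; rewrite la ?lb.
have osi p := esym (iso p).
have /choice [Phi hPhi] := corresponds_ex da iso.
have sym x y : corresponds a b x y -> corresponds b a y x.
  by move=> h e /h [p [h1 h2]]; exists p.
have uniq x y : corresponds a b x y -> Phi x = y.
  by move=> h; apply: (corresponds_uniq iso (hPhi x)).
exists Phi; split.
- by move=> c x y; apply: uniq; exact: corresponds_lin.
- by move=> x y; apply: uniq; exact: (corresponds_mul iso).
- by move=> x; apply: uniq; exact: corresponds_star.
- move=> x x' h; apply: (corresponds_uniq osi (sym _ _ (hPhi x))).
  by rewrite h; exact: sym.
- move=> y; have [x hx] := corresponds_ex db osi y; exists x.
  by apply: uniq => e /hx [p [h1 h2]]; exists p.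
Qed.

(** * Calculus of scalar anticommutators *)

Section anticommutator.
Variables (C : fieldType) (V : lmodType C).

Definition anti (f g : V -> V) (c : C) := forall x, f (g x) + g (f x) = c *: x.

Definition vec4 (a b c d : C) : 'I_4 -> C := fun i => nth 0 [:: a; b; c; d] i.

Definition lin4 (g : 'I_4 -> V -> V) (v : 'I_4 -> C) (x : V) : V := \sum_i v i *: g i x.

Definition gram4 (G : 'I_4 -> 'I_4 -> C) (v w : 'I_4 -> C) : C :=
  \sum_i \sum_j v i * w j * G i j.

Lemma lin4_linear g v : (forall i, linear (g i)) -> linear (lin4 g v).
Proof.
move=> lg c x y; rewrite /lin4 scaler_sumr -big_split; apply: eq_bigr => i _ /=.
by rewrite lg scalerDr !scalerA mulrC.
Qed.

Lemma anti_sym f g c : anti f g c -> anti g f c.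
Proof. by move=> h x; rewrite addrC h. Qed.

Lemma linear_sumE (f : V -> V) (J : Type) (s : seq J) (F : J -> V) : linear f ->
  f (\sum_(j <- s) F j) = \sum_(j <- s) f (F j).
Proof.
move=> lf; have f0 : f 0 = 0 by rewrite -[0 in LHS](addNr (0 : V)) -scaleN1r lf scaleN1r addNr.
by elim/big_rec2: _ => [|j a b _ <-] //; rewrite -[F j]scale1r lf !scale1r.
Qed.

Lemma linear_scaleE (f : V -> V) c x : linear f -> f (c *: x) = c *: f x.
Proof.
move=> lf; have f0 : f 0 = 0 by rewrite -[0 in LHS](addNr (0 : V)) -scaleN1r lf scaleN1r addNr.
by rewrite -[c *: x]addr0 lf f0 addr0.
Qed.

Lemma anti_lin4 g G v w : (forall i, linear (g i)) -> (forall i j, anti (g i) (g j) (G i j)) ->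
  anti (lin4 g v) (lin4 g w) (gram4 G v w).
Proof.
move=> lg hG x; rewrite {1}/lin4.
have -> : lin4 g w (lin4 g v x) = \sum_i v i *: lin4 g w (g i x).
  rewrite [lin4 g v x]/lin4 linear_sumE; last exact: lin4_linear.
  by apply: eq_bigr => i _; rewrite linear_scaleE //; exact: lin4_linear.
rewrite -big_split /gram4 scaler_suml; apply: eq_bigr => i _ /=.
rewrite -scalerDr.
have -> : g i (lin4 g w x) = \sum_j w j *: g i (g j x).
  by rewrite /lin4 linear_sumE //; apply: eq_bigr => j _; rewrite linear_scaleE.
rewrite -big_split scaler_suml scaler_sumr; apply: eq_bigr => j _ /=.
by rewrite -scalerDr hG !scalerA.
Qed.

End anticommutator.

(** * The coefficients attached to a point of the domain *)

Section parameters.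
Variable R : realType.
Local Notation C := (Cplx R).

Definition point6 : Type := R * R * R * C * C * C.
Implicit Type p : point6.

Definition pr p : R := p.1.1.1.1.1.
Definition px1 p : R := p.1.1.1.1.2.
Definition px2 p : R := p.1.1.1.2.
Definition pu p : C := p.1.1.2.
Definition pu1 p : C := p.1.2.
Definition pu2 p : C := p.2.

(** The scalars of the representation over p. The number [pt] has squared modulus [ptau]. The
    residual operator h, left after the first fermion is split off, has {h, h^*} equal to [pdel] and
    square equal to [pw']. The square of b_1 is [pw], the solution w of w + t^2 w^* = w'. *)
Definition ptau p : R := 2 * px1 p / (1 + pr p).
Definition pt p : C := Cr (Num.sqrt (ptau p)) * pu1 p.
Definition pdel p : R := 1 - pr p - 2 * px1 p.
Definition pw' p : C := Cr (pdel p * px2 p) * pu2 p.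
Definition pw p : C := (pw' p - pt p ^+ 2 * (pw' p)^*) / Cr (1 - ptau p ^+ 2).
(** Bogoliubov coefficients of b_1 = A e + B e^*: the solution with A > 0 of A^2 + |B|^2 = 1 + r and
    A B = w. The discriminant is A^2 - |B|^2, the determinant of the transformation. *)
Definition disc (r : R) (w : C) : R := Num.sqrt ((1 + r) ^+ 2 - 4 * (re w ^+ 2 + im w ^+ 2)).
Definition coefA (r : R) (w : C) : R := Num.sqrt ((1 + r + disc r w) / 2).
Definition coefB (r : R) (w : C) : C := w / Cr (coefA r w).
Definition pD p := disc (pr p) (pw p).
Definition pA p := coefA (pr p) (pw p).
Definition pB p := coefB (pr p) (pw p).
(** Coefficients of the residual operator, up to scale and a phase, in the second fermion and its
    adjoint: ca^2 + cb^2 = 1 and ca cb = x. They coincide at x = 1/2, where the second fermion can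
    no longer be recovered. *)
Definition ca (x : R) : R := (Num.sqrt (1 + 2 * x) + Num.sqrt (1 - 2 * x)) / 2.
Definition cb (x : R) : R := (Num.sqrt (1 + 2 * x) - Num.sqrt (1 - 2 * x)) / 2.
Definition pa p : R := ca (px2 p).
Definition pb p : R := cb (px2 p).

Section cacb.
Variable x : R.
Hypothesis hx : 0 <= x <= 1 / 2.

Lemma cacb_args : 0 <= 1 + 2 * x /\ 0 <= 1 - 2 * x.
Proof. by move: hx => /andP[? ?]; split; lra. Qed.
Lemma cacb_sqr : ca x ^+ 2 + cb x ^+ 2 = 1.
Proof.
have [h1 h2] := cacb_args; rewrite /ca /cb.
rewrite (_ : _ + _ = (Num.sqrt (1 + 2 * x) ^+ 2 + Num.sqrt (1 - 2 * x) ^+ 2) / 2); last by field.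
by rewrite !sqr_sqrtr //; field.
Qed.
Lemma cacb_mul : ca x * cb x = x.
Proof.
have [h1 h2] := cacb_args; rewrite /ca /cb.
rewrite (_ : _ * _ = (Num.sqrt (1 + 2 * x) ^+ 2 - Num.sqrt (1 - 2 * x) ^+ 2) / 4); last by field.
by rewrite !sqr_sqrtr //; field.
Qed.
Lemma cacb_lt : x < 1 / 2 -> 0 < ca x ^+ 2 - cb x ^+ 2.
Proof.
move: hx => /andP[x0 _] x1; rewrite /ca /cb.
rewrite (_ : _ - _ = Num.sqrt (1 + 2 * x) * Num.sqrt (1 - 2 * x)); last by field.
by rewrite mulr_gt0 // sqrtr_gt0; lra.
Qed.
End cacb.

Lemma cb0 : cb 0 = 0.
Proof. by rewrite /cb mulr0 addr0 subr0 subrr mul0r. Qed.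

Lemma norm_sqrtE (z : C) : `|z| = Cr (Num.sqrt (re z ^+ 2 + im z ^+ 2)).
Proof. exact: normc_def. Qed.

Lemma norm1_mulC (u : C) : `|u| = 1 -> u * u^* = 1.
Proof. by move=> u1; rewrite -normCK u1 expr1n. Qed.

(** The equation w + t^2 w^* = v is only real-linear in w; eliminating w^* with the conjugate
    equation gives the solution, with determinant 1 - |t|^4. *)
Lemma conj_eq_solve (v t d : C) : d != 0 -> d^* = d -> d = 1 - (t * t^*) ^+ 2 ->
  (v - t ^+ 2 * v^*) / d + t ^+ 2 * ((v - t ^+ 2 * v^*) / d)^* = v.
Proof.
move=> d0 dd dE; rewrite rmorphM fmorphV rmorphB rmorphM rmorphXn /= conjCK dd.
rewrite mulrA -mulrDl; apply: (canLR (mulfK d0)); rewrite dE; ring.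
Qed.

Section coefAB.
Variables (r : R) (w : C).
Hypotheses (r0 : 0 < r) (wr : 2 * Num.sqrt (re w ^+ 2 + im w ^+ 2) < 1 + r).

Lemma disc_arg_gt0 : 0 < (1 + r) ^+ 2 - 4 * (re w ^+ 2 + im w ^+ 2).
Proof.
have n0 : 0 <= re w ^+ 2 + im w ^+ 2 by rewrite addr_ge0 ?sqr_ge0.
have := sqr_sqrtr n0; have := sqrtr_ge0 (re w ^+ 2 + im w ^+ 2).
move: wr; set q := Num.sqrt _ => h q0 <-; nra.
Qed.

Lemma disc_gt0 : 0 < disc r w.
Proof. by rewrite sqrtr_gt0 disc_arg_gt0. Qed.

Lemma disc_sqr : disc r w ^+ 2 = (1 + r) ^+ 2 - 4 * (re w ^+ 2 + im w ^+ 2).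
Proof. by rewrite sqr_sqrtr // ltW // disc_arg_gt0. Qed.

Lemma coefA_gt0 : 0 < coefA r w.
Proof. by rewrite sqrtr_gt0 divr_gt0 // addr_gt0 ?disc_gt0 // addr_gt0. Qed.

Lemma coefA_sqr : coefA r w ^+ 2 = (1 + r + disc r w) / 2.
Proof. by rewrite sqr_sqrtr // ltW // -sqrtr_gt0 coefA_gt0. Qed.

Lemma coefAB : Cr (coefA r w) * coefB r w = w.
Proof. by rewrite /coefB mulrC divfK // gt_eqF // Cr_gt0 coefA_gt0. Qed.

Lemma coefB_sqr : coefB r w * (coefB r w)^* = Cr ((1 + r - disc r w) / 2).
Proof.
have A0 := coefA_gt0; have A2 := coefA_sqr; have D2 := disc_sqr.
have -> : coefB r w * (coefB r w)^* = `|w| ^+ 2 / Cr (coefA r w ^+ 2).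
  rewrite /coefB rmorphM fmorphV /= conj_Cr mulrACA -normCK -invfM.
  by rewrite rmorphXn expr2.
rewrite sqr_normCE -fmorphV -rmorphM; congr Cr.
have A20 : coefA r w ^+ 2 != 0 by rewrite expf_neq0 // gt_eqF.
apply: (mulIf A20); rewrite divfK // A2.
have -> : re w ^+ 2 + im w ^+ 2 = ((1 + r) ^+ 2 - disc r w ^+ 2) / 4 by rewrite D2; field.
by field.
Qed.

Lemma coefAB_add : Cr (coefA r w) ^+ 2 + coefB r w * (coefB r w)^* = 1 + Cr r.
Proof.
rewrite coefB_sqr -rmorphXn coefA_sqr -rmorphD -(rmorph1 (@Cr R)) -rmorphD.
by congr Cr; field.
Qed.

Lemma coefAB_sub : Cr (coefA r w) ^+ 2 - coefB r w * (coefB r w)^* = Cr (disc r w).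
Proof.
by rewrite coefB_sqr -rmorphXn coefA_sqr -rmorphB; congr Cr; field.
Qed.
End coefAB.

Section point_facts.
Variables (eps : R) (p : point6).
Hypotheses (eps0 : 0 < eps) (hp : DT3 eps p).

Lemma DT3_bounds : [/\ eps <= pr p <= 1, 0 <= px1 p <= (1 - pr p) / 2 & 0 <= px2 p <= 1 / 2].
Proof. by move: hp; rewrite /pr /px1 /px2; case: p => [[[[[? ?] ?] ?] ?] ?] /= []. Qed.

Lemma DT3_norms : [/\ `|pu p| = 1, `|pu1 p| = 1 & `|pu2 p| = 1].
Proof. by move: hp; rewrite /pu /pu1 /pu2; case: p => [[[[[? ?] ?] ?] ?] ?] /= [? ? ? []]. Qed.

Lemma pr_gt0 : 0 < pr p.
Proof. by have [/andP[h _] _ _] := DT3_bounds; exact: lt_le_trans h. Qed.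

Lemma pr_le1 : pr p <= 1.
Proof. by have [/andP[]] := DT3_bounds. Qed.

Lemma pdel_ge0 : 0 <= pdel p.
Proof. by have [_ /andP[_ h] _] := DT3_bounds; rewrite /pdel; lra. Qed.

Lemma ptau_ge0 : 0 <= ptau p.
Proof.
have [_ /andP[h _] _] := DT3_bounds; have := pr_gt0.
by move=> r0; rewrite /ptau divr_ge0 ?mulr_ge0 // addr_ge0 // ltW.
Qed.

Lemma ptauE : ptau p * (1 + pr p) = 2 * px1 p.
Proof. by rewrite /ptau divfK // gt_eqF // addr_gt0 // pr_gt0. Qed.

Lemma pdelE : pdel p = 1 - pr p - ptau p * (1 + pr p).
Proof. by rewrite ptauE. Qed.

Lemma ptau_lt1 : ptau p < 1.
Proof. by have := pr_gt0; have := pdel_ge0; rewrite pdelE; nra. Qed.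

Lemma pt_norm : pt p * (pt p)^* = Cr (ptau p).
Proof.
have [_ u1 _] := DT3_norms.
rewrite /pt rmorphM /= conj_Cr mulrACA norm1_mulC // mulr1 -rmorphM -expr2.
by rewrite sqr_sqrtr // ptau_ge0.
Qed.

Lemma pw_eq : pw p + pt p ^+ 2 * (pw p)^* = pw' p.
Proof.
have tt := pt_norm; have t1 := ptau_lt1; have t0 := ptau_ge0.
have d0 : Cr (1 - ptau p ^+ 2) != 0.
  rewrite fmorph_eq0 gt_eqF // subr_gt0 expr_lt1 //.
apply: conj_eq_solve => //; first by rewrite conj_Cr.
by rewrite tt rmorphB rmorph1 rmorphXn.
Qed.

Lemma pw'_norm_le : Num.sqrt (re (pw' p) ^+ 2 + im (pw' p) ^+ 2) = pdel p * px2 p.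
Proof.
have [_ _ u2] := DT3_norms; have [_ _ /andP[x20 _]] := DT3_bounds.
have d0 := pdel_ge0; apply: (@Cr_inj R); rewrite -norm_sqrtE.
by rewrite /pw' normrM u2 mulr1 norm_Cr ger0_norm // mulr_ge0.
Qed.

(** From w = w' - t^2 w^* follows |w| <= |w'| + tau |w|, and |w'| <= del / 2. Hence 2 |w| (1 - tau)
    <= 1 - r - tau (1 + r) < (1 + r)(1 - tau), strictly because r > 0. This makes the discriminant
    positive on the whole domain. *)
Lemma pw_small : 2 * Num.sqrt (re (pw p) ^+ 2 + im (pw p) ^+ 2) < 1 + pr p.
Proof.
have [_ _ /andP[x20 x21]] := DT3_bounds.
have r0 := pr_gt0; have r1 := pr_le1; have d0 := pdel_ge0.
have t1 := ptau_lt1; have t0 := ptau_ge0.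
set q := Num.sqrt _.
have h : q <= pdel p * px2 p + ptau p * q.
  have qE : Cr q = `|pw p| by rewrite norm_sqrtE.
  have w'E : Cr (pdel p * px2 p) = `|pw' p| by rewrite norm_sqrtE pw'_norm_le.
  have tE : Cr (ptau p) = `|pt p ^+ 2| by rewrite normrX normCK pt_norm.
  rewrite -ler_Cr CrD w'E CrM qE tE -[`|pw p| in leRHS]norm_conjC -normrM.
  have {1}-> : pw p = pw' p - pt p ^+ 2 * (pw p)^* by rewrite -pw_eq addrK.
  exact: ler_normB.
have q0 : 0 <= q by exact: sqrtr_ge0.
have {x20} : pdel p * px2 p <= pdel p / 2 by rewrite ler_wpM2l // -div1r.
move: h (pdelE); set T := ptau p in t0 t1 *; set r := pr p in r0 r1 *.
move=> h dE hd.
have : q * (1 - T) * 2 <= 1 - r - T * (1 + r) by rewrite -dE; lra.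
have : 0 < 1 - T by lra.
nra.
Qed.

End point_facts.
End parameters.

(** * Matrices of two fermions *)

Section adjoint_matrices.
Variable C : numClosedFieldType.

Lemma adjmx_delta m n i j : (delta_mx i j : 'M[C]_(m, n)) ^t* = delta_mx j i.
Proof. by rewrite trmx_delta map_delta_mx. Qed.
Lemma adjmxD m n (A B : 'M[C]_(m, n)) : (A + B) ^t* = A ^t* + B ^t*.
Proof. by rewrite linearD map_mxD. Qed.
Lemma adjmxZ m n c (A : 'M[C]_(m, n)) : (c *: A) ^t* = c^* *: A ^t*.
Proof. by rewrite linearZ /= map_mxZ. Qed.
Lemma adjmxN m n (A : 'M[C]_(m, n)) : (- A) ^t* = - A ^t*.
Proof. by rewrite linearN map_mxN. Qed.
Lemma adjmxM m n p (A : 'M[C]_(m, n)) (B : 'M[C]_(n, p)) : (A *m B) ^t* = B ^t* *m A ^t*.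
Proof. by rewrite trmx_mul map_mxM. Qed.
Lemma adjmx1 n : (1%:M : 'M[C]_n) ^t* = 1%:M.
Proof. by rewrite trmx1 map_mx1. Qed.

(** The Kronecker product with its type pinned to order 4 rather than 2 * 2. *)
Definition tens2 (A B : 'M[C]_2) : 'M[C]_4 := A *t B.

Lemma tens2Dl A A' B : tens2 (A + A') B = tens2 A B + tens2 A' B.
Proof. by apply/matrixP => i j; rewrite !mxE mulrDl. Qed.
Lemma tens2Dr A B B' : tens2 A (B + B') = tens2 A B + tens2 A B'.
Proof. by apply/matrixP => i j; rewrite !mxE mulrDr. Qed.
Lemma tens2Zl c A B : tens2 (c *: A) B = c *: tens2 A B.
Proof. by apply/matrixP => i j; rewrite !mxE mulrA. Qed.
Lemma tens2Zr c A B : tens2 A (c *: B) = c *: tens2 A B.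
Proof. by apply/matrixP => i j; rewrite !mxE mulrCA. Qed.
Lemma tens2Nl A B : tens2 (- A) B = - tens2 A B.
Proof. by apply/matrixP => i j; rewrite !mxE mulNr. Qed.
Lemma tens20l B : tens2 0 B = 0. Proof. by apply/matrixP => i j; rewrite !mxE mul0r. Qed.
Lemma tens20r A : tens2 A 0 = 0. Proof. by apply/matrixP => i j; rewrite !mxE mulr0. Qed.
Lemma tens2M A A' B B' : tens2 A B *m tens2 A' B' = tens2 (A *m A') (B *m B').
Proof. exact: (@tensmx_mul C 2 2 2 2 2 2 A B A' B'). Qed.
Lemma tens2_adj A B : (tens2 A B) ^t* = tens2 (A ^t*) (B ^t*).
Proof. by apply/matrixP => i j; rewrite !mxE rmorphM. Qed.
Lemma tens2_11 : tens2 1%:M 1%:M = 1%:M.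
Proof.
apply/matrixP => i j; case: (@mxtens_indexP 2 2 i) => i0 i1; case: (@mxtens_indexP 2 2 j) => j0 j1.
rewrite [LHS](tensmxE (1%:M : 'M[C]_2) (1%:M : 'M[C]_2)) !mxE (can_eq (@mxtens_indexK 2 2)) xpair_eqE.
by case: (i0 == j0); case: (i1 == j1); rewrite ?(mul0r, mulr0, mul1r).
Qed.

End adjoint_matrices.

Section car_matrices.
Variable C : numClosedFieldType.
Local Notation d i j := (delta_mx i j : 'M[C]_2).

(** The Jordan-Wigner construction: [grading] anticommutes with the two off-diagonal matrix units,
    which makes the second fermion anticommute with the first. *)
Definition grading : 'M[C]_2 := d 1 1 - d 0 0.
Definition mxE1 : 'M[C]_4 := tens2 (d 1 0) 1%:M.
Definition mxF1 : 'M[C]_4 := tens2 grading (d 1 0).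
Definition mxE1s : 'M[C]_4 := tens2 (d 0 1) 1%:M.
Definition mxF1s : 'M[C]_4 := tens2 grading (d 0 1).

Lemma grading_adj : grading ^t* = grading.
Proof. by rewrite /grading adjmxD adjmxN !adjmx_delta. Qed.
Lemma mxE1_adj : mxE1 ^t* = mxE1s.
Proof. by rewrite tens2_adj adjmx_delta adjmx1. Qed.
Lemma mxF1_adj : mxF1 ^t* = mxF1s.
Proof. by rewrite tens2_adj adjmx_delta grading_adj. Qed.
Lemma mxE1s_adj : mxE1s ^t* = mxE1. Proof. by rewrite -mxE1_adj trmxCK. Qed.
Lemma mxF1s_adj : mxF1s ^t* = mxF1. Proof. by rewrite -mxF1_adj trmxCK. Qed.

Lemma delta2_add : d 0 0 + d 1 1 = 1%:M.
Proof. by rewrite [RHS]mx1_sum_delta !big_ord_recl big_ord0 addr0; congr (_ + d _ _); apply/val_inj. Qed.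

Lemma mul_delta2 (i j k l : 'I_2) : d i j *m d k l = (j == k)%:R *: d i l.
Proof. by rewrite mul_delta_mx_cond; case: (j == k); rewrite ?scale1r ?scale0r. Qed.

Lemma grading_sqr : grading *m grading = 1%:M.
Proof.
rewrite /grading mulmxBl !mulmxBr !mul_delta2 /= ?scale1r ?scale0r subr0 sub0r opprK.
by rewrite addrC delta2_add.
Qed.

Lemma grading_e1 : grading *m d 1 0 = d 1 0.
Proof. by rewrite /grading mulmxBl !mul_delta2 /= scale1r scale0r subr0. Qed.
Lemma grading_e2 : grading *m d 0 1 = - d 0 1.
Proof. by rewrite /grading mulmxBl !mul_delta2 /= scale1r scale0r sub0r. Qed.
Lemma e1_grading : d 1 0 *m grading = - d 1 0.
Proof. by rewrite /grading mulmxBr !mul_delta2 /= scale1r scale0r sub0r. Qed.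
Lemma e2_grading : d 0 1 *m grading = d 0 1.
Proof. by rewrite /grading mulmxBr !mul_delta2 /= scale1r scale0r subr0. Qed.

Definition car_mx (i : 'I_4) : 'M[C]_4 := nth 0 [:: mxE1; mxE1s; mxF1; mxF1s] i.
Definition car_gram (i j : 'I_4) : C :=
  nth 0 (nth [::] [:: [:: 0; 1; 0; 0]; [:: 1; 0; 0; 0]; [:: 0; 0; 0; 1]; [:: 0; 0; 1; 0]] i) j.

Lemma car_mx_anti i j : car_mx i *m car_mx j + car_mx j *m car_mx i = (car_gram i j)%:M.
Proof.
case: i => [[|[|[|[|//]]]] ?]; case: j => [[|[|[|[|//]]]] ?];
rewrite /car_mx /car_gram /= /mxE1 /mxF1 /mxE1s /mxF1s;
rewrite !tens2M ?(mulmx1, mul1mx, grading_sqr, grading_e1, grading_e2, e1_grading, e2_grading, mul_delta2) /= ?(scale0r, scale1r, tens20l, tens20r, tens2Nl).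
all: rewrite ?addr0 ?addNr ?subrr ?raddf0 //.
all: by rewrite -?tens2Dl -?tens2Dr ?delta2_add 1?addrC ?delta2_add tens2_11.
Qed.

Definition cl4 (v : 'I_4 -> C) : 'M[C]_4 := \sum_i v i *: car_mx i.

Lemma cl4E a b c d : cl4 (vec4 a b c d) = a *: mxE1 + b *: mxE1s + c *: mxF1 + d *: mxF1s.
Proof. by rewrite /cl4 !big_ord_recl big_ord0 addr0 /= !addrA. Qed.

Lemma cl4_adj a b c d : (cl4 (vec4 a b c d)) ^t* = cl4 (vec4 b^* a^* d^* c^*).
Proof.
rewrite !cl4E !adjmxD !adjmxZ mxE1_adj mxF1_adj mxE1s_adj mxF1s_adj.
by rewrite [b^* *: _ + _]addrC -!addrA; congr (_ + (_ + _)); rewrite addrC.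
Qed.

Lemma car_gramE a b c d a' b' c' d' :
  gram4 car_gram (vec4 a b c d) (vec4 a' b' c' d') = a * b' + b * a' + c * d' + d * c'.
Proof.
rewrite /gram4 !big_ord_recl !big_ord0 /= /vec4 /car_gram /=; ring.
Qed.

Lemma cl4_mul v (X : 'M[C]_4) : cl4 v *m X = lin4 (fun i => mulmx (car_mx i)) v X.
Proof. by rewrite /cl4 mulmx_suml; apply: eq_bigr => i _; rewrite scalemxAl. Qed.

Lemma cl4_anti a b c d a' b' c' d' :
  cl4 (vec4 a b c d) *m cl4 (vec4 a' b' c' d') + cl4 (vec4 a' b' c' d') *m cl4 (vec4 a b c d) =
  (a * b' + b * a' + c * d' + d * c')%:M.
Proof.
have := @anti_lin4 _ _ (fun i => mulmx (car_mx i)) car_gram (vec4 a b c d) (vec4 a' b' c' d').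
rewrite car_gramE => h.
have := h 4%N _ _ 1%:M; rewrite -!cl4_mul !mulmx1 => ->.
- by rewrite scalemx1.
- by move=> i; exact: linearP.
- by move=> i j X; rewrite !mulmxA -mulmxDl car_mx_anti mul_scalar_mx.
Qed.

End car_matrices.

Section car_rows.
Variable C : numClosedFieldType.

Definition mxs (l : seq (seq C)) : 'M[C]_4 := \matrix_(i, j) nth 0 (nth [::] l i) j.

Lemma tens2_mxs (A B : 'M[C]_2) : tens2 A B = mxs
  [:: [:: A 0 0 * B 0 0; A 0 0 * B 0 1; A 0 1 * B 0 0; A 0 1 * B 0 1];
      [:: A 0 0 * B 1 0; A 0 0 * B 1 1; A 0 1 * B 1 0; A 0 1 * B 1 1];
      [:: A 1 0 * B 0 0; A 1 0 * B 0 1; A 1 1 * B 0 0; A 1 1 * B 0 1];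
      [:: A 1 0 * B 1 0; A 1 0 * B 1 1; A 1 1 * B 1 0; A 1 1 * B 1 1]].
Proof.
apply/matrixP => -[[|[|[|[|//]]]] ?] -[[|[|[|[|//]]]] ?]; rewrite !mxE /=;
by congr (_ * _); congr (_ _ _); apply/val_inj.
Qed.

Lemma mxs_row (V : lmodType C) (l : seq (seq C)) (z : 'I_4 -> V) (k : 'I_4) :
  \sum_j mxs l k j *: z j =
  nth 0 (nth [::] l k) 0 *: z 0 + nth 0 (nth [::] l k) 1 *: z 1 +
  nth 0 (nth [::] l k) 2 *: z 2%:R + nth 0 (nth [::] l k) 3 *: z 3%:R.
Proof.
rewrite !big_ord_recl big_ord0 addr0 !mxE /= !addrA.
by congr (_ *: z _ + _ *: z _ + _ *: z _ + _ *: z _); apply/val_inj.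
Qed.

End car_rows.

(** * The model matrices and their relations *)

Section generators.
Variable C : numClosedFieldType.
Implicit Types A B t u c d r : C.

Definition kap : C := (sqrtC 2)^-1.

Lemma kap_sqr : kap * kap = 2^-1.
Proof. by rewrite /kap -invfM -expr2 sqrtCK. Qed.
Lemma kap_conj : kap^* = kap.
Proof. by rewrite geC0_conj // invr_ge0 sqrtC_ge0 ler0n. Qed.

Definition odd_part c d : 'M[C]_4 := c *: mxF1 C + d *: mxF1s C.
Definition gen0 A B t (h : 'M[C]_4) : 'M[C]_4 :=
  kap *: ((A - t * B^*) *: mxE1 C + (B + t * A) *: mxE1s C + h).
Definition gen1 A B t u (h : 'M[C]_4) : 'M[C]_4 :=
  (kap * u) *: ((B^* - t^* * A) *: mxE1 C + (A + t^* * B) *: mxE1s C - h ^t*).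

Lemma odd_part_adj c d : (odd_part c d) ^t* = odd_part d^* c^*.
Proof. by rewrite /odd_part adjmxD !adjmxZ mxF1_adj mxF1s_adj addrC. Qed.

Lemma gen0E A B t c d : gen0 A B t (odd_part c d) =
  cl4 (vec4 (kap * (A - t * B^*)) (kap * (B + t * A)) (kap * c) (kap * d)).
Proof. by rewrite cl4E /gen0 /odd_part !scalerDr !scalerA !addrA. Qed.

Lemma gen1E A B t u c d : gen1 A B t u (odd_part c d) =
  cl4 (vec4 (kap * u * (B^* - t^* * A)) (kap * u * (A + t^* * B)) (- (kap * u * d^*)) (- (kap * u * c^*))).
Proof.
by rewrite cl4E /gen1 odd_part_adj /odd_part opprD !scalerDr !scalerN !scalerA !scaleNr !addrA.
Qed.

Section relations.
Variables A B t u c d r T del w w' : C.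
Hypotheses (hA : A^* = A) (hr : r^* = r) (hAB : A ^+ 2 + B * B^* = 1 + r) (ht : t * t^* = T)
  (hu : u * u^* = 1) (hcd : c * c^* + d * d^* = del) (hdel : del = 1 - r - T * (1 + r))
  (hw : A * B = w) (hw' : w + t ^+ 2 * w^* = w') (hcd' : c * d = w').
Let a0 := gen0 A B t (odd_part c d).
Let a1 := gen1 A B t u (odd_part c d).

Lemma gen0_car : a0 ^t* *m a0 + a0 *m a0 ^t* = 1%:M.
Proof.
rewrite /a0 gen0E cl4_adj cl4_anti; congr (_%:M).
rewrite !(rmorphM, rmorphD, rmorphB, rmorphN) /= !conjCK hA kap_conj.
transitivity (kap * kap * ((A ^+ 2 + B * B^*) * (1 + t * t^*) + (c * c^* + d * d^*))); first by ring.
by rewrite hAB ht hcd hdel kap_sqr; field.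
Qed.

Lemma gen1_car : a1 ^t* *m a1 + a1 *m a1 ^t* = 1%:M.
Proof.
rewrite /a1 gen1E cl4_adj cl4_anti; congr (_%:M).
rewrite !(rmorphM, rmorphD, rmorphB, rmorphN) /= !conjCK hA kap_conj.
transitivity (kap * kap * (u * u^*) * ((A ^+ 2 + B * B^*) * (1 + t * t^*) + (c * c^* + d * d^*))); first by ring.
by rewrite hAB ht hcd hdel hu kap_sqr; field.
Qed.

(** The anticommutator is 2 kap^2 u times A B^* + t^*^2 A B - c^* d^*, which is zero by the
    conjugate of w + t^2 w^* = c d. *)
Lemma gen01_anti : a0 ^t* *m a1 = - (a1 *m a0 ^t*).
Proof.
apply/eqP; rewrite -addr_eq0; apply/eqP.
rewrite /a0 /a1 gen0E gen1E cl4_adj cl4_anti.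
have E : A * B^* + t^* ^+ 2 * (A * B) = c^* * d^*.
  rewrite -rmorphM hcd' -hw' rmorphD rmorphM rmorphXn /= conjCK.
  by rewrite -hw rmorphM /= hA.
rewrite [X in X%:M](_ : _ = 0) ?raddf0 //.
rewrite !(rmorphM, rmorphD, rmorphB, rmorphN) /= !conjCK hA kap_conj.
transitivity (2 * (kap * kap) * u * ((A * B^* + t^* ^+ 2 * (A * B)) - c^* * d^*)); first by ring.
by rewrite E subrr mulr0.
Qed.

Lemma gen01_scalar : a1 *m a0 + a0 *m a1 = (r * u)%:M.
Proof.
rewrite /a0 /a1 gen0E gen1E cl4_anti.
congr (_%:M).
transitivity (kap * kap * u * ((A ^+ 2 + B * B^*) * (1 - t * t^*) - (c * c^* + d * d^*))); first by ring.
by rewrite hAB ht hcd hdel kap_sqr; field.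
Qed.

(** The squares of the two generators carry w and t; together with the scalar r u they are the
    invariants that separate models. *)
Lemma gen0_sqr : a0 *m a0 + a0 *m a0 = (2 * w + t * (A ^+ 2 - B * B^*))%:M.
Proof.
rewrite /a0 gen0E cl4_anti; congr (_%:M).
transitivity (2 * (kap * kap) * (A * B + c * d - t ^+ 2 * (A * B^*) + t * (A ^+ 2 - B * B^*))); first by ring.
have -> : A * B^* = w^* by rewrite -hw rmorphM /= hA.
by rewrite kap_sqr hw hcd' -hw'; field.
Qed.

Lemma gen1_sqr : a1 *m a1 + a1 *m a1 = (u ^+ 2 * (2 * w - t * (A ^+ 2 - B * B^*))^*)%:M.
Proof.
rewrite /a1 gen1E cl4_anti; congr (_%:M).
transitivity (2 * (kap * kap) * u ^+ 2 * (A * B^* + c^* * d^* - t^* ^+ 2 * (A * B) -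
  t^* * (A ^+ 2 - B * B^*))); first by ring.
have -> : c^* * d^* = w^* + t^* ^+ 2 * w.
  by rewrite -rmorphM hcd' -hw' rmorphD rmorphM rmorphXn /= conjCK.
have -> : A * B^* = w^* by rewrite -hw rmorphM /= hA.
rewrite kap_sqr hw !(rmorphM, rmorphD, rmorphB, rmorphN, rmorphXn) /= !conjCK hA ?rmorph_nat ?rmorph1.
by field.
Qed.

End relations.
End generators.

(** * Operators with scalar anticommutators on a Hilbert space *)

Section clifford_operators.
Variables (C : numClosedFieldType) (H : hilbertType C).
Implicit Types (f g : H -> H) (c s : C).

Definition adjoint f g := forall x y, dot (f x) y = dot x (g y).

Lemma adjoint_sym f g : adjoint f g -> adjoint g f.
Proof. by move=> h x y; rewrite dotC -h -dotC. Qed.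

Lemma dot_ext (x y : H) : (forall z, dot x z = dot y z) -> x = y.
Proof.
move=> h; apply/eqP; rewrite -subr_eq0; apply/eqP/dot_self_eq0.
by rewrite dotBl h subrr.
Qed.

Lemma anti_adjoint f f' g g' c : adjoint f f' -> adjoint g g' -> anti f g c -> anti f' g' c^*.
Proof.
move=> af ag h x; apply: dot_ext => z.
have af' := adjoint_sym af; have ag' := adjoint_sym ag.
by rewrite dotDl dotZl af' ag' ag' af' -dotDr addrC h dotZr.
Qed.

Lemma lin4_adjoint (F F' : 'I_4 -> H -> H) (v w : 'I_4 -> C) :
  (forall i, adjoint (F i) (F' i)) -> (forall i, w i = (v i)^*) ->
  adjoint (lin4 F v) (lin4 F' w).
Proof.
move=> aF wE x y; rewrite /lin4.
rewrite (linear_sum (@dot C H x)) /= -[dot _ y]/(applyr dot y _) linear_sum /=.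
by apply: eq_bigr => i _; rewrite dotZl dotZr aF wE conjCK.
Qed.

Hypothesis H0 : exists x : H, x != 0.

Lemma anti_adjoint_normE f f' s : adjoint f f' -> anti f f' s ->
  forall x, `|f x| ^+ 2 + `|f' x| ^+ 2 = s * `|x| ^+ 2.
Proof.
move=> a h x; rewrite !sqr_normE -[dot (f x) (f x)](adjoint_sym a).
by rewrite -[dot (f' x) (f' x)]a addrC -dotDl h dotZl.
Qed.

Lemma anti_adjoint_ge0 f f' s : adjoint f f' -> anti f f' s -> 0 <= s.
Proof.
move=> a h; have [x x0] := H0.
have xp : 0 < `|x| ^+ 2 by rewrite exprn_gt0 // normr_gt0.
by rewrite -(pmulr_lge0 _ xp) -(anti_adjoint_normE a h) addr_ge0 // exprn_ge0.
Qed.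

Lemma anti_adjoint_eq0 f f' : adjoint f f' -> anti f f' 0 -> forall x, f x = 0 /\ f' x = 0.
Proof.
move=> a h x; have := anti_adjoint_normE a h x; rewrite mul0r => /eqP.
rewrite paddr_eq0 ?exprn_ge0 // !sqrf_eq0 !normr_eq0 => /andP[/eqP -> /eqP ->].
by [].
Qed.

Lemma anti_comb2 f g f' g' (c c' d d' ff fg' gf' gg : C) :
  linear f -> linear g -> linear f' -> linear g' ->
  anti f f' ff -> anti f g' fg' -> anti g f' gf' -> anti g g' gg ->
  anti (fun x => c *: f x + d *: g x) (fun x => c' *: f' x + d' *: g' x)
     (c * c' * ff + c * d' * fg' + d * c' * gf' + d * d' * gg).
Proof.
move=> lf lg lf' lg' h1 h2 h3 h4 x.
have lE (k : H -> H) (a b : C) (y z : H) : linear k -> k (a *: y + b *: z) = a *: k y + b *: k z.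
  by move=> lk; rewrite lk (linear_scaleE b z lk).
rewrite /= (lE f) // (lE g) // (lE f') // (lE g') // !scalerDl -!(scalerA (_ * _)) -h1 -h2 -h3 -h4 !scalerDr !scalerA.
rewrite ![c' * _]mulrC ![d' * _]mulrC.
move: ((c * c') *: f (f' x)) ((c * d') *: f (g' x)) ((d * c') *: g (f' x)) ((d * d') *: g (g' x)) 
  ((c * c') *: f' (f x)) ((c * d') *: g' (f x)) ((d * c') *: f' (g x)) ((d * d') *: g' (g x)).
move=> x1 x2 x3 x4 y1 y2 y3 y4.
by rewrite [y1 + y3 + _]addrACA -[RHS]addrA [x1 + y1 + _]addrACA [x3 + y3 + _]addrACA [RHS]addrACA.
Qed.

Lemma linear_comb2 f g c d : linear f -> linear g -> linear (fun x => c *: f x + d *: g x).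
Proof.
move=> lf lg a x y; rewrite lf lg !scalerDr !scalerA.
by rewrite [c * a]mulrC [d * a]mulrC addrACA.
Qed.

Lemma adjoint_comb2 f g f' g' c d : adjoint f f' -> adjoint g g' ->
  adjoint (fun x => c *: f x + d *: g x) (fun x => c^* *: f' x + d^* *: g' x).
Proof. by move=> a b x y; rewrite dotDl dotDr !dotZl !dotZr !conjCK a b. Qed.

(** Here f^2 = c. With th the phase of c, the operator g = f - th f' has {g, g^*} = 2 (s - 2 |c|),
    and such an anticommutator is nonnegative. *)
Lemma anti_norm_le f f' s c : linear f -> linear f' -> adjoint f f' ->
  anti f f' s -> anti f f (2 * c) -> 2 * `|c| <= s.
Proof.
move=> lf lf' a h1 h2.
have h3 : anti f' f' (2 * c)^* := anti_adjoint a a h2.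
have h4 := anti_sym h1.
pose th : C := if c == 0 then 1 else c / `|c|.
have thc : th^* * c = `|c|.
  rewrite /th; have [c00|c0] := eqVneq c 0; first by rewrite c00 mulr0 normr0.
  rewrite rmorphM fmorphV /= [`|c|^*]geC0_conj // mulrAC [c^* * c]mulrC -normCK.
  by rewrite expr2 mulfK // normr_eq0.
have th1 : th * th^* = 1.
  rewrite -normCK /th; have [c00|c0] := eqVneq c 0; first by rewrite normr1 expr1n.
  by rewrite normrM normfV normr_id divff ?expr1n // normr_eq0.
have := anti_comb2 1 1 (- th) (- th^*) lf lf' lf' lf h1 h2 h3 h4.
have := adjoint_comb2 1 (- th) a (adjoint_sym a).
rewrite rmorphN rmorph1 => a' h5; have := anti_adjoint_ge0 a' h5.
rewrite !mul1r mulr1 mulrNN th1 mul1r rmorphM /= conjC_nat.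
have -> : s + - th^* * (2 * c) + - th * (2 * c^*) + s = 2 * (s - (th^* * c + (th^* * c)^*)).
  by rewrite rmorphM /= conjCK; ring.
rewrite thc [(`|c|)^*]geC0_conj // pmulr_rge0 ?ltr0n // subr_ge0.
by rewrite -mulr2n mulr_natl.
Qed.

End clifford_operators.

(** * Coordinates in an ampliation of the model *)

Section intertwiner.
Variables (C : numClosedFieldType) (V : lmodType C).
Variables (e es k1 k2 : V -> V).
Hypotheses (le : linear e) (les : linear es) (lk1 : linear k1) (lk2 : linear k2).
Hypotheses (ee : forall x, e (e x) = 0) (eses : forall x, es (es x) = 0)
  (ees : forall x, e (es x) + es (e x) = x).
Hypotheses (k1e : forall x, k1 (e x) = - e (k1 x)) (k1es : forall x, k1 (es x) = - es (k1 x))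
  (k2e : forall x, k2 (e x) = e (k2 x)) (k2es : forall x, k2 (es x) = es (k2 x)).

(** Instead of factorising the space as C^4 (x) K, the vector x is sent to four vectors of the same
    space, on which operators act by 4 x 4 scalar matrices. The first tensor index is the occupation
    of [e]; the second comes from the maps [k1] and [k2], which treat the second mode. The sign in
    the first entry compensates for [k1] anticommuting with [e]. *)
Definition tofock (k : 'I_4) (x : V) : V :=
  nth 0 [:: - e (k1 x); e (k2 x); e (es (k1 x)); e (es (k2 x))] k.

Definition intertwines (X : V -> V) (M : 'M[C]_4) :=
  forall x k, tofock k (X x) = \sum_l M k l *: tofock l x.

Let lin0 (f : V -> V) : linear f -> f 0 = 0.
Proof. by move=> lf; rewrite -[0 in LHS](addNr (0 : V)) -scaleN1r lf scaleN1r addNr. Qed.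
Let linN (f : V -> V) x : linear f -> f (- x) = - f x.
Proof. by move=> lf; rewrite -scaleN1r (linear_scaleE _ _ lf) scaleN1r. Qed.

Lemma tofock_linear k : linear (tofock k).
Proof.
move=> c x y; rewrite /tofock lk1 lk2 !les !le.
by case: k => [[|[|[|[|//]]]] ?] /=; rewrite // opprD scalerN.
Qed.

Lemma eese x : e (es (e x)) = e x.
Proof. by have := ees (e x); rewrite ee (lin0 les) addr0. Qed.

Lemma intertwines_e : intertwines e (mxE1 C).
Proof.
move=> x k; rewrite /mxE1 tens2_mxs mxs_row /tofock !mxE /= !(mul0r, mulr0, mul1r, scale0r, scale1r, addr0, add0r).
case: k => [[|[|[|[|//]]]] ?] /=; rewrite ?scale0r ?scale1r ?addr0 ?add0r.
- by rewrite k1e (linN _ le) ee !oppr0.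
- by rewrite k2e ee.
- by rewrite k1e (linN _ les) (linN _ le) eese.
- by rewrite k2e eese.
Qed.

Lemma intertwines_es : intertwines es (mxE1s C).
Proof.
move=> x k; rewrite /mxE1s tens2_mxs mxs_row /tofock !mxE /= !(mul0r, mulr0, mul1r, scale0r, scale1r, addr0, add0r).
case: k => [[|[|[|[|//]]]] ?] /=; rewrite ?scale0r ?scale1r ?addr0 ?add0r.
- by rewrite k1es (linN _ le) opprK.
- by rewrite k2es.
- by rewrite k1es (linN _ les) eses oppr0 (lin0 le).
- by rewrite k2es eses (lin0 le).
Qed.

Lemma intertwines_odd (h : V -> V) c d :
  (forall x, k1 (h x) = d *: k2 x) -> (forall x, k2 (h x) = c *: k1 x) ->
  intertwines h (odd_part c d).
Proof.
move=> k1h k2h x k; rewrite /odd_part.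
have -> : c *: mxF1 C + d *: mxF1s C = mxs
  [:: [:: 0; - d; 0; 0]; [:: - c; 0; 0; 0]; [:: 0; 0; 0; d]; [:: 0; 0; c; 0]].
  rewrite /mxF1 /mxF1s !tens2_mxs /grading.
  apply/matrixP => -[[|[|[|[|//]]]] ?] -[[|[|[|[|//]]]] ?]; rewrite !mxE /= ?mxE /=; ring.
rewrite mxs_row /tofock /=.
case: k => [[|[|[|[|//]]]] ?] /=; rewrite ?scale0r ?addr0 ?add0r.
- by rewrite k1h (linear_scaleE _ _ le) scaleNr.
- by rewrite k2h (linear_scaleE _ _ le) scalerN scaleNr opprK.
- by rewrite k1h (linear_scaleE _ _ les) (linear_scaleE _ _ le).
- by rewrite k2h (linear_scaleE _ _ les) (linear_scaleE _ _ le).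
Qed.

Lemma intertwines_comb X Y M N c d : intertwines X M -> intertwines Y N ->
  intertwines (fun x => c *: X x + d *: Y x) (c *: M + d *: N).
Proof.
move=> hX hY x k; rewrite tofock_linear (linear_scaleE _ _ (@tofock_linear k)) hX hY.
rewrite !scaler_sumr -big_split; apply: eq_bigr => l _ /=.
by rewrite !mxE scalerDl !scalerA.
Qed.

Lemma intertwines_scale X M c : intertwines X M -> intertwines (fun x => c *: X x) (c *: M).
Proof.
move=> hX x k; rewrite (linear_scaleE _ _ (@tofock_linear k)) hX scaler_sumr.
by apply: eq_bigr => l _ /=; rewrite !mxE scalerA.
Qed.

Lemma intertwines_add X Y M N : intertwines X M -> intertwines Y N ->
  intertwines (fun x => X x + Y x) (M + N).
Proof.
move=> hX hY x k; have := intertwines_comb 1 1 hX hY x k.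
by rewrite !scale1r.
Qed.

Lemma intertwines_comp X Y M N : intertwines X M -> intertwines Y N ->
  intertwines (X \o Y) (M *m N).
Proof.
move=> hX hY x k; rewrite /= hX.
transitivity (\sum_l \sum_j (M k l * N l j) *: tofock j x).
  by apply: eq_bigr => l _; rewrite hY scaler_sumr; apply: eq_bigr => j _; rewrite scalerA.
rewrite exchange_big; apply: eq_bigr => l _ /=.
by rewrite !mxE scaler_suml.
Qed.

Lemma intertwines_id : intertwines id 1%:M.
Proof.
move=> x k; rewrite (bigD1 k) //= mxE eqxx scale1r big1 ?addr0 // => l lk.
by rewrite mxE eq_sym (negPf lk) scale0r.
Qed.

End intertwiner.

Section fermions.
Variables (C : numClosedFieldType) (H : hilbertType C).
Implicit Types f g e : H -> H.

Lemma anti_self0 f : anti f f 0 -> forall x, f (f x) = 0.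
Proof.
move=> h x; have := h x; rewrite scale0r -mulr2n -scaler_nat => /eqP.
by rewrite scaler_eq0 pnatr_eq0 /= => /eqP.
Qed.

Lemma anti0E f g : anti f g 0 -> forall x, f (g x) = - g (f x).
Proof. by move=> h x; have /eqP := h x; rewrite scale0r addr_eq0 => /eqP. Qed.

Lemma anti1E f g : anti f g 1 -> forall x, f (g x) + g (f x) = x.
Proof. by move=> h x; rewrite h scale1r. Qed.

(** Apply {e, e^*} = 1 at e^* x, where the second term is killed by e^* e^* = 0. Thus x |-> (e x, e
    e^* x) is isometric. *)
Lemma fermion_norm e es : adjoint e es -> anti es es 0 -> anti e es 1 ->
  forall x, `|e x| ^+ 2 + `|e (es x)| ^+ 2 = `|x| ^+ 2.
Proof.
move=> ae hes hees x.
have := anti_adjoint_normE ae hees (es x).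
rewrite (anti_self0 hes) normr0 expr0n addr0 mul1r => ->.
by rewrite (anti_adjoint_normE ae hees) mul1r.
Qed.
End fermions.

(** * Splitting off the second fermion *)

Section residual.
Variables (R : realType).
Local Notation C := (Cplx R).
Variables (H : hilbertType C) (e es h hs : H -> H) (del x2 : R) (u2 : C).
Hypotheses (le : linear e) (les : linear es) (lh : linear h) (lhs : linear hs).
Hypotheses (ae : adjoint e es) (ah : adjoint h hs).
Hypotheses (eh : anti e h 0) (ehs : anti e hs 0) (esh : anti es h 0) (eshs : anti es hs 0).
Let w' := Cr (del * x2) * u2.
Hypotheses (hh : anti h h (2 * w')) (hhs : anti h hs (Cr del)).
Hypotheses (del0 : 0 <= del) (hx2 : 0 <= x2 <= 1 / 2) (hu2 : u2 * u2^* = 1).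
Let hshs : anti hs hs (2 * w'^*).
Proof. by have := anti_adjoint ah ah hh; rewrite rmorphM /= conjC_nat. Qed.
Let hsh : anti hs h (Cr del). Proof. exact: anti_sym. Qed.
Let sd : R := Num.sqrt del.
Let a := ca x2.
Let b := cb x2.

Lemma residual_factor : exists k1 k2 : H -> H,
  [/\ [/\ linear k1, linear k2 & forall x, `|k1 x| ^+ 2 + `|k2 x| ^+ 2 = `|x| ^+ 2],
      [/\ forall x, k1 (e x) = - e (k1 x), forall x, k1 (es x) = - es (k1 x),
          forall x, k2 (e x) = e (k2 x) & forall x, k2 (es x) = es (k2 x)],
      (forall x, k1 (h x) = (Cr (sd * b) * u2) *: k2 x) /\
      (forall x, k2 (h x) = Cr (sd * a) *: k1 x) &
      (forall x, k1 (hs x) = Cr (sd * a) *: k2 x) /\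
      (forall x, k2 (hs x) = (Cr (sd * b) * u2^*) *: k1 x)].
Proof.
have sd2 : sd ^+ 2 = del by rewrite sqr_sqrtr.
have ab1 := cacb_sqr hx2; have abx := cacb_mul hx2; rewrite -/a -/b in ab1 abx.
(* A vanishing {h, h^*} forces h = 0; then k1 = 0 and k2 = 1. *)
have [d0|dN0] := eqVneq del 0.
  have hhs0 : anti h hs 0 by move: hhs; rewrite d0 Cr0.
  have h0 x : h x = 0 := (anti_adjoint_eq0 ah hhs0 x).1.
  have hs0 x : hs x = 0 := (anti_adjoint_eq0 ah hhs0 x).2.
  have sd0 : sd = 0 by rewrite /sd d0 sqrtr0.
  exists (fun=> 0), id; split; first split => //.
  - by move=> c x y; rewrite scaler0 addr0.
  - by move=> x; rewrite normr0 expr0n add0r.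
  - have lin0 (f : H -> H) : linear f -> f 0 = 0.
      by move=> lf; rewrite -[0 in LHS](addNr (0 : H)) -scaleN1r lf scaleN1r addNr.
    by split=> // x; rewrite lin0 // oppr0.
  - by split=> x; rewrite ?h0 sd0 mul0r Cr0 ?mul0r scale0r.
  - by split=> x; rewrite ?hs0 sd0 mul0r Cr0 ?mul0r scale0r.
have sdN0 : Cr sd != 0 by rewrite fmorph_eq0; apply: contraNneq dN0 => s0; rewrite -sd2 s0 expr0n.
have csd2 : Cr sd ^+ 2 = Cr del by rewrite -CrX sd2.
have cab1 : Cr a ^+ 2 + Cr b ^+ 2 = 1 by rewrite -!CrX -CrD ab1 Cr1.
have cabx : Cr a * Cr b = Cr x2 by rewrite -CrM abx.
have w'E : w' = Cr sd ^+ 2 * (Cr a * Cr b) * u2 by rewrite cabx csd2 -CrM.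
have w'cE : w'^* = Cr sd ^+ 2 * (Cr a * Cr b) * u2^* by rewrite w'E !(rmorphM, rmorphXn) /= !conj_Cr.
have [x12|x12] := eqVneq x2 (1 / 2).
  have aE : a = Num.sqrt 2 / 2.
    by rewrite /a /ca x12 (_ : 1 - 2 * (1 / 2) = 0) ?sqrtr0 ?addr0; [congr (Num.sqrt _ / _); field|field].
  have bE : b = Num.sqrt 2 / 2.
    by rewrite /b /cb x12 (_ : 1 - 2 * (1 / 2) = 0) ?sqrtr0 ?subr0; [congr (Num.sqrt _ / _); field|field].
  have ba : b = a by rewrite aE bE.
  have a2 : Cr a * Cr a = 2^-1.
    by rewrite -CrM -(Cr_nat R 2) -CrV; congr Cr; move: ab1; rewrite ba => ab1; rewrite -expr2; lra.
  (* The operator h^* - u2^* h has zero anticommutator with its adjoint because a = b, hence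
     vanishes. *)
  have hsE x : hs x = u2^* *: h x.
    have lF : linear (fun x => 1 *: hs x + (- u2^*) *: h x) by exact: linear_comb2.
    have aF := adjoint_comb2 1 (- u2^*) (adjoint_sym ah) ah.
    have := anti_comb2 1 1^* (- u2^*) (- u2^*)^* lhs lh lh lhs hsh hshs hh hhs.
    move=> hF; have : 1 * 1^* * Cr del + 1 * (- u2^*)^* * (2 * w'^*) + - u2^* * 1^* * (2 * w') + - u2^* * (- u2^*)^* * Cr del = 0 :> C.
      rewrite rmorph1 rmorphN /= conjCK w'cE w'E ba a2 -csd2.
      transitivity (Cr sd ^+ 2 * (1 - u2 * u2^*)); first by field.
      by rewrite hu2 subrr mulr0.
    move=> F0; rewrite F0 in hF; have [F0x _] := anti_adjoint_eq0 aF hF x.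
    by move: F0x; rewrite scale1r scaleNr => /eqP; rewrite subr_eq0 => /eqP.
  have hhE x : h (h x) = w' *: x.
    have two0 : (2 : C) != 0 by rewrite pnatr_eq0.
    by apply: (scalerI two0); rewrite scaler_nat mulr2n hh scalerA.
  have nh x : `|h x| ^+ 2 = Cr del / 2 * `|x| ^+ 2.
    have := anti_adjoint_normE ah hhs x; rewrite hsE normrZ.
    have -> : `|u2^*| = 1.
      by rewrite norm_conjC; apply/eqP; rewrite -sqrp_eq1 // normCK hu2.
    rewrite mul1r => E; transitivity ((`|h x| ^+ 2 + `|h x| ^+ 2) / 2); first by field.
    by rewrite E; field.
  exists (fun x => (Cr sd)^-1 *: h x), (fun x => Cr a *: x); split; first split.
  - by move=> c x y; rewrite lh scalerDr !scalerA [c * _]mulrC.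
  - by move=> c x y; rewrite scalerDr !scalerA [c * _]mulrC.
  - move=> x; rewrite !normrZ !exprMn nh normfV !norm_Cr.
    rewrite [`|sd|]ger0_norm ?sqrtr_ge0 // exprVn csd2 -CrX real_normK ?num_real // CrX [Cr a ^+ 2]expr2 a2.
    have dC : Cr del != 0 by rewrite fmorph_eq0.
    by field.
  - split=> x.
    + by rewrite (anti0E (anti_sym eh)) scalerN (linear_scaleE _ _ le).
    + by rewrite (anti0E (anti_sym esh)) scalerN (linear_scaleE _ _ les).
    + by rewrite (linear_scaleE _ _ le).
    + by rewrite (linear_scaleE _ _ les).
  - split=> x.
    + rewrite hhE !scalerA; congr (_ *: _); rewrite w'E ba CrM.
      by field.
    + by rewrite scalerA CrM; congr (_ *: _); field.
  - split=> x.
    + rewrite hsE (linear_scaleE _ _ lh) hhE !scalerA; congr (_ *: _); rewrite w'E ba CrM.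
      transitivity (Cr sd * (Cr a * Cr a) * (u2 * u2^*)); first by field.
      by rewrite hu2; ring.
    + by rewrite hsE !scalerA ba CrM; congr (_ *: _); field.
have d2N0 : Cr a ^+ 2 - Cr b ^+ 2 != 0.
  rewrite -!CrX -CrB fmorph_eq0 gt_eqF // cacb_lt // lt_neqAle x12.
  by move: hx2 => /andP[].
set D2 := Cr a ^+ 2 - Cr b ^+ 2 in d2N0.
pose al : C := Cr a / (Cr sd * D2).
pose be : C := - (Cr b * u2 / (Cr sd * D2)).
have D2c : D2^* = D2 by rewrite rmorphB !rmorphXn /= !conj_Cr.
have sDc : (Cr sd * D2)^* = Cr sd * D2 by rewrite rmorphM /= D2c conj_Cr.
have alc : al^* = al by rewrite /al rmorphM /= fmorphV /= sDc conj_Cr.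
have bec : be^* = - (Cr b * u2^* / (Cr sd * D2)).
  by rewrite /be rmorphN /= rmorphM /= fmorphV /= sDc [(Cr b * u2)^*]rmorphM /= conj_Cr.
pose f x := al *: h x + be *: hs x.
pose fs x := al^* *: hs x + be^* *: h x.
have lf : linear f by exact: linear_comb2.
have lfs : linear fs by exact: linear_comb2.
have af : adjoint f fs := adjoint_comb2 al be ah (adjoint_sym ah).
have ff : anti f f 0.
  have := anti_comb2 al al be be lh lhs lh lhs hh hhs hsh hshs.
  suff -> : al * al * (2 * w') + al * be * Cr del + be * al * Cr del + be * be * (2 * w'^*) = 0 :> C by [].
  rewrite w'cE w'E -csd2 /al /be.
  transitivity (2 * Cr a * Cr b * u2 * (Cr a ^+ 2 + Cr b ^+ 2 * (u2 * u2^*) - 1) / D2 ^+ 2); first by field; rewrite d2N0 sdN0.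
  by rewrite hu2 mulr1 cab1 subrr mulr0 mul0r.
have ffs : anti f fs 1.
  have := anti_comb2 al al^* be be^* lh lhs lhs lh hhs hh hshs hsh.
  suff -> : al * al^* * Cr del + al * be^* * (2 * w') + be * al^* * (2 * w'^*) + be * be^* * Cr del = 1 :> C by [].
  rewrite w'cE w'E -csd2 bec alc /al /be.
  transitivity ((Cr a ^+ 2 + Cr b ^+ 2 * (u2 * u2^*) - 4 * Cr a ^+ 2 * Cr b ^+ 2 * (u2 * u2^*)) / D2 ^+ 2); first by field; rewrite d2N0 sdN0.
  have D2E : D2 ^+ 2 = (Cr a ^+ 2 + Cr b ^+ 2) ^+ 2 - 4 * Cr a ^+ 2 * Cr b ^+ 2.
    by rewrite /D2; ring.
  by rewrite hu2 !mulr1 cab1 -[X in X - _](expr1n _ 2) -[X in X ^+ 2 - _]cab1 -D2E divff // expf_neq0.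
have fsfs : anti fs fs 0 by have := anti_adjoint af af ff; rewrite rmorph0.
have ef : anti e f 0.
  move=> x; rewrite /f le (linear_scaleE _ _ le) (anti0E eh) (anti0E ehs) !scalerN.
  by rewrite addrACA !addNr addr0 scale0r.
have esf : anti es f 0.
  move=> x; rewrite /f les (linear_scaleE _ _ les) (anti0E esh) (anti0E eshs) !scalerN.
  by rewrite addrACA !addNr addr0 scale0r.
have efs : anti e fs 0.
  move=> x; rewrite /fs le (linear_scaleE _ _ le) (anti0E eh) (anti0E ehs) !scalerN.
  by rewrite addrACA !addNr addr0 scale0r.
have esfs : anti es fs 0.
  move=> x; rewrite /fs les (linear_scaleE _ _ les) (anti0E esh) (anti0E eshs) !scalerN.
  by rewrite addrACA !addNr addr0 scale0r.
have saE : Cr (sd * a) = Cr sd * Cr a := CrM _ _.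
have sbE : Cr (sd * b) = Cr sd * Cr b := CrM _ _.
have co1 : Cr (sd * a) * al + Cr (sd * b) * u2 * be^* = 1.
  rewrite bec /al saE sbE; transitivity ((Cr a ^+ 2 - Cr b ^+ 2 * (u2 * u2^*)) / D2); first by field; rewrite d2N0 sdN0.
  by rewrite hu2 mulr1 divff.
have co2 : Cr (sd * a) * be + Cr (sd * b) * u2 * al^* = 0.
  by rewrite alc /al /be saE sbE; field; rewrite d2N0 sdN0.
have co3 : Cr (sd * a) * al^* + Cr (sd * b) * u2^* * be = 1.
  rewrite alc /al /be saE sbE; transitivity ((Cr a ^+ 2 - Cr b ^+ 2 * (u2 * u2^*)) / D2); first by field; rewrite d2N0 sdN0.
  by rewrite hu2 mulr1 divff.
have co4 : Cr (sd * a) * be^* + Cr (sd * b) * u2^* * al = 0.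
  by rewrite bec /al saE sbE; field; rewrite d2N0 sdN0.
have fE x : h x = Cr (sd * a) *: f x + (Cr (sd * b) * u2) *: fs x.
  rewrite /f /fs !scalerDr !scalerA [_ *: hs x + _ *: h x]addrC addrACA -!scalerDl.
  by rewrite co1 co2 scale1r scale0r addr0.
have fsE x : hs x = Cr (sd * a) *: fs x + (Cr (sd * b) * u2^*) *: f x.
  rewrite /f /fs !scalerDr !scalerA [_ *: h x + _ *: hs x]addrC addrACA -!scalerDl.
  by rewrite co3 co4 scale1r scale0r addr0.
have ff0 := anti_self0 ff; have fsfs0 := anti_self0 fsfs.
have lin0 (k : H -> H) : linear k -> k 0 = 0.
  by move=> lk; rewrite -[0 in LHS](addNr (0 : H)) -scaleN1r lk scaleN1r addNr.
have ffsf x : f (fs (f x)) = f x.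
  by have := anti1E ffs (f x); rewrite ff0 (lin0 _ lfs) addr0.
exists f, (f \o fs); split; first split => //.
- by move=> c x y /=; rewrite lfs lf.
- by move=> x /=; exact: fermion_norm af fsfs ffs x.
- have linN (k : H -> H) x : linear k -> k (- x) = - k x.
    by move=> lk; rewrite -scaleN1r (linear_scaleE _ _ lk) scaleN1r.
  split=> x /=.
  + by rewrite (anti0E (anti_sym ef)).
  + by rewrite (anti0E (anti_sym esf)).
  + by rewrite (anti0E (anti_sym efs)) (linN f) // (anti0E (anti_sym ef)) opprK.
  + by rewrite (anti0E (anti_sym esfs)) (linN f) // (anti0E (anti_sym esf)) opprK.
- split=> x /=; rewrite fE.
  + by rewrite lf (linear_scaleE _ _ lf) ff0 scaler0 add0r.
  + by rewrite lfs (linear_scaleE _ _ lfs) fsfs0 scaler0 addr0 (linear_scaleE _ _ lf) ffsf.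
- split=> x /=; rewrite fsE.
  + by rewrite lf (linear_scaleE _ _ lf) ff0 scaler0 addr0.
  + by rewrite lfs (linear_scaleE _ _ lfs) fsfs0 scaler0 add0r (linear_scaleE _ _ lf) ffsf.
Qed.

End residual.

(** * Irreducible representations lie over points of the domain *)

Section evaluation.
Variable R : realType.
Local Notation C := (Cplx R).
Implicit Type p : point6 R.

Definition podd p : 'M[C]_4 :=
  odd_part (Cr (Num.sqrt (pdel p) * pa p)) (Cr (Num.sqrt (pdel p) * pb p) * pu2 p).

Definition ev p (i : 'I_2) : 'M[C]_4 :=
  if i == 0 then gen0 (Cr (pA p)) (pB p) (pt p) (podd p)
  else gen1 (Cr (pA p)) (pB p) (pt p) (pu p) (podd p).

End evaluation.

Lemma ord2P (i : 'I_2) : i = 0 \/ i = 1.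
Proof. by case: i => [[|[|//]] ?]; [left|right]; exact/val_inj. Qed.

Section anti_more.
Variables (C : numClosedFieldType) (H : hilbertType C).
Implicit Types f g k : H -> H.

Lemma anti_comb1 k f g (c d a b : C) : linear k ->
  anti k f a -> anti k g b -> anti k (fun x => c *: f x + d *: g x) (c * a + d * b).
Proof.
move=> lk hf hg x; rewrite lk (linear_scaleE _ _ lk) addrACA -!scalerDr hf hg.
by rewrite !scalerA -scalerDl.
Qed.

Lemma anti_eq f g (c c' : C) : anti f g c -> c = c' -> anti f g c'.
Proof. by move=> h <-. Qed.
End anti_more.

Section representation.
Variables (R : realType) (eps : R).
Local Notation C := (Cplx R).
Variables (H : hilbertType C) (T : op_family 'I_2 H).
Hypotheses (eps0 : 0 < eps) (hT : wcar_annulus eps T).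
Local Notation op := (op T).
Local Notation adj := (adj T).

Let lop i : linear (op i). Proof. exact: linearP. Qed.
Let ladj i : linear (adj i). Proof. exact: linearP. Qed.
Let aop i : adjoint (op i) (adj i). Proof. by move=> x y; exact: op_adj. Qed.
Let car i : anti (op i) (adj i) 1.
Proof. by move=> x; have [[h _] _ _] := hT; rewrite addrC h scale1r. Qed.
Let a01 : anti (adj 0) (op 1) 0.
Proof. by move=> x; have [[_ h] _ _] := hT; rewrite h addNr scale0r. Qed.
Let a01' : anti (op 0) (adj 1) 0.
Proof. by have := anti_adjoint (adjoint_sym (aop 0)) (aop 1) a01; rewrite rmorph0. Qed.
Let Hne : exists x : H, x != 0. Proof. by have [_ [h _] _] := hT. Qed.

Lemma wcar_contractive i x : `|op i x| <= `|x| /\ `|adj i x| <= `|x|.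
Proof.
have h := anti_adjoint_normE (aop i) (car i) x; rewrite mul1r in h.
by split; rewrite -ler_sqr ?nnegrE // -h ?lerDl ?lerDr exprn_ge0.
Qed.

(** The relations move op i squared past every generator and adjoint: past the other generator the
    terms in y cancel, past its adjoint the sign changes twice, and past its own adjoint the
    relation {a, a^*} = 1 is used twice. Schur's lemma then applies. *)
Lemma wcar_square i : exists c : C, forall x, op i (op i x) = c *: x.
Proof.
have [_ irr [y _ hy]] := hT.
have ac j x : adj j (op j x) = x - op j (adj j x).
  by rewrite -[X in X - _](anti1E (car j)) addrC addKr.
have anti_oa j k : j != k -> anti (op j) (adj k) 0.
  have [->|->] := ord2P j; have [->|->] := ord2P k => // _.
  exact: anti_sym.
have hyy j k x : j != k -> op j (op k x) = y *: x - op k (op j x).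
  have [->|->] := ord2P j; have [->|->] := ord2P k => // _; rewrite -hy.
    by rewrite addrC addKr.
  by rewrite addrK.
have co j x : op i (op i (op j x)) = op j (op i (op i x)).
  have [->//|ij] := eqVneq i j.
  rewrite (hyy _ _ x ij) (linearB (op i)) (linearZ_LR (op i)) (hyy _ _ (op i x) ij).
  by rewrite opprB addrC subrK.
have ca j x : op i (op i (adj j x)) = adj j (op i (op i x)).
  have [<-|ij] := eqVneq i j.
    have -> : op i (adj i x) = x - adj i (op i x).
      by rewrite -[X in X - _](anti1E (car i)) addrK.
    by rewrite (ac i (op i x)) (linearB (op i)).
  have h := anti0E (anti_oa _ _ ij).
  by rewrite h (linearN (op i)) h opprK.
have l2 : linear (fun x => op i (op i x)) by move=> c x z; rewrite !linearP.
have l2' : linear (fun x => adj i (adj i x)) by move=> c x z; rewrite !linearP.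
have ad2 x z : dot (op i (op i x)) z = dot x (adj i (adj i z)) by rewrite !op_adj.
have n1 x := (wcar_contractive i x).1; have n2 x := (wcar_contractive i x).2.
apply: (schur irr wcar_contractive l2 l2') => //.
- by move=> x; rewrite (le_trans (n1 _)).
- by move=> x; rewrite (le_trans (n2 _)).
- have ad2' x z : dot (adj i (adj i x)) z = dot x (op i (op i z)).
    by rewrite !(adjoint_sym (aop i)).
  move=> j x; split; apply: dot_ext => z.
    by rewrite ad2' !op_adj ad2' ca.
  have aj := adjoint_sym (aop j).
  by rewrite ad2' (aj x) (aj _ z) ad2' co.
Qed.

(** The classification of representations, in the form needed for norm estimates: an isometry into
    four copies of the space that intertwines the generators with the model at some point p. The
    point is found from the scalar anticommutators. *)
Lemma rep_at_point : exists p : point6 R, DT3 eps p /\ exists J : 'I_4 -> H -> H,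
  [/\ forall k, linear (J k), forall x, \sum_k `|J k x| ^+ 2 = `|x| ^+ 2 &
     forall i x k, J k (op i x) = \sum_l ev p i k l *: J l x /\
                   J k (adj i x) = \sum_l (ev p i) ^t* k l *: J l x].
Proof.
have [_ _ [y /andP[ylo yhi] hy]] := hT.
have [c0 hc0] := wcar_square 0; have [c1 hc1] := wcar_square 1.
have y0 : y != 0.
  rewrite -normr_gt0 (lt_le_trans _ ylo) //.
  by rewrite -[X in X < _](Cr0 R) ltr_Cr.
pose r := re `|y|; have rE : Cr r = `|y| by rewrite Cr_re_ge0.
have reps : eps <= r by rewrite -ler_Cr rE.
have r0 : 0 < r by exact: lt_le_trans reps.
have r1 : r <= 1 by rewrite -ler_Cr rE Cr1.
pose u := y / `|y|.
have ny0 : `|y| != 0 by rewrite normr_eq0.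
have yE : y = Cr r * u by rewrite rE /u mulrC divfK.
have uu : u * u^* = 1.
  by rewrite -normCK /u normrM normfV normr_id divff ?expr1n.
have ycE : y^* = Cr r * u^* by rewrite yE rmorphM /= conj_Cr.
have h00 : anti (op 0) (op 0) (2 * c0).
  by move=> x; rewrite hc0 -scalerA -mulr2n scaler_nat.
have h11 : anti (op 1) (op 1) (2 * c1).
  by move=> x; rewrite hc1 -scalerA -mulr2n scaler_nat.
have h10 : anti (op 1) (op 0) y by [].
have h01 := anti_sym h10.
have s00 := anti_adjoint (aop 0) (aop 0) h00.
have s11 := anti_adjoint (aop 1) (aop 1) h11.
have s10 := anti_adjoint (aop 1) (aop 0) h10.
have s01 := anti_sym s10.
have h0s0 := car 0; have h1s1 := car 1; have s0h0 := anti_sym h0s0; have s1h1 := anti_sym h1s1.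
have s0h1 := a01; have h1s0 := anti_sym a01; have h0s1 := a01'; have s1h0 := anti_sym a01'.
have kk := kap_sqr C; have kc := kap_conj C.
(* These are the scalars b_1^2 = b_2^2 = w and {b_1, b_2} = z. *)
pose w := (c0 + u ^+ 2 * c1^*) / 2; pose z := c0 - u ^+ 2 * c1^*.
(* The rotation makes b_1 anticommute with the adjoint of b_2, and splits {b_i, b_i^*} into 1 + r
   and 1 - r. *)
pose b1 x := kap C *: op 0 x + (kap C * u) *: adj 1 x.
pose b1s x := kap C *: adj 0 x + (kap C * u^*) *: op 1 x.
pose b2 x := kap C *: op 0 x + (- (kap C * u)) *: adj 1 x.
pose b2s x := kap C *: adj 0 x + (- (kap C * u^*)) *: op 1 x.
have lb1 : linear b1 by exact: linear_comb2.
have lb1s : linear b1s by exact: linear_comb2.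
have lb2 : linear b2 by exact: linear_comb2.
have lb2s : linear b2s by exact: linear_comb2.
have ab1 : adjoint b1 b1s.
  have := adjoint_comb2 (kap C) (kap C * u) (aop 0) (adjoint_sym (aop 1)).
  by rewrite rmorphM /= kc.
have ab2 : adjoint b2 b2s.
  have := adjoint_comb2 (kap C) (- (kap C * u)) (aop 0) (adjoint_sym (aop 1)).
  by rewrite rmorphN rmorphM /= kc.
have b11 : anti b1 b1 (2 * w).
  apply: anti_eq (anti_comb2 _ _ _ _ (lop 0) (ladj 1) (lop 0) (ladj 1) h00 h0s1 s1h0 s11) _.
  rewrite rmorphM /= conjC_nat.
  transitivity (2 * (kap C * kap C) * (c0 + u ^+ 2 * c1^*)); first by ring.
  by rewrite kk /w; field.
have b11s : anti b1 b1s (1 + Cr r).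
  apply: anti_eq (anti_comb2 _ _ _ _ (lop 0) (ladj 1) (ladj 0) (lop 1) h0s0 h01 s10 s1h1) _.
  rewrite ycE yE.
  transitivity ((kap C * kap C) * (1 + u * u^* + 2 * Cr r * (u * u^*))); first by ring.
  by rewrite kk uu; field.
have b12 : anti b1 b2 z.
  apply: anti_eq (anti_comb2 _ _ _ _ (lop 0) (ladj 1) (lop 0) (ladj 1) h00 h0s1 s1h0 s11) _.
  rewrite rmorphM /= conjC_nat.
  transitivity (2 * (kap C * kap C) * (c0 - u ^+ 2 * c1^*)); first by ring.
  by rewrite kk /z; field.
have b12s : anti b1 b2s 0.
  apply: anti_eq (anti_comb2 _ _ _ _ (lop 0) (ladj 1) (ladj 0) (lop 1) h0s0 h01 s10 s1h1) _.
  rewrite ycE yE.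
  transitivity ((kap C * kap C) * (1 - u * u^*)); first by ring.
  by rewrite uu subrr mulr0.
have b22 : anti b2 b2 (2 * w).
  apply: anti_eq (anti_comb2 _ _ _ _ (lop 0) (ladj 1) (lop 0) (ladj 1) h00 h0s1 s1h0 s11) _.
  rewrite rmorphM /= conjC_nat.
  transitivity (2 * (kap C * kap C) * (c0 + u ^+ 2 * c1^*)); first by ring.
  by rewrite kk /w; field.
have b22s : anti b2 b2s (1 - Cr r).
  apply: anti_eq (anti_comb2 _ _ _ _ (lop 0) (ladj 1) (ladj 0) (lop 1) h0s0 h01 s10 s1h1) _.
  rewrite ycE yE.
  transitivity ((kap C * kap C) * (1 + u * u^* - 2 * Cr r * (u * u^*))); first by ring.
  by rewrite kk uu; field.
have bss11 := anti_adjoint ab1 ab1 b11.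
have bs1b2 : anti b1s b2 0 by have := anti_adjoint ab1 (adjoint_sym ab2) b12s; rewrite rmorph0.
have bss12 := anti_adjoint ab1 ab2 b12.
have bss22 := anti_adjoint ab2 ab2 b22.
have op0E x : op 0 x = kap C *: (b1 x + b2 x).
  rewrite /b1 /b2 addrACA scaleNr addrN addr0 -scalerDl scalerA mulrDr kk.
  by rewrite -[LHS]scale1r; congr (_ *: _); field.
have adj0E x : adj 0 x = kap C *: (b1s x + b2s x).
  rewrite /b1s /b2s addrACA scaleNr addrN addr0 -scalerDl scalerA mulrDr kk.
  by rewrite -[LHS]scale1r; congr (_ *: _); field.
have op1E x : op 1 x = (kap C * u) *: (b1s x - b2s x).
  rewrite /b1s /b2s opprD addrACA subrr add0r scaleNr opprK -scalerDl scalerA.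
  rewrite -[LHS]scale1r; congr (_ *: _).
  transitivity (2 * (kap C * kap C) * (u * u^*)); last by ring.
  by rewrite kk uu; field.
have adj1E x : adj 1 x = (kap C * u^*) *: (b1 x - b2 x).
  rewrite /b1 /b2 opprD addrACA subrr add0r scaleNr opprK -scalerDl scalerA.
  rewrite -[LHS]scale1r; congr (_ *: _).
  transitivity (2 * (kap C * kap C) * (u * u^*)); last by ring.
  by rewrite kk uu; field.
(* From here on b_1 and b_2 enter only through their anticommutators, and the generators through
   [op0E] to [adj1E]. *)
clearbody b1 b1s b2 b2s w z u r.
(* Positivity for b_2 gives 2 |w| <= 1 - r, so the discriminant is positive. *)
have wle : 2 * `|w| <= 1 - Cr r by exact: (anti_norm_le Hne lb2 lb2s ab2 b22s b22).
have wr : 2 * Num.sqrt (re w ^+ 2 + im w ^+ 2) < 1 + r.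
  rewrite (@le_lt_trans _ _ (1 - r)) //; last by rewrite ltrD2l gtrN.
  by rewrite -ler_Cr CrM -norm_sqrtE Cr_nat CrB Cr1.
have [A AE] : {A : C | A = Cr (coefA r w)} by exists (Cr (coefA r w)).
have [B BE] : {B : C | B = coefB r w} by exists (coefB r w).
have [D DE] : {D : C | D = Cr (disc r w)} by exists (Cr (disc r w)).
have AAd : A ^+ 2 + B * B^* = 1 + Cr r by rewrite AE BE coefAB_add.
have AAs : A ^+ 2 - B * B^* = D by rewrite AE BE DE coefAB_sub.
have ABw : A * B = w by rewrite AE BE coefAB.
have D0 : D != 0 by rewrite DE fmorph_eq0 gt_eqF // disc_gt0.
have Ac : A^* = A by rewrite AE conj_Cr.
have Dc : D^* = D by rewrite DE conj_Cr.
have wc : w^* = A * B^* by rewrite -ABw rmorphM /= Ac.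
have [t tE] : {t : C | t = z / D} by exists (z / D).
have zE : z = t * D by rewrite tE divfK.
have zcE : z^* = t^* * D by rewrite zE rmorphM /= Dc.
have wcE2 : (2 * w)^* = 2 * (A * B^*) by rewrite rmorphM /= conjC_nat wc.
(* The inverse Bogoliubov transformation, solving b_1 = A e + B e^* and its adjoint for e. *)
pose e x := (A / D) *: b1 x + (- (B / D)) *: b1s x.
pose es x := (A / D) *: b1s x + (- (B^* / D)) *: b1 x.
have le : linear e by exact: linear_comb2.
have les : linear es by exact: linear_comb2.
have ae : adjoint e es.
  have := adjoint_comb2 (A / D) (- (B / D)) ab1 (adjoint_sym ab1).
  by rewrite rmorphN !rmorphM !fmorphV /= Ac Dc.
have AAs0 : A ^+ 2 - B * B^* != 0 by rewrite AAs.
have ee : anti e e 0.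
  apply: anti_eq (anti_comb2 _ _ _ _ lb1 lb1s lb1 lb1s b11 b11s (anti_sym b11s) bss11) _.
  by rewrite wcE2 -ABw -AAd -AAs; field.
have ees : anti e es 1.
  apply: anti_eq (anti_comb2 _ _ _ _ lb1 lb1s lb1s lb1 b11s b11 bss11 (anti_sym b11s)) _.
  by rewrite wcE2 -ABw -AAd -AAs; field.
have eses : anti es es 0 by have := anti_adjoint ae ae ee; rewrite rmorph0.
have eb2 : anti e b2 (A * t).
  apply: anti_eq (anti_sym (anti_comb1 _ _ lb2 (anti_sym b12) (anti_sym bs1b2))) _.
  by rewrite zE; field.
have eb2s : anti e b2s (- (B * t^*)).
  apply: anti_eq (anti_sym (anti_comb1 _ _ lb2s (anti_sym b12s) (anti_sym bss12))) _.
  by rewrite zcE; field.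
have esb2 : anti es b2 (- (B^* * t)).
  by have := anti_adjoint ae (adjoint_sym ab2) eb2s; rewrite rmorphN rmorphM /= conjCK.
have esb2s : anti es b2s (A * t^*).
  by have := anti_adjoint ae ab2 eb2; rewrite rmorphM /= Ac.
(* P is the part of b_2 in e and e^*, so that h = b_2 - P anticommutes with both. *)
pose P x := (- (t * B^*)) *: e x + (t * A) *: es x.
pose Ps x := (- (t^* * B)) *: es x + (t^* * A) *: e x.
have lP : linear P by exact: linear_comb2.
have lPs : linear Ps by exact: linear_comb2.
have aP : adjoint P Ps.
  have := adjoint_comb2 (- (t * B^*)) (t * A) ae (adjoint_sym ae).
  by rewrite rmorphN !rmorphM /= conjCK Ac.
pose h x := 1 *: b2 x + (- 1) *: P x.
pose hs x := 1 *: b2s x + (- 1) *: Ps x.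
have lh : linear h by exact: linear_comb2.
have lhs : linear hs by exact: linear_comb2.
have ah : adjoint h hs.
  by have := adjoint_comb2 1 (- 1) ab2 aP; rewrite rmorphN /= conjC1.
have eh : anti e h 0.
  apply: anti_eq (anti_comb1 _ _ le eb2 (anti_comb1 _ _ le ee ees)) _; ring.
have esh : anti es h 0.
  apply: anti_eq (anti_comb1 _ _ les esb2 (anti_comb1 _ _ les (anti_sym ees) eses)) _; ring.
have ehs : anti e hs 0 by have := anti_adjoint (adjoint_sym ae) ah esh; rewrite rmorph0.
have eshs : anti es hs 0 by have := anti_adjoint ae ah eh; rewrite rmorph0.
pose w' := w + t ^+ 2 * w^*.
have hh : anti h h (2 * w').
  have b2P := anti_comb1 (- (t * B^*)) (t * A) lb2 (anti_sym eb2) (anti_sym esb2).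
  have hb2 := anti_sym (anti_comb1 1 (- 1) lb2 b22 b2P).
  have hP := anti_comb1 (- (t * B^*)) (t * A) lh (anti_sym eh) (anti_sym esh).
  apply: anti_eq (anti_comb1 1 (- 1) lh hb2 hP) _.
  by rewrite /w' wc; ring.
have hhs : anti h hs (1 - Cr r - t * t^* * (1 + Cr r)).
  have b2sP := anti_comb1 (- (t * B^*)) (t * A) lb2s (anti_sym eb2s) (anti_sym esb2s).
  have hb2s := anti_sym (anti_comb1 1 (- 1) lb2s (anti_sym b22s) b2sP).
  have hPs := anti_comb1 (- (t^* * B)) (t^* * A) lh (anti_sym esh) (anti_sym eh).
  apply: anti_eq (anti_comb1 1 (- 1) lh hb2s hPs) _.
  by rewrite -AAd; ring.
have e1 (v : C) : A * (A / D) + v * - (v^* / D) = (A ^+ 2 - v * v^*) / D by ring.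
have e2 (v : C) : A * - (v / D) + v * (A / D) = 0 by ring.
have b1E x : b1 x = A *: e x + B *: es x.
  rewrite /e /es !scalerDr !scalerA [(B * (A / D)) *: _ + _]addrC addrACA -!scalerDl.
  by rewrite e1 e2 AAs divff // scale1r scale0r addr0.
have b1sE x : b1s x = A *: es x + B^* *: e x.
  rewrite /e /es !scalerDr !scalerA [(B^* * (A / D)) *: _ + _]addrC addrACA -!scalerDl.
  rewrite e2 scale0r addr0 (_ : _ + _ = (A ^+ 2 - B * B^*) / D); last by ring.
  by rewrite AAs divff // scale1r.
have b2E x : b2 x = P x + h x by rewrite /h scale1r scaleN1r addrC subrK.
have b2sE x : b2s x = Ps x + hs x by rewrite /hs scale1r scaleN1r addrC subrK.
clearbody h hs.
have op0F x : op 0 x = kap C *: ((A - t * B^*) *: e x + (B + t * A) *: es x + h x).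
  by rewrite op0E b1E b2E /P addrA addrACA -!scalerDl.
have adj0F x : adj 0 x = kap C *: ((A - t^* * B) *: es x + (B^* + t^* * A) *: e x + hs x).
  by rewrite adj0E b1sE b2sE /Ps addrA addrACA -!scalerDl.
have op1F x : op 1 x = (kap C * u) *: ((B^* - t^* * A) *: e x + (A + t^* * B) *: es x + (- 1) *: hs x).
  rewrite op1E b1sE b2sE /Ps opprD addrA [A *: _ + _]addrC opprD [- _ - _ *: e x]addrC addrACA.
  by rewrite -!scaleNr -!scalerDl opprK scaleN1r.
have adj1F x : adj 1 x = (kap C * u^*) *: ((B - t * A) *: es x + (A + t * B^*) *: e x + (- 1) *: h x).
  rewrite adj1E b1E b2E /P opprD addrA [A *: _ + _]addrC opprD [- _ - _ *: es x]addrC addrACA.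
  by rewrite -!scaleNr -!scalerDl opprK scaleN1r.
clearbody e es P Ps.
pose Tt : R := re (t * t^*).
have TE : Cr Tt = t * t^* by rewrite Cr_re_ge0 // mul_conjC_ge0.
have T0 : 0 <= Tt by rewrite -Cr_ge0 TE mul_conjC_ge0.
clearbody Tt.
pose del : R := 1 - r - Tt * (1 + r).
have delE : 1 - Cr r - t * t^* * (1 + Cr r) = Cr del by rewrite -TE /del !CrB CrM CrD Cr1.
rewrite delE in hhs.
(* Positivity for h is what bounds the coordinate x_2 by 1/2. *)
have w'le := anti_norm_le Hne lh lhs ah hhs hh.
have del0 : 0 <= del by rewrite -Cr_ge0 (le_trans _ w'le) // mulr_ge0.
pose n' : R := re `|w'|.
have n'E : Cr n' = `|w'| by rewrite Cr_re_ge0.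
have n'0 : 0 <= n' by rewrite -Cr_ge0 n'E.
have n'le : 2 * n' <= del by rewrite -ler_Cr CrM n'E Cr_nat.
(* The coordinates invert the formulas for [ptau], [pt] and [pw']. A phase that is undetermined,
   because t or w' vanishes, is set to 1; for del = 0 the quotient [x2] is 0 by the convention on
   division. *)
pose x1 : R := Tt * (1 + r) / 2.
pose x2 : R := n' / del.
pose u1 : C := if t == 0 then 1 else t / `|t|.
pose u2 : C := if w' == 0 then 1 else w' / `|w'|.
have norm1 (v : C) : `|if v == 0 then 1 else v / `|v| | = 1.
  case: ifPn => [_|v0]; first by rewrite normr1.
  by rewrite normrM normfV normr_id divff // normr_eq0.
have normv (v : C) : `|v| * (if v == 0 then 1 else v / `|v|) = v.
  case: ifPn => [/eqP ->|v0]; first by rewrite normr0 mul0r.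
  by rewrite mulrC divfK // normr_eq0.
pose p : point6 R := (r, x1, x2, u, u1, u2).
have nu : `|u| = 1 by apply/eqP; rewrite -sqrp_eq1 // normCK uu.
have hx2 : 0 <= x2 <= 1 / 2.
  have [d0|dN0] := eqVneq del 0; first by rewrite /x2 d0 invr0 mulr0 lexx divr_ge0.
  have dp : 0 < del by rewrite lt_def dN0.
  by rewrite divr_ge0 // ler_pdivrMr //; lra.
have hp : DT3 eps p.
  split=> //.
  - by rewrite reps.
  - by rewrite divr_ge0 ?mulr_ge0 ?addr_ge0 ?(ltW r0) //= ler_pM2r // -subr_ge0 ; move: del0; rewrite /del.
  - by split=> //; exact: norm1.
have ptauE' : ptau p = Tt.
  by rewrite /ptau /px1 /pr /= /x1 [2 * _]mulrC divfK // mulfK // gt_eqF // addr_gt0.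
have ptE : pt p = t.
  rewrite /pt ptauE' /pu1 /= -[RHS](normv t); congr (_ * _).
  apply/eqP; rewrite -(eqrXn2 (n := 2)) ?normr_ge0 //; last by rewrite Cr_ge0 sqrtr_ge0.
  by rewrite -CrX sqr_sqrtr // TE normCK.
have pdE : pdel p = del.
  by rewrite /pdel /px1 /pr /= /x1 /del [2 * _]mulrC divfK.
have pw'E : pw' p = w'.
  rewrite /pw' pdE /px2 /pu2 /= -[RHS](normv w'); congr (_ * _).
  rewrite -n'E /x2; congr Cr.
  have [d0|dN0] := eqVneq del 0; last by rewrite mulrC divfK.
  by move: n'le; rewrite d0 mul0r; lra.
have pwE : pw p = w.
  have T1 := ptau_lt1 eps0 hp.
  have N0 : Cr (1 - ptau p ^+ 2) != 0.
    by rewrite fmorph_eq0 gt_eqF // subr_gt0 expr_lt1 // ptauE'.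
  rewrite /pw pw'E ptE; apply: (canLR (mulfK N0)).
  rewrite ptauE' CrB CrX TE Cr1 /w' rmorphD rmorphM rmorphXn /= conjCK; ring.
have pAE : Cr (pA p) = A by rewrite AE /pA pwE.
have pBE : pB p = B by rewrite BE /pB pwE.
have u22 : u2 * u2^* = 1 by apply: norm1_mulC; exact: norm1.
have hh' : anti h h (2 * (Cr (del * x2) * u2)).
  by have := pw'E; rewrite /pw' pdE => ->.
have [k1 [k2 [[lk1 lk2 nk] [k1e k1es k2e k2es] [k1h k2h] [k1hs k2hs]]]] :=
  residual_factor le les lh lhs ah eh ehs esh eshs hh' hhs del0 hx2 u22.
have ee0 := anti_self0 ee; have eses0 := anti_self0 eses; have ees1 := anti1E ees.
have lin0 (f : H -> H) : linear f -> f 0 = 0.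
  by move=> lf; rewrite -[0 in LHS](addNr (0 : H)) -scaleN1r lf scaleN1r addNr.
exists p; split=> //; exists (tofock e es k1 k2).
have it_e := intertwines_e le les ee0 ees1 k1e k2e.
have it_es := intertwines_es le les eses0 k1es k2es.
have it_h := intertwines_odd le les k1h k2h.
have it_hs := intertwines_odd le les k1hs k2hs.
split.
- by move=> k; exact: tofock_linear.
- move=> x; rewrite !big_ord_recl big_ord0 addr0 /tofock /= normrN -(nk x).
  rewrite -(fermion_norm ae eses ees (k1 x)) -(fermion_norm ae eses ees (k2 x)).
  ring.
- have poE : podd p = odd_part (Cr (Num.sqrt del * ca x2)) (Cr (Num.sqrt del * cb x2) * u2).
    by rewrite /podd pdE.
  have poEc : (podd p) ^t* = odd_part (Cr (Num.sqrt del * cb x2) * u2^*) (Cr (Num.sqrt del * ca x2)).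
    by rewrite poE odd_part_adj rmorphM /= !conj_Cr.
  have lc := @intertwines_comb _ _ _ _ _ _ le les lk1 lk2.
  have ls := @intertwines_scale _ _ _ _ _ _ le les lk1 lk2.
  have la := @intertwines_add _ _ _ _ _ _ le les lk1 lk2.
  have g0 (h0 : 'M[C]_4) : (gen0 A B t h0) ^t* =
      kap C *: ((A - t^* * B) *: mxE1s C + (B^* + t^* * A) *: mxE1 C + h0 ^t*).
    rewrite /gen0 adjmxZ !adjmxD !adjmxZ mxE1_adj mxE1s_adj kc.
    by rewrite rmorphB rmorphD !rmorphM /= conjCK Ac.
  have g1 (h0 : 'M[C]_4) : (gen1 A B t u h0) ^t* =
      (kap C * u^*) *: ((B - t * A) *: mxE1s C + (A + t * B^*) *: mxE1 C - h0).
    rewrite /gen1 adjmxZ adjmxD adjmxN trmxCK adjmxD !adjmxZ mxE1_adj mxE1s_adj.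
    by rewrite rmorphB rmorphD !rmorphM /= !conjCK Ac kc.
  move=> i x k; have [->|->] := ord2P i; rewrite /ev /= pAE pBE ptE ?g0 ?g1; split.
  + rewrite op0F poE; exact: (ls _ _ _ (la _ _ _ _ (lc _ _ _ _ _ _ it_e it_es) it_h) x k).
  + rewrite adj0F poEc.
    exact: (ls _ _ _ (la _ _ _ _ (lc _ _ _ _ _ _ it_es it_e) it_hs) x k).
  + rewrite op1F /gen1 poEc -[- odd_part _ _]scaleN1r.
    exact: (ls _ _ _ (la _ _ _ _ (lc _ _ _ _ _ _ it_e it_es) (ls _ _ _ it_hs)) x k).
  + rewrite adj1F poE -[- odd_part _ _]scaleN1r.
    exact: (ls _ _ _ (la _ _ _ _ (lc _ _ _ _ _ _ it_es it_e) (ls _ _ _ it_h)) x k).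
Qed.

End representation.

(** * C^4 as a Hilbert space *)

Section column_dot.
Variables (C : numClosedFieldType) (n : nat).
Local Notation V := ('cV[C]_n).
Implicit Types x y : V.

Definition dotcv x y : C := \sum_i x i 0 * (y i 0)^*.

Fact dotcv_bilinear : bilinear_for *%R (Num.conj \; *%R) dotcv.
Proof.
split=> [y|x] c u v; rewrite /= /dotcv mulr_sumr -big_split; apply: eq_bigr => i _ /=.
  by rewrite !mxE mulrDl mulrA.
by rewrite !mxE rmorphD rmorphM mulrDr mulrCA.
Qed.
HB.instance Definition _ := bilinear_isBilinear.Build C V V C *%R (Num.conj \; *%R) dotcv dotcv_bilinear.

Fact dotcv_herm x y : dotcv x y = (-1) ^+ false * (dotcv y x)^*.
Proof.
rewrite expr0 mul1r /dotcv rmorph_sum; apply: eq_bigr => i _.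
by rewrite rmorphM /= conjCK mulrC.
Qed.
HB.instance Definition _ := isHermitianSesquilinear.Build C V false Num.conj dotcv dotcv_herm.

Lemma dotcvE x : dotcv x x = \sum_i `|x i 0| ^+ 2.
Proof. by apply: eq_bigr => i _; rewrite normCK. Qed.

Lemma ler_coord_dotcv x i : `|x i 0| ^+ 2 <= dotcv x x.
Proof.
by rewrite dotcvE (bigD1 i) //= lerDl sumr_ge0 // => j _; rewrite exprn_ge0.
Qed.

Fact dotcv_pos x : x != 0 -> 0 < dotcv x x.
Proof.
move=> x0; have : exists i, x i 0 != 0.
  apply/existsP; rewrite -negb_forall; apply: contra x0 => /forallP h.
  apply/eqP/matrixP => i j; rewrite ord1 mxE; exact/eqP.
by move=> [i xi]; apply: lt_le_trans (ler_coord_dotcv x i); rewrite exprn_gt0 // normr_gt0.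
Qed.
HB.instance Definition _ := isDotProduct.Build C V dotcv dotcv_pos.

End column_dot.

Lemma dot_triangle (C : numClosedFieldType) (U : lmodType C) (form : {dot U for Num.conj}) (x y : U) :
  sqrtC (form (x + y) (x + y)) <= sqrtC (form x x) + sqrtC (form y y).
Proof.
have p0 z : 0 <= form z z by exact: dnorm_ge0.
have s0 z : 0 <= sqrtC (form z z) by rewrite sqrtC_ge0.
rewrite -ler_sqr ?nnegrE ?addr_ge0 // sqrtCK sqrrD !sqrtCK dnormD /=.
rewrite [leRHS]addrAC lerD2l.
have CS : `|form x y| <= sqrtC (form x x) * sqrtC (form y y).
  rewrite -ler_sqr ?nnegrE ?mulr_ge0 // exprMn !sqrtCK.
  have [->|y0] := eqVneq y 0; first by rewrite [form x 0]linear0r normr0 expr0n mulr_ge0.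
  have yp : 0 < form y y by exact: neq0_dnorm_gt0.
  have : 0 <= form (form y y *: x - form x y *: y) (form y y *: x - form x y *: y) by [].
  have fE a b : form (a *: x) (b *: y) = a * b^* * form x y.
    by rewrite linearZl_LR linearZr_LR /= mulrA.
  rewrite dnormB !dnormZ fE (ger0_norm (p0 y)) !rmorphM /= conjCK (geC0_conj (p0 y)).
  rewrite [X in _ - X](_ : _ = `|form x y| ^+ 2 * form y y *+ 2); last first.
    by rewrite normCK mulr2n; ring.
  have -> : form y y ^+ 2 * form x x + `|form x y| ^+ 2 * form y y - `|form x y| ^+ 2 * form y y *+ 2 =
    form y y * (form x x * form y y - `|form x y| ^+ 2) by ring.
  by rewrite pmulr_rge0 // subr_ge0.
have dreal : form x y + (form x y)^* \is Num.real.
  by rewrite CrealE rmorphD /= conjCK addrC.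
rewrite (le_trans (real_ler_norm dreal)) // (le_trans (ler_normD _ _)) //.
by rewrite norm_conjC mulr2n lerD.
Qed.

Section complete_complex.
Variable R : realType.
Local Notation C := (Cplx R).

Lemma cauchy_ex_ball (K : numFieldType) (V : pseudoMetricType K) (F : set_system V) :
  ProperFilter F -> cauchy F -> forall e : K, 0 < e -> exists x, F (ball x e).
Proof. by move=> FF /cauchyP. Qed.

Lemma Cplx_complete (F : set_system C) : ProperFilter F -> cauchy F -> cvg F.
Proof.
move=> FF cF.
have coord (g : C -> R) : (forall x y : C, Cr `|g x - g y| <= `|x - y|) -> exists l : R, g @ F --> l.
  move=> gl; apply/cvg_ex; apply: R_complete; apply: cauchy_exP => e e0.
  have [|x Fx] := cauchy_ex_ball FF cF (e := Cr e); first by rewrite Cr_gt0.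
  exists (g x); apply: (@filterS _ F _ (ball x (Cr e)) (g @^-1` ball (g x) e) _ Fx) => z; rewrite -!ball_normE /= => h.
  by rewrite -ltr_Cr (le_lt_trans (gl _ _)).
have reB (x y : C) : re (x - y) = re x - re y by case: x => ? ?; case: y => ? ?.
have imB (x y : C) : im (x - y) = im x - im y by case: x => ? ?; case: y => ? ?.
have [|a ha] := coord (@re R).
  by move=> x y; rewrite -reB; exact: ler_norm_re.
have [|b hb] := coord (@im R).
  move=> x y; rewrite -imB.
  have -> : `|x - y| = `|- 'i * (x - y)| by rewrite normrM normrN normCi mul1r.
  have -> : im (x - y) = re (- 'i * (x - y)).
    by rewrite -complexiE; case: (x - y) => c d /=; rewrite /re /= ; ring.
  exact: ler_norm_re.
apply/cvg_ex; exists (Cr a + 'i * Cr b); apply/cvgrPdist_lt => e e0.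
have e2 : 0 < re e / 2 by rewrite divr_gt0 // re_gt0.
move/cvgrPdist_lt : ha => /(_ _ e2) ha; move/cvgrPdist_lt : hb => /(_ _ e2) hb.
apply: filterS2 ha hb => z /= hza hzb.
have -> : Cr a + 'i * Cr b - z = Cr (a - re z) + 'i * Cr (b - im z).
  by rewrite {1}(re_imE z) !CrB mulrBr opprD addrACA.
rewrite (le_lt_trans (ler_normD _ _)) // normrM normCi mul1r !norm_Cr -CrD.
rewrite -[ltRHS]Cr_re_ge0 ?(ltW e0) // ltr_Cr (splitr (re e)) ltrD //.
Qed.

HB.instance Definition _ := Uniform_isComplete.Build C Cplx_complete.

End complete_complex.

Section euclidean.
Variable R : realType.
Local Notation C := (Cplx R).

(** C^4 under a name of its own, so that it carries the Euclidean norm in place of the entrywise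
    maximum norm of matrices. *)
Definition euclid : Type := 'cV[C]_4.
HB.instance Definition _ := GRing.Lmodule.copy euclid 'cV[C]_4.

Definition euclid_norm (x : euclid) : C := sqrtC (dotcv x x).

Fact euclid_normD x y : euclid_norm (x + y) <= euclid_norm x + euclid_norm y.
Proof. exact: (dot_triangle (@dotcv C 4)). Qed.
Fact euclid_normZ (l : C) x : euclid_norm (l *: x) = `|l| * euclid_norm x.
Proof.
rewrite /euclid_norm (dnormZ (@dotcv C 4)) sqrtCM ?nnegrE ?exprn_ge0 ?dnorm_ge0 //.
by rewrite sqrCK.
Qed.
Fact euclid_norm_eq0 x : euclid_norm x = 0 -> x = 0.
Proof. by move=> /eqP; rewrite (sqrt_dnorm_eq0 (@dotcv C 4)) => /eqP. Qed.

HB.instance Definition _ := Lmodule_isNormed.Build C euclid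
  euclid_normD euclid_normZ euclid_norm_eq0.

Lemma ler_coord_euclid (x : euclid) i : `|x i 0| <= `|x|.
Proof.
rewrite -ler_sqr ?nnegrE // /Num.norm /= sqrtCK; exact: ler_coord_dotcv.
Qed.

Lemma euclid_complete (F : set_system euclid) : ProperFilter F -> cauchy F -> cvg F.
Proof.
move=> FF cF.
have coord i : exists l : C, (fun x : euclid => x i 0) @ F --> l.
  apply/cvg_ex; apply: Cplx_complete; apply: cauchy_exP => e e0.
  have [x Fx] := cauchy_ex_ball FF cF e0.
  exists (x i 0); apply: (@filterS _ F _ (ball x e) ((fun y : euclid => y i 0) @^-1` ball (x i 0) e) _ Fx) => z; rewrite -!ball_normE /= => h.
  apply: le_lt_trans h; have := ler_coord_euclid (x - z) i.
  by rewrite !mxE.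
have /choice [l hl] := coord.
apply/cvg_ex; exists (\col_i l i : euclid); apply/cvgrPdist_lt => e e0.
have e2 : 0 < e / 4 by rewrite divr_gt0.
have hall : \forall x \near F, forall i, `|l i - (x : euclid) i 0| < e / 4.
  by apply: filter_forall => i; have /cvgrPdist_lt := hl i; apply.
apply: filterS hall => x hx.
have e0' : 0 <= e by exact: ltW.
rewrite -ltr_sqr ?nnegrE // /Num.norm /= sqrtCK dotcvE.
apply: (@le_lt_trans _ _ (\sum_(i < 4) (e / 4) ^+ 2)).
  apply: ler_sum => i _; rewrite ler_sqr ?nnegrE ?(ltW e2) // !mxE; exact: ltW.
rewrite sumr_const card_ord (_ : (e / 4) ^+ 2 *+ 4 = e ^+ 2 / 4); last first.
  by rewrite -mulr_natl; field.
by rewrite ltr_pdivrMr // ltr_pMr ?exprn_gt0 // ltr1n.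
Qed.

HB.instance Definition _ := Uniform_isComplete.Build euclid euclid_complete.

Definition euclid_dot : {dot euclid for Num.conj} := @dotcv C 4.

Fact euclid_sqr_norm (x : euclid) : `|x| ^+ 2 = euclid_dot x x.
Proof. by rewrite {1}/Num.norm /= sqrtCK. Qed.

HB.instance Definition _ := isHilbert.Build C euclid euclid_sqr_norm.

End euclidean.

(** * Norm bounds through ampliations *)

Section ampliation.
Variables (C : numClosedFieldType) (H : hilbertType C).

Lemma dot_suml (J : Type) (s : seq J) (F : J -> H) y :
  dot (\sum_(j <- s) F j) y = \sum_(j <- s) dot (F j) y.
Proof. by elim/big_rec2: _ => [|j a b _ <-]; rewrite ?linear0l ?dotDl. Qed.
Lemma dot_sumr (J : Type) (s : seq J) (F : J -> H) y :
  dot y (\sum_(j <- s) F j) = \sum_(j <- s) dot y (F j).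
Proof. by elim/big_rec2: _ => [|j a b _ <-]; rewrite ?linear0r ?dotDr. Qed.

(* The Gram matrix of [z] is diagonalised by a unitary change of coordinates, so
   that [z] may be assumed orthogonal. *)
Lemma ampliation_norm n (M : 'M[C]_n) (b : C) (z : 'I_n -> H) :
  (forall v : 'cV[C]_n, dotcv (M *m v) (M *m v) <= b * dotcv v v) ->
  \sum_k `|\sum_l M k l *: z l| ^+ 2 <= b * \sum_l `|z l| ^+ 2.
Proof.
move=> hM.
pose Z : 'M[C]_n := \matrix_(i, j) dot (z i) (z j).
have Zherm : Z ^t* = Z by apply/matrixP => i j; rewrite !mxE -dotC.
have Znorm : Z \is normalmx by apply/normalmxP; rewrite Zherm.
have /orthomx_spectralP ZE := Znorm.
set P := spectralmx Z in ZE; set sp := spectral_diag Z in ZE.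
have Pu : P \is unitarymx := spectral_unitarymx Z.
have PP : P *m P ^t* = 1%:M by apply/unitarymxP.
have PP' : P ^t* *m P = 1%:M by apply: mulmx1C.
have PZP : P *m Z *m P ^t* = diag_mx sp.
  by rewrite ZE invmx_unitary // !mulmxA PP mul1mx -mulmxA PP mulmx1.
pose y c := \sum_l P c l *: z l.
have ydot c d : dot (y c) (y d) = (diag_mx sp) c d.
  rewrite -PZP /y dot_suml [RHS]mxE.
  under [RHS]eq_bigr do rewrite mxE mulr_suml.
  rewrite exchange_big; apply: eq_bigr => i _ /=.
  rewrite dotZl dot_sumr mulr_sumr; apply: eq_bigr => j _.
  by rewrite dotZr !mxE mulrA mulrAC.
have zE l : z l = \sum_c (P ^t*) l c *: y c.
  rewrite /y; under eq_bigr do rewrite scaler_sumr.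
  rewrite exchange_big /=.
  transitivity (\sum_j (P ^t* *m P) l j *: z j).
    rewrite PP' (bigD1 l) //= mxE eqxx scale1r big1 ?addr0 // => j jl.
    by rewrite mxE eq_sym (negPf jl) scale0r.
  by apply: eq_bigr => j _; rewrite mxE scaler_suml; apply: eq_bigr => i _; rewrite scalerA.
have key (N : 'M[C]_n) : \sum_k `|\sum_l N k l *: z l| ^+ 2 =
    \sum_c `|y c| ^+ 2 * dotcv (N *m col c (P ^t*)) (N *m col c (P ^t*)).
  have NE k : \sum_l N k l *: z l = \sum_c (N *m P ^t*) k c *: y c.
    transitivity (\sum_l \sum_c (N k l * (P ^t*) l c) *: y c).
      by apply: eq_bigr => l _; rewrite zE scaler_sumr; apply: eq_bigr => i _; rewrite scalerA.
    by rewrite exchange_big; apply: eq_bigr => i _; rewrite [in RHS]mxE scaler_suml.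
  under eq_bigr do rewrite NE.
  transitivity (\sum_k \sum_c `|(N *m P ^t*) k c| ^+ 2 * `|y c| ^+ 2).
    apply: eq_bigr => k _; rewrite sqr_normE dot_suml; apply: eq_bigr => i _.
    rewrite dotZl dot_sumr (bigD1 i) //= big1 ?addr0.
      by rewrite dotZr mulrA -normCK sqr_normE.
    by move=> j ji; rewrite dotZr ydot [diag_mx _ _ _]mxE eq_sym (negPf ji) mulr0n mulr0.
  rewrite exchange_big; apply: eq_bigr => i _ /=.
  rewrite dotcvE mulr_sumr; apply: eq_bigr => k _; rewrite mulrC.
  by rewrite !mxE; congr (_ * `|_| ^+ 2); apply: eq_bigr => j _; rewrite !mxE.
have -> : \sum_l `|z l| ^+ 2 = \sum_k `|\sum_l (1%:M : 'M[C]_n) k l *: z l| ^+ 2.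
  apply: eq_bigr => k _; congr (`|_| ^+ 2).
  rewrite (bigD1 k) //= mxE eqxx scale1r big1 ?addr0 // => j jk.
  by rewrite mxE eq_sym (negPf jk) scale0r.
rewrite !key mulr_sumr; apply: ler_sum => i _.
by rewrite mul1mx mulrCA ler_wpM2l // exprn_ge0.
Qed.

End ampliation.

Section matrix_evaluation.
Variable C : numClosedFieldType.
Variables (I : Type) (a : I -> 'M[C]_4).

Definition mx_word (w : seq (I * bool)) : 'M[C]_4 :=
  foldr (fun l y => (if l.2 then (a l.1) ^t* else a l.1) *m y) 1%:M w.
Definition mx_eval (q : starpoly C I) : 'M[C]_4 := \sum_(m <- q) m.1 *: mx_word m.2.

(** Through J a polynomial in the operators becomes the matrix [mx_eval q] acting on the tuple (J_k
    x). An ampliation does not increase the norm, and J is isometric. *)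
Lemma op_eval_bound (H : hilbertType C) (T : op_family I H) (J : 'I_4 -> H -> H) (c : C) q :
  (forall k, linear (J k)) -> (forall x, \sum_k `|J k x| ^+ 2 = `|x| ^+ 2) ->
  (forall i x k, J k (op T i x) = \sum_l a i k l *: J l x /\
                 J k (adj T i x) = \sum_l (a i) ^t* k l *: J l x) ->
  0 <= c -> (forall v : 'cV[C]_4, dotcv (mx_eval q *m v) (mx_eval q *m v) <= c ^+ 2 * dotcv v v) ->
  forall x, `|op_eval T q x| <= c * `|x|.
Proof.
move=> lJ nJ itJ c0 hc x.
have wordE w y k : J k (foldr (fun l y => if l.2 then adj T l.1 y else op T l.1 y) y w) =
    \sum_l mx_word w k l *: J l y.
  elim: w k => [|l w IH] k /=.
    rewrite (bigD1 k) //= mxE eqxx scale1r big1 ?addr0 // => j jk.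
    by rewrite mxE eq_sym (negPf jk) scale0r.
  have hstep (M : 'M[C]_4) : \sum_j M k j *: \sum_i mx_word w j i *: J i y =
      \sum_i (M *m mx_word w) k i *: J i y.
    under eq_bigr do rewrite scaler_sumr.
    rewrite exchange_big; apply: eq_bigr => i _ /=.
    by rewrite mxE scaler_suml; apply: eq_bigr => j _; rewrite scalerA.
  case: l => i [] /=; [rewrite (itJ i _ k).2|rewrite (itJ i _ k).1];
  by rewrite -hstep; apply: eq_bigr => j _; rewrite IH.
have evalE k : J k (op_eval T q x) = \sum_l mx_eval q k l *: J l x.
  rewrite /op_eval /mx_eval (linear_sumE _ _ (lJ k)).
  under [RHS]eq_bigr do rewrite summxE scaler_suml.
  rewrite exchange_big; apply: eq_bigr => m _ /=.
  rewrite (linear_scaleE _ _ (lJ k)) wordE scaler_sumr.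
  by apply: eq_bigr => l _; rewrite mxE scalerA.
rewrite -ler_sqr ?nnegrE ?mulr_ge0 // exprMn -(nJ (op_eval T q x)) -(nJ x).
under eq_bigr do rewrite evalE.
exact: ampliation_norm.
Qed.
End matrix_evaluation.

(** * The algebra generated by the model at a point *)

Section generator_combinations.
Variable C : numClosedFieldType.
Variables (A B t u c d r : C).
Hypotheses (hA : A^* = A) (hu : u * u^* = 1).
Let a0 := gen0 A B t (odd_part c d).
Let a1 := gen1 A B t u (odd_part c d).

Lemma gen1_adj : a1 ^t* =
  (kap C * u^*) *: ((B - t * A) *: mxE1s C + (A + t * B^*) *: mxE1 C - odd_part c d).
Proof.
rewrite /a1 /gen1 adjmxZ adjmxD adjmxN trmxCK adjmxD !adjmxZ mxE1_adj mxE1s_adj.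
by rewrite rmorphB !rmorphD !rmorphM /= !conjCK hA kap_conj.
Qed.

Lemma gen_sum : kap C *: (a0 + u *: a1 ^t*) = A *: mxE1 C + B *: mxE1s C.
Proof.
rewrite gen1_adj /a0 /gen0 /odd_part.
move: (mxE1 C) (mxE1s C) (mxF1 C) (mxF1s C) => E Es F Fs; apply/matrixP => i j; rewrite !mxE.
move: (E i j) (Es i j) (F i j) (Fs i j) => x y z v.
transitivity (kap C * kap C * ((A - t * B^*) * x + (B + t * A) * y + (c * z + d * v)
  + u * u^* * ((B - t * A) * y + (A + t * B^*) * x - (c * z + d * v)))); first by ring.
by rewrite kap_sqr hu; field.
Qed.

Lemma gen_diff : kap C *: (a0 - u *: a1 ^t*) =
  (- (t * B^*)) *: mxE1 C + (t * A) *: mxE1s C + odd_part c d.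
Proof.
rewrite gen1_adj /a0 /gen0 /odd_part.
move: (mxE1 C) (mxE1s C) (mxF1 C) (mxF1s C) => E Es F Fs; apply/matrixP => i j; rewrite !mxE.
move: (E i j) (Es i j) (F i j) (Fs i j) => x y z v.
transitivity (kap C * kap C * ((A - t * B^*) * x + (B + t * A) * y + (c * z + d * v)
  - u * u^* * ((B - t * A) * y + (A + t * B^*) * x - (c * z + d * v)))); first by ring.
by rewrite kap_sqr hu; field.
Qed.

End generator_combinations.

Section subalgebras.
Variable C : numClosedFieldType.
Local Notation dl i j := (delta_mx i j : 'M[C]_2).

Definition mx_closed (S : set 'M[C]_4) :=
  (forall c X Y, S X -> S Y -> S (c *: X + Y)) /\ (forall X Y, S X -> S Y -> S (X *m Y)).

Lemma mx2_sum (A : 'M[C]_2) : A = A 0 0 *: dl 0 0 + A 0 1 *: dl 0 1 + A 1 0 *: dl 1 0 + A 1 1 *: dl 1 1.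
Proof.
apply/matrixP => i j; have [->|->] := ord2P i; have [->|->] := ord2P j; rewrite !mxE /=; ring.
Qed.

Lemma mx_closed_tens1 S : mx_closed S -> S (mxE1 C) -> S (mxE1s C) -> forall A, S (tens2 A 1%:M).
Proof.
move=> [lS mS] SE SEs A.
have S0 : S 0 by rewrite -(addNr (mxE1 C)) -scaleN1r; exact: lS.
have SZ c X : S X -> S (c *: X) by move=> SX; rewrite -[c *: X]addr0; exact: lS.
have SD X Y : S X -> S Y -> S (X + Y) by move=> SX SY; rewrite -[X]scale1r; exact: lS.
have S00 : S (tens2 (dl 0 0) 1%:M).
  by have := mS _ _ SEs SE; rewrite /mxE1 /mxE1s tens2M mul_delta2 /= scale1r mulmx1.
have S11 : S (tens2 (dl 1 1) 1%:M).
  by have := mS _ _ SE SEs; rewrite /mxE1 /mxE1s tens2M mul_delta2 /= scale1r mulmx1.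
by rewrite [A]mx2_sum !tens2Dl !tens2Zl; apply: (SD _ _ (SD _ _ (SD _ _ _ _) _) _); apply: SZ.
Qed.

Definition mx_block (X : 'M[C]_4) (i j : 'I_2) : 'M[C]_2 :=
  \matrix_(k, l) X (@mxtens_index 2 2 (i, k)) (@mxtens_index 2 2 (j, l)).

Lemma tens2_blocks (X : 'M[C]_4) : X = tens2 (dl 0 0) (mx_block X 0 0) +
  tens2 (dl 0 1) (mx_block X 0 1) + tens2 (dl 1 0) (mx_block X 1 0) + tens2 (dl 1 1) (mx_block X 1 1).
Proof.
apply/matrixP => i j; case: (@mxtens_indexP 2 2 i) => i0 i1; case: (@mxtens_indexP 2 2 j) => j0 j1.
rewrite ![in RHS]mxE !mxtens_indexK /=.
have [->|->] := ord2P i0; have [->|->] := ord2P j0; rewrite /=; ring.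
Qed.

(** Once M_2 (x) 1 lies in S, membership is decided block by block, since E_ij (x) X_ij = (E_ij (x)
    1)(1 (x) X_ij). *)
Lemma mx_closed_blocks S (K : set 'M[C]_2) : mx_closed S -> S (mxE1 C) -> S (mxE1s C) ->
  (forall B, K B -> S (tens2 1%:M B)) ->
  forall X, (forall i j, K (mx_block X i j)) -> S X.
Proof.
move=> hS SE SEs KS X KX; have h1 := mx_closed_tens1 hS SE SEs; have [lS mS] := hS.
have SD X' Y : S X' -> S Y -> S (X' + Y) by move=> SX SY; rewrite -[X']scale1r; exact: lS.
have hT A i j : S (tens2 A (mx_block X i j)).
  by rewrite -[A]mulmx1 -[mx_block X i j]mul1mx -tens2M; apply: mS => //; exact: KS.
by rewrite [X]tens2_blocks; apply: (SD _ _ (SD _ _ (SD _ _ _ _) _) _); exact: hT.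
Qed.

(** Multiplying by grading (x) 1 strips the grading from F and its adjoint, which yields 1 (x) M_2
    next to M_2 (x) 1. *)
Lemma mx_closed_full S : mx_closed S -> S (mxE1 C) -> S (mxE1s C) -> S (mxF1 C) -> S (mxF1s C) ->
  forall X, S X.
Proof.
move=> hS SE SEs SF SFs X; have h1 := mx_closed_tens1 hS SE SEs; have [lS mS] := hS.
apply: (@mx_closed_blocks S setT) => // B _.
have S0 : S 0 by rewrite -(addNr (mxE1 C)) -scaleN1r; exact: lS.
have SZ c Y : S Y -> S (c *: Y) by move=> SX; rewrite -[c *: Y]addr0; exact: lS.
have SD Y Z : S Y -> S Z -> S (Y + Z) by move=> SX SY; rewrite -[Y]scale1r; exact: lS.
have S10 : S (tens2 1%:M (dl 1 0)).
  by have := mS _ _ (h1 (grading C)) SF; rewrite /mxF1 tens2M grading_sqr mul1mx.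
have S01 : S (tens2 1%:M (dl 0 1)).
  by have := mS _ _ (h1 (grading C)) SFs; rewrite /mxF1s tens2M grading_sqr mul1mx.
have S00 : S (tens2 1%:M (dl 0 0)).
  by have := mS _ _ S01 S10; rewrite tens2M mul_delta2 /= scale1r mulmx1.
have S11 : S (tens2 1%:M (dl 1 1)).
  by have := mS _ _ S10 S01; rewrite tens2M mul_delta2 /= scale1r mulmx1.
by rewrite [B]mx2_sum !tens2Dr !tens2Zr; apply: (SD _ _ (SD _ _ (SD _ _ _ _) _) _); apply: SZ.
Qed.

End subalgebras.

Section point_relations.
Variables (R : realType) (eps : R) (p : point6 R).
Local Notation C := (Cplx R).
Hypotheses (eps0 : 0 < eps) (hp : DT3 eps p).

Let A : C := Cr (pA p).
Let B := pB p.
Let t := pt p.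
Let u := pu p.
Let c : C := Cr (Num.sqrt (pdel p) * pa p).
Let d : C := Cr (Num.sqrt (pdel p) * pb p) * pu2 p.

Let hA : A^* = A. Proof. exact: conj_Cr. Qed.
Let hr : (Cr (pr p))^* = Cr (pr p) :> C. Proof. exact: conj_Cr. Qed.
Let hAB : A ^+ 2 + B * B^* = 1 + Cr (pr p).
Proof. exact: coefAB_add (pr_gt0 eps0 hp) (pw_small eps0 hp). Qed.
Let hABD : A ^+ 2 - B * B^* = Cr (pD p).
Proof. exact: coefAB_sub (pr_gt0 eps0 hp) (pw_small eps0 hp). Qed.
Let ht : t * t^* = Cr (ptau p). Proof. exact: pt_norm eps0 hp. Qed.
Let hu : u * u^* = 1.
Proof. by apply: norm1_mulC; have [] := DT3_norms hp. Qed.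
Let hu2 : pu2 p * (pu2 p)^* = 1.
Proof. by apply: norm1_mulC; have [] := DT3_norms hp. Qed.
Let hx2 : 0 <= px2 p <= 1 / 2. Proof. by have [] := DT3_bounds hp. Qed.
Let hcd : c * c^* + d * d^* = Cr (pdel p).
Proof.
rewrite /c /d [(Cr _ * pu2 p)^*]rmorphM /= !conj_Cr mulrACA hu2 mulr1 -!CrM -CrD; congr Cr.
rewrite mulrACA [X in _ + X]mulrACA -!expr2 -mulrDr cacb_sqr // mulr1 sqr_sqrtr //.
exact: pdel_ge0 hp.
Qed.
Let hdel : Cr (pdel p) = 1 - Cr (pr p) - Cr (ptau p) * (1 + Cr (pr p)) :> C.
Proof. by rewrite (pdelE eps0 hp) !CrB CrM CrD Cr1. Qed.
Let hw : A * B = pw p.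
Proof. exact: coefAB (pr_gt0 eps0 hp) (pw_small eps0 hp). Qed.
Let hw' : pw p + t ^+ 2 * (pw p)^* = pw' p. Proof. exact: pw_eq eps0 hp. Qed.
Let hcd' : c * d = pw' p.
Proof.
rewrite /c /d mulrA -CrM /pw'; congr (Cr _ * _).
rewrite mulrACA -expr2 sqr_sqrtr ?(pdel_ge0 hp) //.
by rewrite -/(pa p) -/(pb p) cacb_mul.
Qed.

Lemma ev_car i : (ev p i) ^t* *m ev p i + ev p i *m (ev p i) ^t* = 1%:M.
Proof.
have [->|->] := ord2P i; rewrite /ev /=.
  exact: gen0_car hA hAB ht hcd hdel.
exact: gen1_car hA hAB ht hu hcd hdel.
Qed.

Lemma ev_anti : (ev p 0) ^t* *m ev p 1 = - (ev p 1 *m (ev p 0) ^t*).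
Proof. exact: gen01_anti hA hw hw' hcd'. Qed.

Lemma ev_scalar : ev p 1 *m ev p 0 + ev p 0 *m ev p 1 = (Cr (pr p) * pu p)%:M.
Proof. exact: gen01_scalar hAB ht hcd hdel. Qed.

Lemma ev0_sqr : ev p 0 *m ev p 0 + ev p 0 *m ev p 0 = (2 * pw p + pt p * Cr (pD p))%:M.
Proof. by rewrite -hABD; exact: gen0_sqr hA hw hw' hcd'. Qed.

Lemma ev1_sqr : ev p 1 *m ev p 1 + ev p 1 *m ev p 1 =
  (pu p ^+ 2 * (2 * pw p - pt p * Cr (pD p))^*)%:M.
Proof. by rewrite -hABD; exact: gen1_sqr hA hw hw' hcd'. Qed.

End point_relations.

Section generated_fiber.
Variables (R : realType) (eps : R) (p : point6 R).
Local Notation C := (Cplx R).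
Hypotheses (eps0 : 0 < eps) (hp : DT3 eps p).
Variable S : set 'M[C]_4.
Hypotheses (hS : mx_closed S) (Sev : forall i, S (ev p i) /\ S ((ev p i) ^t*)).
Local Notation dl i j := (delta_mx i j : 'M[C]_2).

Let hu : pu p * (pu p)^* = 1. Proof. by apply: norm1_mulC; have [] := DT3_norms hp. Qed.
Let hu2 : pu2 p * (pu2 p)^* = 1. Proof. by apply: norm1_mulC; have [] := DT3_norms hp. Qed.
Let S0 : S 0.
Proof. by rewrite -(addNr (ev p 0)) -scaleN1r; apply: hS.1; have [] := Sev 0. Qed.
Let SZ c X : S X -> S (c *: X).
Proof. by move=> SX; rewrite -[c *: X]addr0; apply: hS.1. Qed.
Let SD X Y : S X -> S Y -> S (X + Y).
Proof. by move=> SX SY; rewrite -[X]scale1r; apply: hS.1. Qed.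
Let SN X : S X -> S (- X).
Proof. by move=> SX; rewrite -scaleN1r; apply: SZ. Qed.

Let D0 : Cr (pD p) != 0 :> C.
Proof. by rewrite fmorph_eq0 gt_eqF //; apply: disc_gt0; exact: pw_small eps0 hp. Qed.

(** The combination b_1 = A E + B E^* of the generators and its adjoint form a linear system for E
    and its adjoint, whose determinant A^2 - |B|^2 is the nonzero discriminant. *)
Lemma closed_E : S (mxE1 C) /\ S (mxE1s C).
Proof.
have A_c : (Cr (pA p))^* = Cr (pA p) :> C by exact: conj_Cr.
have hD : Cr (pA p) ^+ 2 - pB p * (pB p)^* = Cr (pD p).
  exact: coefAB_sub (pr_gt0 eps0 hp) (pw_small eps0 hp).
have [S0e S0s] := Sev 0; have [S1e S1s] := Sev 1.
have Sb : S (Cr (pA p) *: mxE1 C + pB p *: mxE1s C).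
  rewrite -(@gen_sum C (Cr (pA p)) (pB p) (pt p) (pu p) (Cr (Num.sqrt (pdel p) * pa p)) (Cr (Num.sqrt (pdel p) * pb p) * pu2 p) A_c hu).
  by apply: SZ; apply: SD => //; apply: SZ.
have Sbs : S (Cr (pA p) *: mxE1s C + (pB p)^* *: mxE1 C).
  have -> : Cr (pA p) *: mxE1s C + (pB p)^* *: mxE1 C = kap C *: ((ev p 0) ^t* + (pu p)^* *: ev p 1).
    have h : kap C *: (ev p 0 + pu p *: (ev p 1) ^t*) = Cr (pA p) *: mxE1 C + pB p *: mxE1s C.
      exact: (@gen_sum C (Cr (pA p)) (pB p) (pt p) (pu p) (Cr (Num.sqrt (pdel p) * pa p)) (Cr (Num.sqrt (pdel p) * pb p) * pu2 p) A_c hu).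
    move: h; move: (ev p 0) (ev p 1) => X0 X1 /(congr1 (fun X : 'M[C]_4 => X ^t*)).
    by rewrite !adjmxZ !adjmxD !adjmxZ trmxCK kap_conj conj_Cr mxE1_adj mxE1s_adj => <-.
  by apply: SZ; apply: SD => //; apply: SZ.
split.
  have -> : mxE1 C = (Cr (pA p) / Cr (pD p)) *: (Cr (pA p) *: mxE1 C + pB p *: mxE1s C)
     - (pB p / Cr (pD p)) *: (Cr (pA p) *: mxE1s C + (pB p)^* *: mxE1 C).
    apply/matrixP => i j; move: (mxE1 C) (mxE1s C) => E Es; rewrite !mxE -hD; field.
    by rewrite hD.
  by apply: SD; [|apply: SN]; apply: SZ.
have -> : mxE1s C = (Cr (pA p) / Cr (pD p)) *: (Cr (pA p) *: mxE1s C + (pB p)^* *: mxE1 C)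
     - ((pB p)^* / Cr (pD p)) *: (Cr (pA p) *: mxE1 C + pB p *: mxE1s C).
  apply/matrixP => i j; move: (mxE1 C) (mxE1s C) => E Es; rewrite !mxE -hD; field.
  by rewrite hD.
by apply: SD; [|apply: SN]; apply: SZ.
Qed.

Lemma closed_odd : S (podd p) /\ S ((podd p) ^t*).
Proof.
have [SE SEs] := closed_E.
have A_c : (Cr (pA p))^* = Cr (pA p) :> C by exact: conj_Cr.
have [S0e S0s] := Sev 0; have [S1e S1s] := Sev 1.
have h := @gen_diff C (Cr (pA p)) (pB p) (pt p) (pu p) (Cr (Num.sqrt (pdel p) * pa p)) (Cr (Num.sqrt (pdel p) * pb p) * pu2 p) A_c hu.
rewrite -/(podd p) in h.
have hE : podd p = kap C *: (ev p 0 - pu p *: (ev p 1) ^t*) -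
   ((- (pt p * (pB p)^*)) *: mxE1 C + (pt p * Cr (pA p)) *: mxE1s C).
  by rewrite h addrC addKr.
split.
  rewrite hE; apply: SD; [|apply: SN].
    by apply: SZ; apply: SD => //; apply: SN; apply: SZ.
  by apply: SD; apply: SZ.
have adjE (X0 X1 E Es : 'M[C]_4) (k v al be : C) : E ^t* = Es -> Es ^t* = E ->
    (k *: (X0 - v *: X1 ^t*) - (al *: E + be *: Es)) ^t* =
    k^* *: (X0 ^t* - v^* *: X1) - (al^* *: Es + be^* *: E).
  move=> EE EsE; rewrite [LHS]adjmxD adjmxN adjmxZ [(X0 - _) ^t*]adjmxD [(- (v *: _)) ^t*]adjmxN.
  by rewrite [(v *: _) ^t*]adjmxZ trmxCK [(al *: E + _) ^t*]adjmxD !adjmxZ EE EsE.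
rewrite hE (adjE _ _ _ _ _ _ _ _ (mxE1_adj C) (mxE1s_adj C)).
apply: SD; [|apply: SN].
  by apply: SZ; apply: SD => //; apply: SN; apply: SZ.
by apply: SD; apply: SZ.
Qed.

(** The odd part c F + d F^* and its adjoint can be solved for F: the determinant c^2 - |d|^2 equals
    del (a^2 - b^2), positive exactly away from the degenerate faces. *)
Lemma closed_full : 0 < pdel p -> px2 p < 1 / 2 -> forall X, S X.
Proof.
move=> d0 x2; have [SE SEs] := closed_E; have [So Sos] := closed_odd.
pose c : C := Cr (Num.sqrt (pdel p) * pa p); pose d : C := Cr (Num.sqrt (pdel p) * pb p) * pu2 p.
have cc : c^* = c by exact: conj_Cr.
have hx2 : 0 <= px2 p <= 1 / 2 by have [] := DT3_bounds hp.
have N0 : c * c - d * d^* != 0.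
  rewrite /c /d [(Cr _ * pu2 p)^*]rmorphM /= !conj_Cr mulrACA hu2 mulr1 -!CrM -CrB fmorph_eq0.
  rewrite mulrACA [X in _ - X]mulrACA -!expr2 -mulrBr sqr_sqrtr ?(ltW d0) //.
  by rewrite gt_eqF // mulr_gt0 // cacb_lt.
move: So Sos; rewrite /podd odd_part_adj -/c -/d cc => So Sos.
clearbody c d.
have SF : S (mxF1 C).
  have -> : mxF1 C = (c * c - d * d^*)^-1 *: (c *: odd_part c d - d *: odd_part d^* c).
    rewrite /odd_part; apply/matrixP => i j; move: (mxF1 C) (mxF1s C) => F Fs; rewrite !mxE.
    by move: (F i j) (Fs i j) => x y; field.
  by apply: SZ; apply: SD; [|apply: SN]; apply: SZ.
have SFs : S (mxF1s C).
  have -> : mxF1s C = (c * c - d * d^*)^-1 *: (c *: odd_part d^* c - d^* *: odd_part c d).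
    rewrite /odd_part; apply/matrixP => i j; move: (mxF1 C) (mxF1s C) => F Fs; rewrite !mxE.
    by move: (F i j) (Fs i j) => x y; field.
  by apply: SZ; apply: SD; [|apply: SN]; apply: SZ.
exact: mx_closed_full.
Qed.

(** At x_2 = 1/2 the two coefficients agree and the odd part collapses to a multiple of grading (x)
    G, with G the matrix shown. *)
Lemma closed_half : 0 < pdel p -> px2 p = 1 / 2 -> S (tens2 1%:M (dl 1 0 + pu2 p *: dl 0 1)).
Proof.
move=> d0 x2; have [SE SEs] := closed_E; have [So Sos] := closed_odd.
have h1 := mx_closed_tens1 hS SE SEs.
have ab : pa p = pb p.
  by rewrite /pa /pb /ca /cb x2 (_ : 1 - 2 * (1 / 2) = 0) ?sqrtr0 ?addr0 ?subr0 //; field.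
have a0 : pa p != 0.
  rewrite /pa /ca x2 (_ : 1 - 2 * (1 / 2) = 0) ?sqrtr0 ?addr0; last by field.
  by rewrite mulf_neq0 ?invr_eq0 ?pnatr_eq0 // gt_eqF // sqrtr_gt0; lra.
pose c : C := Cr (Num.sqrt (pdel p) * pa p).
have c0 : c != 0 by rewrite fmorph_eq0 mulf_neq0 // gt_eqF // sqrtr_gt0.
have := hS.2 _ _ (h1 (grading C)) (SZ c^-1 So).
rewrite /podd -ab -/c /odd_part /mxF1 /mxF1s scalerDr !scalerA mulrA mulVf // mul1r scale1r.
by rewrite mulmxDr -scalemxAr !tens2M grading_sqr !mul1mx tens2Dr tens2Zr.
Qed.
End generated_fiber.

(** * The models as irreducible representations *)

Section matrix_operators.
Variable R : realType.
Local Notation C := (Cplx R).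
Local Notation H := (euclid R).

Definition mxop (M : 'M[C]_4) (x : H) : H := M *m x.

Fact mxop_linear M : linear (mxop M).
Proof. by move=> c x y; rewrite /mxop mulmxDr -scalemxAr. Qed.
HB.instance Definition _ M := GRing.isLinear.Build C H H *:%R (mxop M) (mxop_linear M).

Lemma mxop_bounded M : exists2 c : C, 0 <= c & forall x : H, `|mxop M x| <= c * `|x|.
Proof.
exists (\sum_j `|(col j M : H)|); first by rewrite sumr_ge0.
move=> x; have -> : mxop M x = \sum_j x j 0 *: (col j M : H).
  apply/matrixP => i k; rewrite ord1 mxE summxE; apply: eq_bigr => j _.
  by rewrite !mxE mulrC.
rewrite (le_trans (ler_norm_sum _ _ _)) // mulr_suml; apply: ler_sum => j _.
by rewrite normrZ mulrC ler_wpM2l // ler_coord_euclid.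
Qed.

Lemma mxop_continuous M : continuous (mxop M).
Proof.
have [c _ hc] := mxop_bounded M.
exact: bounded_linear_continuous (mxop_linear M) hc.
Qed.

Lemma mxop_adj M (x y : H) : dot (mxop M x) y = dot x (mxop (M ^t*) y).
Proof.
rewrite /dot /= /euclid_dot /dotcv.
under eq_bigr do rewrite mxE mulr_suml.
rewrite exchange_big; apply: eq_bigr => i _ /=.
rewrite mxE rmorph_sum mulr_sumr; apply: eq_bigr => j _.
by rewrite !mxE rmorphM /= conjCK mulrCA mulrA.
Qed.

Definition mx_family (a : 'I_2 -> 'M[C]_4) : op_family 'I_2 H :=
  OpFamily (op := fun i => mxop (a i)) (adj := fun i => mxop ((a i) ^t*))
    (fun i => @mxop_continuous (a i)) (fun i x y => mxop_adj (a i) x y).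

Lemma mx_family_eval a q (x : H) : op_eval (mx_family a) q x = mxop (mx_eval a q) x.
Proof.
rewrite /op_eval /mxop /mx_eval mulmx_suml; apply: eq_bigr => m _.
rewrite -scalemxAl; congr (_ *: _).
elim: m.2 => [|l w IH] /=; first by rewrite mul1mx.
by rewrite -mulmxA -IH; case: l => i [].
Qed.

Lemma mxop_comp M N (x : H) : mxop M (mxop N x) = mxop (M *m N) x.
Proof. by rewrite /mxop mulmxA. Qed.
Lemma mxop_add M N (x : H) : mxop M x + mxop N x = mxop (M + N) x.
Proof. by rewrite /mxop mulmxDl. Qed.

Section at_point.
Variables (eps : R) (p : point6 R).
Hypotheses (eps0 : 0 < eps) (hp : DT3 eps p) (d0 : 0 < pdel p) (hx2 : px2 p < 1 / 2).

(** The stabiliser of an invariant subspace is an algebra containing the generators and their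
    adjoints, hence all of M_4 by [closed_full], and M_4 acts transitively on nonzero vectors. *)
Lemma interior_wcar : wcar_annulus eps (mx_family (ev p)).
Proof.
have scal (c : C) (x : H) : mxop c%:M x = c *: x by rewrite /mxop mul_scalar_mx.
split.
- split=> [i x|x] /=.
    by rewrite !mxop_comp mxop_add (ev_car eps0 hp) scal scale1r.
  by rewrite !mxop_comp (ev_anti eps0 hp) /mxop mulNmx.
- split; first by exists (const_mx 1 : H); apply/eqP => /matrixP /(_ 0 0); rewrite !mxE => /eqP; rewrite oner_eq0.
  move=> W _ W0 lW invW.
  have [[x Wx x0]|nW] := pselect (exists2 x, W x & x != 0); last first.
    left; apply/seteqP; split=> [x Wx|_ ->//]; apply: contrapT => x0.
    by apply: nW; exists x => //; apply/eqP.
  right; apply/seteqP; split=> // y _.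
  pose S : set 'M[C]_4 := [set M | forall z, W z -> W (mxop M z)].
  have hS : mx_closed S.
    split=> [c X Y SX SY z Wz|X Y SX SY z Wz].
      by rewrite -mxop_add /mxop -scalemxAl; apply: lW; [exact: SX|exact: SY].
    by rewrite -mxop_comp; apply: SX; exact: SY.
  have hSe i : S (ev p i) /\ S ((ev p i) ^t*).
    by split=> z Wz; have [] := invW i z Wz.
  (* The rank-one matrix y x^* / |x|^2 sends the nonzero vector x of W to the arbitrary vector y. *)
  have := closed_full eps0 hp hS hSe d0 hx2 ((dotcv x x)^-1 *: (y *m (x ^t*))) x Wx.
  rewrite /mxop -scalemxAl -mulmxA.
  have -> : x ^t* *m x = (dotcv x x)%:M.
    apply/matrixP => i j; rewrite !ord1 !mxE mulr1n; apply: eq_bigr => k _.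
    by rewrite !mxE mulrC.
  by rewrite mul_mx_scalar scalerA mulVf ?scale1r // (dnorm_eq0 (@dotcv C 4)).
- exists (Cr (pr p) * pu p).
    have [/andP[r1 r2] _ _] := DT3_bounds hp; have [nu _ _] := DT3_norms hp.
    rewrite normrM nu mulr1 norm_Cr ger0_norm; last by rewrite ltW // (pr_gt0 eps0 hp).
    by apply/andP; split; [rewrite -/(Cr eps) ler_Cr|rewrite -(Cr1 R) ler_Cr].
  by move=> x /=; rewrite !mxop_comp mxop_add (ev_scalar eps0 hp) scal.
Qed.

Lemma interior_bound q (M : C) : 0 <= M ->
  bounded_on_class (@wcar_annulus R eps) q M ->
  forall v : 'cV[C]_4, dotcv (mx_eval (ev p) q *m v) (mx_eval (ev p) q *m v) <= M ^+ 2 * dotcv v v.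
Proof.
move=> M0 hM v; have := hM _ _ interior_wcar (v : H).
rewrite mx_family_eval -ler_sqr ?nnegrE ?mulr_ge0 // exprMn !sqr_normE.
by [].
Qed.

End at_point.
End matrix_operators.

(** * Compactness and continuity *)

Lemma compact_set_type (T : topologicalType) (A : set T) :
  compact A -> compact [set: set_type A].
Proof.
move=> cA F FF _.
pose G := fmap (@set_val T A) F.
have GA : G A.
  by apply: (@filterS _ F _ setT (set_val @^-1` A) _ filterT) => y _; exact: set_valP.
have [x [Ax clx]] := cA G _ GA.
have xA : x \in A by rewrite inE.
exists (exist _ x xA); split=> // P B FP.
rewrite nbhsE => -[B' [[U oU UB'] B'x] B'B].
have Ux : U x by rewrite -[U x]/((set_val @^-1` U) (exist _ x xA)) UB'.
have GP : G (set_val @` P).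
  by apply: (@filterS _ F _ P (set_val @^-1` (set_val @` P)) _ FP) => y Py; exists y.
have [z [[y Py <-] Uy]] := clx _ _ GP (open_nbhs_nbhs (conj oU Ux)).
exists y; split=> //; apply: B'B; rewrite -UB'; exact: Uy.
Qed.

Lemma modulus_continuous (K K' : numFieldType) (V : pseudoMetricNormedZmodType K)
    (W : pseudoMetricNormedZmodType K') (f : V -> W) :
  (forall e, 0 < e -> exists2 d, 0 < d & forall x y, `|x - y| < d -> `|f x - f y| < e) ->
  continuous f.
Proof.
move=> h x; apply/cvgrPdist_lt => e /h[d d0 hd].
have := nbhsx_ballx x d d0; rewrite -ball_normE => hx.
by apply: (@filterS _ (nbhs x) _ (ball_ Num.norm x d) _ _ hx) => y /hd.
Qed.

Section complex_continuity.
Variables (R : realType).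
Local Notation C := (Cplx R).

Lemma Cr_continuous : continuous (@Cr R : R -> C).
Proof.
apply: modulus_continuous => e e0; exists (re e); first exact: re_gt0.
by move=> x y h; rewrite -CrB norm_Cr -[ltRHS]Cr_re_ge0 ?(ltW e0) // ltr_Cr.
Qed.

Lemma reB (x y : C) : re (x - y) = re x - re y. Proof. by case: x => ? ?; case: y. Qed.
Lemma imB (x y : C) : im (x - y) = im x - im y. Proof. by case: x => ? ?; case: y. Qed.

Lemma ler_norm_im (z : C) : Cr `|im z| <= `|z|.
Proof.
have -> : `|z| = `|- 'i * z| by rewrite normrM normrN normCi mul1r.
have -> : im z = re (- 'i * z).
  by rewrite -complexiE; case: z => c d /=; rewrite /re /= ; ring.
exact: ler_norm_re.
Qed.

Lemma re_continuous : continuous (@re R).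
Proof.
apply: modulus_continuous => e e0; exists (Cr e); first by rewrite Cr_gt0.
by move=> x y h; rewrite -reB -ltr_Cr (le_lt_trans (ler_norm_re _)).
Qed.

Lemma im_continuous : continuous (@im R).
Proof.
apply: modulus_continuous => e e0; exists (Cr e); first by rewrite Cr_gt0.
by move=> x y h; rewrite -imB -ltr_Cr (le_lt_trans (ler_norm_im _)).
Qed.

Lemma conjC_continuous : continuous (Num.conj : C -> C).
Proof.
apply: modulus_continuous => e e0; exists e => // x y h.
by rewrite -rmorphB norm_conjC.
Qed.

Lemma expi_continuous : continuous (@expi R).
Proof.
have -> : @expi R = fun t => Cr (cos t) + 'i * Cr (sin t).
  by apply/funext => t; rewrite [LHS]re_imE.
move=> t; apply: cvgD.
  by apply: continuous_comp; [exact: continuous_cos|exact: Cr_continuous].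
apply: cvgM; first exact: cvg_cst.
by apply: continuous_comp; [exact: continuous_sin|exact: Cr_continuous].
Qed.

Lemma expi_norm t : `|expi t| = 1 :> C.
Proof.
apply/eqP; rewrite -sqrp_eq1 // sqr_normCE /re /im /= cos2Dsin2 Cr1.
by [].
Qed.

Lemma expi_surj (u : C) : `|u| = 1 -> exists2 t, 0 <= t <= 2 * pi & expi t = u.
Proof.
move=> u1; have : re u ^+ 2 + im u ^+ 2 = 1.
  by apply: (@Cr_inj R); rewrite -sqr_normCE u1 expr1n Cr1.
case: u u1 => a b _; rewrite /re /im /= => ab.
have a1 : -1 <= a <= 1 by have b2 := sqr_ge0 b; apply/andP; split; nra.
have sE : sin (acos a) = `|b|.
  by rewrite sin_acos // (_ : 1 - a ^+ 2 = b ^+ 2) ?sqrtr_sqr // -ab addrC addKr.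
have cE : cos (acos a) = a by rewrite acosK.
have t0 := acos_ge0 a1; have tp := acos_lepi a1; have p0 := pi_ge0 R.
have [b0|b0] := leP 0 b.
  exists (acos a); first by apply/andP; split=> //; lra.
  by rewrite /expi cE sE ger0_norm.
exists (2 * pi - acos a); first by apply/andP; split; lra.
have c2 : cos (2 * pi) = 1 :> R by rewrite mulr_natl cos2pi.
have s2 : sin (2 * pi) = 0 :> R by rewrite mulr_natl sin2pi.
by rewrite /expi cosB sinB c2 s2 cE sE ltr0_norm // !mul1r !mul0r addr0 add0r opprK.
Qed.

End complex_continuity.

(** The lists, filtered by inclusion, serve as the parameter of the near-covering form of
    compactness; a list eventually good for all points is a finite subcover. *)
Lemma compact_finite_cover (T : topologicalType) (U : T -> set T) :
  compact [set: T] -> (forall x, nbhs x (U x)) ->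
  exists s : seq T, forall x, exists2 y, y \in s & U y x.
Proof.
move=> /compact_near_coveringP cT nU.
pose F : set_system (seq T) := [set A | exists L : seq T, forall L' : seq T, {subset L <= L'} -> A L'].
have FF : Filter F.
  split; first by exists [::].
    move=> A B [L hL] [L' hL']; exists (L ++ L') => M hM; split.
      by apply: hL => x xL; apply: hM; rewrite mem_cat xL.
    by apply: hL' => x xL; apply: hM; rewrite mem_cat xL orbT.
  by move=> A B AB [L hL]; exists L => M hM; apply: AB; exact: hL.
have [|L hL] := cT (seq T) F (fun s x => exists2 y, y \in s & U y x) FF.
  move=> x _; exists (U x, [set L : seq T | x \in L]) => /=.
    by split; [exact: nU|exists [:: x] => L; apply; rewrite mem_head].
  by move=> [x' L] /= [Ux' xL]; exists x.
by exists L => x; exact: (hL L).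
Qed.

(** Near each point either V holds or h stays above a positive constant; compactness makes the
    threshold uniform. It is used to pass from a fibre of the invariants to a neighbourhood defined
    by the invariants alone. *)
Lemma compact_level (R : realType) (T : topologicalType) (h : T -> R) (V : T -> Prop) :
  compact [set: T] -> continuous h ->
  (forall x, 0 < h x \/ (\forall y \near x, V y)) ->
  exists2 d : R, 0 < d & forall x, h x < d -> V x.
Proof.
move=> /compact_near_coveringP cT hc hV.
have H := cT R (0^'+) (fun d x => h x < d -> V x) _.
have [|e /= e0 he] := H; last first.
  exists (e / 2); first by rewrite divr_gt0.
  move=> x; apply: (he (e / 2)) => //=; last by rewrite divr_gt0.
  by rewrite /ball_ sub0r normrN gtr0_norm ?divr_gt0 //; lra.
move=> x _; have [hx|Vx] := hV x; last first.
  by exists (V, setT); [split=> //; exact: filterT|case=> y d [Vy _] _].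
exists ([set y | h x / 2 < h y], [set d | d < h x / 2]) => /=.
  split.
    have h2 : h x / 2 < h x by lra.
    exact: (cvgr_gt (h x) (hc x) _ h2).
  apply: nbhs_right_lt; lra.
move=> [y d] /= [h1 h2] h3; lra.
Qed.

Lemma compact_norm_bound (K : numFieldType) (T : topologicalType) (W : normedModType K) (f : T -> W) :
  compact [set: T] -> continuous f -> exists2 M : K, 0 <= M & forall x, `|f x| <= M.
Proof.
move=> cT fc.
have [x|s hs] := @compact_finite_cover T (fun x => [set y | `|f x - f y| < 1]) cT.
  by have /cvgrPdist_lt := fc x; apply.
exists (1 + \sum_(y <- s) `|f y|); first by rewrite addr_ge0 ?sumr_ge0.
move=> x; have [y ys /= h] := hs x.
have -> : f x = (f x - f y) + f y by rewrite subrK.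
rewrite (le_trans (ler_normD _ _)) //; apply: lerD; first by rewrite distrC ltW.
by rewrite (perm_big _ (perm_to_rem ys)) big_cons lerDl sumr_ge0.
Qed.

Section pointwise_continuity.
Variable T : topologicalType.

Lemma cts_id : continuous (fun x : T => x). Proof. by move=> x; exact: cvg_id. Qed.

Lemma cts_comp (U W : topologicalType) (g : U -> W) (f : T -> U) :
  continuous g -> continuous f -> continuous (fun x => g (f x)).
Proof. by move=> gc fc x; apply: (@continuous_comp _ _ _ f g); [exact: fc|exact: gc]. Qed.

Lemma cts_fst (U W : topologicalType) (f : T -> U * W) :
  continuous f -> continuous (fun x => (f x).1).
Proof. by apply: cts_comp => y; exact: cvg_fst. Qed.

Lemma cts_snd (U W : topologicalType) (f : T -> U * W) :
  continuous f -> continuous (fun x => (f x).2).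
Proof. by apply: cts_comp => y; exact: cvg_snd. Qed.

Lemma cts_pair (U W : topologicalType) (f : T -> U) (g : T -> W) :
  continuous f -> continuous g -> continuous (fun x => (f x, g x)).
Proof. by move=> fc gc x; apply: cvg_pair; [exact: fc|exact: gc]. Qed.

Variable K : numFieldType.
Implicit Types f g : T -> K.

Lemma cts_cst (U : topologicalType) (c : U) : continuous (fun _ : T => c).
Proof. by move=> x; exact: cvg_cst. Qed.

Lemma cts_mul f g : continuous f -> continuous g -> continuous (fun x => f x * g x).
Proof. by move=> fc gc x; apply: cvgM; [exact: fc|exact: gc]. Qed.

Lemma cts_sqr f : continuous f -> continuous (fun x => f x ^+ 2).
Proof. by move=> fc; under eq_fun do rewrite expr2; exact: cts_mul. Qed.

Lemma cts_inv f : (forall x, f x != 0) -> continuous f -> continuous (fun x => (f x)^-1).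
Proof. by move=> f0 fc x; apply: cvgV; [exact: f0|exact: fc]. Qed.

Variable W : normedModType K.

Lemma cts_add (f g : T -> W) : continuous f -> continuous g -> continuous (fun x => f x + g x).
Proof. by move=> fc gc x; apply: cvgD; [exact: fc|exact: gc]. Qed.

Lemma cts_opp (f : T -> W) : continuous f -> continuous (fun x => - f x).
Proof. by move=> fc x; apply: cvgN; exact: fc. Qed.

Lemma cts_scale f (g : T -> W) : continuous f -> continuous g -> continuous (fun x => f x *: g x).
Proof. by move=> fc gc x; apply: cvgZ; [exact: fc|exact: gc]. Qed.

End pointwise_continuity.

Section matrix_continuity.
Variables (R : realType) (T : topologicalType).
Local Notation C := (Cplx R).

Lemma mx_coord_continuous m n (f : T -> 'M[C]_(m.+1, n.+1)) :
  (forall i j, continuous (fun x => f x i j)) -> continuous f.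
Proof.
move=> hf; have -> : f = fun x => \sum_i \sum_j f x i j *: delta_mx i j.
  by apply/funext => x; exact: matrix_sum_delta.
apply: continuous_big; first exact: add_continuous.
move=> i _; apply: continuous_big; first exact: add_continuous.
by move=> j _ x; apply: cvgZr_tmp; exact: hf.
Qed.

Lemma coord_mx_continuous m n (f : T -> 'M[C]_(m.+1, n.+1)) i j :
  continuous f -> continuous (fun x => f x i j).
Proof.
by move=> hf x; apply: (@continuous_comp _ _ _ f (fun M => M i j)); [exact: hf|exact: coord_continuous].
Qed.

Lemma mulmx_continuous m n k (f : T -> 'M[C]_(m.+1, n.+1)) (g : T -> 'M[C]_(n.+1, k.+1)) :
  continuous f -> continuous g -> continuous (fun x => f x *m g x).
Proof.
move=> hf hg; apply: mx_coord_continuous => i j.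
have -> : (fun x => (f x *m g x) i j) = fun x => \sum_l f x i l * g x l j.
  by apply/funext => x; rewrite mxE.
apply: continuous_big; first exact: add_continuous.
by move=> l _ x; apply: cvgM; apply: coord_mx_continuous.
Qed.

Lemma adjmx_continuous m n (f : T -> 'M[C]_(m.+1, n.+1)) :
  continuous f -> continuous (fun x => (f x) ^t*).
Proof.
move=> hf; apply: mx_coord_continuous => i j.
have -> : (fun x => (f x) ^t* i j) = Num.conj \o (fun x => f x j i).
  by apply/funext => x; rewrite !mxE.
move=> x; apply: continuous_comp; last exact: conjC_continuous.
exact: coord_mx_continuous.
Qed.

End matrix_continuity.

(** * Compactness of the domain and continuity of the models *)

Section compact_domain.
Variables (R : realType) (eps : R).
Hypotheses (eps0 : 0 < eps) (eps1 : eps < 1).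
Local Notation C := (Cplx R).

(** The domain is the continuous image of a box: x_1 is written as a multiple in [0, 1] of (1 - r) /
    2, and the circles are covered by [expi]. *)
Lemma DT3_compact : compact (@DT3 R eps).
Proof.
pose Q : set (R * R * R * R * R * R) :=
  `[eps, 1]%classic `*` `[0, 1]%classic `*` `[0, 1 / 2]%classic `*`
  `[0, 2 * pi]%classic `*` `[0, 2 * pi]%classic `*` `[0, 2 * pi]%classic.
have cQ : compact Q by do !apply: compact_setX; exact: segment_compact.
pose g (x : R * R * R * R * R * R) : point6 R :=
  (x.1.1.1.1.1, x.1.1.1.1.2 * ((1 - x.1.1.1.1.1) / 2), x.1.1.1.2,
   expi x.1.1.2, expi x.1.2, expi x.2).
have -> : @DT3 R eps = g @` Q.
  apply/seteqP; split=> [p hp|_ [x Qx <-]].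
    have [/andP[r0 r1] /andP[x0 x1] x2] := DT3_bounds hp; have [u0 u1 u2] := DT3_norms hp.
    have [a a0 aE] := expi_surj u0; have [b b0 bE] := expi_surj u1; have [c c0 cE] := expi_surj u2.
    (* At r = 1 the range of x_1 is a point and the multiple is arbitrary; 0 is chosen. *)
    exists (pr p, (if pr p == 1 then 0 else px1 p / ((1 - pr p) / 2)), px2 p, a, b, c).
      rewrite /Q /= !in_itv /= a0 b0 c0 r0 r1 x2; do !split=> //.
      have [_|n1] := eqVneq; first by rewrite lexx ler01.
      have h : 0 < (1 - pr p) / 2 by rewrite divr_gt0 // subr_gt0 lt_neqAle n1.
      by rewrite divr_ge0 ?(ltW h) //= ler_pdivrMr // mul1r.
    rewrite /g /= aE bE cE.
    have -> : (if pr p == 1 then 0 else px1 p / ((1 - pr p) / 2)) * ((1 - pr p) / 2) = px1 p.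
      have [e|n1] := eqVneq; first by rewrite mul0r; apply/eqP; rewrite eq_le x0 /=; move: x1; rewrite e; lra.
      by rewrite divfK // mulf_neq0 // ?invr_neq0 // subr_eq0 eq_sym.
    by case: p {hp r0 r1 x0 x1 x2 u0 u1 u2 aE bE cE} => -[] [] [] [].
  move: Qx; rewrite /Q /= !in_itv /= => -[[[[[h1 h2] h3] h4] h5] h6].
  split=> //; last by rewrite !expi_norm.
  by move: h1 h2 => /andP[? ?] /andP[? ?]; apply/andP; split; nra.
apply: continuous_compact cQ.
apply: continuous_subspaceT; rewrite /g.
repeat (apply: cts_pair); try by repeat (first [exact: cts_id|apply: cts_fst|apply: cts_snd]).
- apply: cts_mul; first by repeat (first [exact: cts_id|apply: cts_fst|apply: cts_snd]).
  apply: cts_mul; last exact: cts_cst.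
  apply: cts_add; first exact: cts_cst.
  by apply: cts_opp; repeat (first [exact: cts_id|apply: cts_fst|apply: cts_snd]).
- by apply: cts_comp; [exact: expi_continuous|repeat (first [exact: cts_id|apply: cts_fst|apply: cts_snd])].
- by apply: cts_comp; [exact: expi_continuous|repeat (first [exact: cts_id|apply: cts_fst|apply: cts_snd])].
- by apply: cts_comp; [exact: expi_continuous|repeat (first [exact: cts_id|apply: cts_fst|apply: cts_snd])].
Qed.
Local Notation X := (set_type (@DT3 R eps)).

Lemma X_compact : compact [set: X].
Proof. exact: compact_set_type DT3_compact. Qed.

Implicit Type p : X.

Lemma XP p : DT3 eps (val p). Proof. exact: set_valP. Qed.

Lemma val_cts : continuous (fun p => val p : point6 R).
Proof. exact: initial_continuous. Qed.

Lemma pr_cts : continuous (fun p => pr (val p)).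
Proof. by rewrite /pr; do 5 apply: cts_fst; exact: val_cts. Qed.
Lemma px1_cts : continuous (fun p => px1 (val p)).
Proof. by rewrite /px1; apply: cts_snd; do 4 apply: cts_fst; exact: val_cts. Qed.
Lemma px2_cts : continuous (fun p => px2 (val p)).
Proof. by rewrite /px2; apply: cts_snd; do 3 apply: cts_fst; exact: val_cts. Qed.
Lemma pu_cts : continuous (fun p => pu (val p)).
Proof. by rewrite /pu; apply: cts_snd; do 2 apply: cts_fst; exact: val_cts. Qed.
Lemma pu1_cts : continuous (fun p => pu1 (val p)).
Proof. by rewrite /pu1; apply: cts_snd; apply: cts_fst; exact: val_cts. Qed.
Lemma pu2_cts : continuous (fun p => pu2 (val p)).
Proof. by rewrite /pu2; apply: cts_snd; exact: val_cts. Qed.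

Lemma cts_Cr (f : X -> R) : continuous f -> continuous (fun p => Cr (f p) : C).
Proof. by apply: cts_comp; exact: Cr_continuous. Qed.
Lemma cts_sqrt (f : X -> R) : continuous f -> continuous (fun p => Num.sqrt (f p)).
Proof. by apply: cts_comp; exact: sqrt_continuous. Qed.
Lemma cts_conj (f : X -> C) : continuous f -> continuous (fun p => (f p)^*).
Proof. by apply: cts_comp; exact: conjC_continuous. Qed.

Lemma ptau_cts : continuous (fun p => ptau (val p)).
Proof.
rewrite /ptau; apply: cts_mul.
  by apply: cts_mul; [exact: cts_cst|exact: px1_cts].
apply: cts_inv => [p|]; first by have h := pr_gt0 eps0 (XP p); rewrite gt_eqF //; lra.
by apply: cts_add; [exact: cts_cst|exact: pr_cts].
Qed.

Lemma pt_cts : continuous (fun p => pt (val p)).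
Proof.
by apply: cts_mul; [apply: cts_Cr; apply: cts_sqrt; exact: ptau_cts|exact: pu1_cts].
Qed.

Lemma pdel_cts : continuous (fun p => pdel (val p)).
Proof.
rewrite /pdel; apply: cts_add; first apply: cts_add; first exact: cts_cst.
  by apply: cts_opp; exact: pr_cts.
by apply: cts_opp; apply: cts_mul; [exact: cts_cst|exact: px1_cts].
Qed.

Lemma pw'_cts : continuous (fun p => pw' (val p)).
Proof.
apply: cts_mul; last exact: pu2_cts.
by apply: cts_Cr; apply: cts_mul; [exact: pdel_cts|exact: px2_cts].
Qed.

Lemma pw_cts : continuous (fun p => pw (val p)).
Proof.
rewrite /pw; apply: cts_mul.
  apply: cts_add; first exact: pw'_cts.
  apply: cts_opp; apply: cts_mul; first by apply: cts_sqr; exact: pt_cts.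
  by apply: cts_conj; exact: pw'_cts.
apply: cts_inv => [p|].
  rewrite fmorph_eq0 gt_eqF // subr_gt0 expr_lt1 //.
    exact: ptau_lt1 eps0 (XP p).
  exact: ptau_ge0 eps0 (XP p).
apply: cts_Cr; apply: cts_add; first exact: cts_cst.
by apply: cts_opp; apply: cts_sqr; exact: ptau_cts.
Qed.

Lemma pD_cts : continuous (fun p => pD (val p)).
Proof.
rewrite /pD /disc; apply: cts_sqrt; apply: cts_add.
  by apply: cts_sqr; apply: cts_add; [exact: cts_cst|exact: pr_cts].
apply: cts_opp; apply: cts_mul; first exact: cts_cst.
apply: cts_add; apply: cts_sqr; apply: cts_comp pw_cts.
  exact: re_continuous.
exact: im_continuous.
Qed.

Lemma pA_cts : continuous (fun p => pA (val p)).
Proof.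
rewrite /pA /coefA; apply: cts_sqrt; apply: cts_mul; last exact: cts_cst.
apply: cts_add; last exact: pD_cts.
by apply: cts_add; [exact: cts_cst|exact: pr_cts].
Qed.

Lemma pB_cts : continuous (fun p => pB (val p)).
Proof.
rewrite /pB /coefB; apply: cts_mul; first exact: pw_cts.
apply: cts_inv => [p|]; last by apply: cts_Cr; exact: pA_cts.
rewrite fmorph_eq0 gt_eqF //.
by apply: coefA_gt0; [exact: pr_gt0 eps0 (XP p)|exact: pw_small eps0 (XP p)].
Qed.

Lemma pa_cts : continuous (fun p => pa (val p)).
Proof.
rewrite /pa /ca; apply: cts_mul; last exact: cts_cst.
apply: cts_add; apply: cts_sqrt; apply: cts_add; try exact: cts_cst.
  by apply: cts_mul; [exact: cts_cst|exact: px2_cts].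
by apply: cts_opp; apply: cts_mul; [exact: cts_cst|exact: px2_cts].
Qed.

Lemma pb_cts : continuous (fun p => pb (val p)).
Proof.
rewrite /pb /cb; apply: cts_mul; last exact: cts_cst.
apply: cts_add; last apply: cts_opp; apply: cts_sqrt; apply: cts_add; try exact: cts_cst.
  by apply: cts_mul; [exact: cts_cst|exact: px2_cts].
by apply: cts_opp; apply: cts_mul; [exact: cts_cst|exact: px2_cts].
Qed.

Lemma lin2_cts (f g : X -> C) (M N : 'M[C]_4) :
  continuous f -> continuous g -> continuous (fun p => f p *: M + g p *: N).
Proof.
move=> fc gc; apply: cts_add; first by apply: cts_scale fc _; exact: cts_cst.
by apply: cts_scale gc _; exact: cts_cst.
Qed.

Lemma podd_cts : continuous (fun p => podd (val p)).
Proof.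
have h : continuous (fun p => Num.sqrt (pdel (val p))) by apply: cts_sqrt; exact: pdel_cts.
rewrite /podd /odd_part; move: (mxF1 C) (mxF1s C) => F Fs; apply: lin2_cts.
  by apply: cts_Cr; apply: cts_mul => //; exact: pa_cts.
apply: cts_mul; last exact: pu2_cts.
by apply: cts_Cr; apply: cts_mul => //; exact: pb_cts.
Qed.

Lemma gen0_cts (A B t : X -> C) (h : X -> 'M[C]_4) : continuous A -> continuous B ->
  continuous t -> continuous h -> continuous (fun p => gen0 (A p) (B p) (t p) (h p)).
Proof.
move=> Ac Bc tc hc; rewrite /gen0; move: (mxE1 C) (mxE1s C) (kap C) => E Es k.
apply: cts_scale; first exact: cts_cst.
apply: cts_add hc; apply: lin2_cts.
  exact: cts_add Ac (cts_opp (cts_mul tc (cts_conj Bc))).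
exact: cts_add Bc (cts_mul tc Ac).
Qed.

Lemma gen1_cts (A B t u : X -> C) (h : X -> 'M[C]_4) : continuous A -> continuous B ->
  continuous t -> continuous u -> continuous h ->
  continuous (fun p => gen1 (A p) (B p) (t p) (u p) (h p)).
Proof.
move=> Ac Bc tc uc hc; rewrite /gen1; move: (mxE1 C) (mxE1s C) (kap C) => E Es k.
apply: cts_scale; first by apply: cts_mul; [exact: cts_cst|exact: uc].
apply: cts_add (cts_opp (adjmx_continuous hc)).
have tc' := cts_conj tc.
apply: lin2_cts.
  exact: cts_add (cts_conj Bc) (cts_opp (cts_mul tc' Ac)).
exact: cts_add Ac (cts_mul tc' Bc).
Qed.

Lemma ev_cts i : continuous (fun p => ev (val p) i).
Proof.
have hA : continuous (fun p => Cr (pA (val p)) : C) by apply: cts_Cr; exact: pA_cts.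
rewrite /ev; case: (i == 0).
  exact: gen0_cts hA pB_cts pt_cts podd_cts.
exact: gen1_cts hA pB_cts pt_cts pu_cts podd_cts.
Qed.

End compact_domain.

(** * The scalar invariants *)

Section key.
Variables (R : realType).
Local Notation C := (Cplx R).
Implicit Types p q : point6 R.

(* The scalars [a_1 a_2 + a_2 a_1], [2 a_1^2] and [2 a_2^2] at the point [p]. *)
Definition pkey p : C * C * C :=
  (Cr (pr p) * pu p, 2 * pw p + pt p * Cr (pD p), pu p ^+ 2 * (2 * pw p - pt p * Cr (pD p))^*).

Variable eps : R.
Hypotheses (eps0 : 0 < eps).

(** The modulus of r u gives r, then u. The two squares, with u removed, have sum 4 w and difference
    2 t D; so w is known, then D, then t, and w' = w + t^2 w^*. *)
Lemma pkey_inj p q : DT3 eps p -> DT3 eps q -> pkey p = pkey q ->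
  [/\ pr p = pr q, pu p = pu q, pt p = pt q & pw' p = pw' q].
Proof.
move=> hp hq [e1 e2 e3].
have [up _ _] := DT3_norms hp; have [uq _ _] := DT3_norms hq.
have er : pr p = pr q.
  apply: (@Cr_inj R); have := congr1 Num.norm e1; rewrite !normrM up uq !mulr1 !norm_Cr.
  by rewrite !gtr0_norm // ?(pr_gt0 eps0 hp) ?(pr_gt0 eps0 hq).
have eu : pu p = pu q.
  apply: (@mulfI _ (Cr (pr p))); last by rewrite e1 er.
  by rewrite fmorph_eq0 gt_eqF // (pr_gt0 eps0 hp).
have u0 : pu p ^+ 2 != 0 by rewrite expf_neq0 // -normr_eq0 up oner_eq0.
have e4 : 2 * pw p - pt p * Cr (pD p) = 2 * pw q - pt q * Cr (pD q).
  by rewrite -[LHS]conjCK -[RHS]conjCK; congr (_^*); apply: (mulfI u0); rewrite {2}eu.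
have ew : pw p = pw q.
  apply: (@mulfI _ 4); first by rewrite pnatr_eq0.
  transitivity ((2 * pw p + pt p * Cr (pD p)) + (2 * pw p - pt p * Cr (pD p))); first by ring.
  by rewrite e2 e4; ring.
have eD : pD p = pD q by rewrite /pD er ew.
have et : pt p = pt q.
  have D0 : Cr (pD q) != 0 :> C.
    by rewrite fmorph_eq0 gt_eqF //; apply: disc_gt0; exact: pw_small eps0 hq.
  by apply: (mulIf D0); move: e2; rewrite eD ew => /addrI.
by split=> //; rewrite -(pw_eq eps0 hp) -(pw_eq eps0 hq) et ew.
Qed.

Lemma same_pdel p q : DT3 eps p -> DT3 eps q -> pr p = pr q -> pt p = pt q -> ptau p = ptau q /\ pdel p = pdel q.
Proof.
move=> hp hq er et.
have etau : ptau p = ptau q by apply: (@Cr_inj R); rewrite -(pt_norm eps0 hp) -(pt_norm eps0 hq) et.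
by split=> //; rewrite (pdelE eps0 hp) (pdelE eps0 hq) er etau.
Qed.

Lemma same_x2 p q : DT3 eps p -> DT3 eps q -> pdel p = pdel q -> 0 < pdel p -> pw' p = pw' q ->
  px2 p = px2 q /\ (px2 p = 0 \/ pu2 p = pu2 q).
Proof.
move=> hp hq ed d0 ew.
have ex : px2 p = px2 q.
  apply: (@mulfI _ (pdel p)); first by rewrite gt_eqF.
  by rewrite -(pw'_norm_le hp) ed -(pw'_norm_le hq) ew.
split=> //; have [x0|x0] := eqVneq (px2 p) 0; first by left.
right.
apply: (@mulfI _ (Cr (pdel p * px2 p))); first by rewrite fmorph_eq0 mulf_neq0 // gt_eqF.
by move: ew; rewrite /pw' -ed -ex.
Qed.

(** A coordinate that the invariants do not determine is multiplied by zero in the model: u_1 when t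
    = 0, u_2 when x_2 = 0 since then cb = 0, and both x_2 and u_2 when del = 0. *)
Lemma ev_same p q i : DT3 eps p -> DT3 eps q -> pkey p = pkey q -> ev p i = ev q i.
Proof.
move=> hp hq /(pkey_inj hp hq)[er eu et ew'].
have [etau ed] := same_pdel hp hq er et.
have ew : pw p = pw q by rewrite /pw ew' et etau.
have eA : pA p = pA q by rewrite /pA er ew.
have eB : pB p = pB q by rewrite /pB er ew.
have eo : podd p = podd q.
  rewrite /podd; have [d0|d0] := eqVneq (pdel p) 0; first by rewrite -ed d0 sqrtr0 !mul0r.
  have dp : 0 < pdel p by rewrite lt_neqAle eq_sym d0 (pdel_ge0 hp).
  have [ex eu2] := same_x2 hp hq ed dp ew'.
  rewrite -ed /pa /pb -ex; congr odd_part.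
  by case: eu2 => [->|->//]; rewrite cb0 mulr0 rmorph0 !mul0r.
by rewrite /ev eA eB et eu eo.
Qed.

End key.

(** The new point is the convex combination of (r, a, b) with (e, 0, 0), which is off the degenerate
    faces because e < 1; so del becomes at least s (1 - e). *)
Lemma shrink_bounds (R : realFieldType) (e r a b s : R) : e < 1 -> 0 < s -> s <= 1 / 2 ->
  e <= r <= 1 -> 0 <= a <= (1 - r) / 2 -> 0 <= b <= 1 / 2 ->
  [/\ e <= r - s * (r - e) <= 1, 0 <= (1 - s) * a <= (1 - (r - s * (r - e))) / 2,
      0 <= (1 - s) * b <= 1 / 2, 0 < 1 - (r - s * (r - e)) - 2 * ((1 - s) * a)
    & (1 - s) * b < 1 / 2].
Proof.
move=> e1 s0 s1 /andP[r0 r1] /andP[a0 a1] /andP[b0 b1].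
have h1 : 0 <= (1 - s) * (1 - r - 2 * a) by apply: mulr_ge0; lra.
have h2 : 0 < s * (1 - e) by apply: mulr_gt0; lra.
have h3 : 0 <= (1 - s) * (1 / 2 - b) by apply: mulr_ge0; lra.
have h4 : 0 <= (1 - s) * a by apply: mulr_ge0; lra.
have h5 : 0 <= (1 - s) * b by apply: mulr_ge0; lra.
have h6 : 0 <= s * (r - e) by apply: mulr_ge0; lra.
have h7 : 0 <= (1 - s) * (r - e) by apply: mulr_ge0; lra.
by split; try (apply/andP; split); lra.
Qed.

Section domain.
Variables (R : realType) (eps : R).
Hypotheses (eps0 : 0 < eps) (eps1 : eps < 1).
Local Notation C := (Cplx R).
Local Notation X := (set_type (@DT3 R eps)).

Lemma pkey_cts : continuous (fun p : X => pkey (val p)).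
Proof.
have Dc : continuous (fun p : X => Cr (pD (val p)) : C) by apply: cts_Cr; exact: pD_cts.
have tD := cts_mul (pt_cts eps0) Dc.
have w2 : continuous (fun p : X => 2 * pw (val p)).
  by apply: cts_mul; [exact: cts_cst|exact: pw_cts].
have rc : continuous (fun p : X => Cr (pr (val p)) : C) by apply: cts_Cr; exact: pr_cts.
apply: cts_pair; first apply: cts_pair.
- exact: cts_mul rc (@pu_cts _ _).
- exact: cts_add w2 tD.
- by apply: cts_mul; [apply: cts_sqr; exact: pu_cts|apply: cts_conj; exact: cts_add w2 (cts_opp tD)].
Qed.

(** The points with del > 0 and x_2 < 1/2 are those where the model generates all of M_4; every
    point is reached from them along a segment. *)
Lemma interior_dense (Z : set X) : closed Z ->
  (forall p, 0 < pdel (val p) -> px2 (val p) < 1 / 2 -> Z p) -> forall p, Z p.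
Proof.
move=> cZ hZ p; apply/not_notP => nZ.
have : nbhs p (~` Z) by apply: open_nbhs_nbhs; split=> //; exact: closed_openC.
rewrite nbhsE => -[B' [[U oU UB'] B'p] B'B].
have Up : U (val p) by rewrite -[U _]/((set_val @^-1` U) p) UB'.
pose c (s : R) : point6 R := (pr (val p) - s * (pr (val p) - eps), (1 - s) * px1 (val p),
  (1 - s) * px2 (val p), pu (val p), pu1 (val p), pu2 (val p)).
have c0 : c 0 = val p.
  by rewrite /c mul0r !subr0 !mul1r; case: (val p) => -[] [] [] [].
have cc : continuous c.
  have h (y : R) : continuous (fun s : R => (1 - s) * y).
    apply: cts_mul; last exact: cts_cst.
    by apply: cts_add; [exact: cts_cst|apply: cts_opp; exact: cts_id].
  rewrite /c; repeat (apply: cts_pair); try exact: cts_cst; try exact: h.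
  apply: cts_add; first exact: cts_cst.
  by apply: cts_opp; apply: cts_mul; [exact: cts_id|exact: cts_cst].
have nU : nbhs (c 0) U by rewrite c0; apply: open_nbhs_nbhs.
have /= [e /= e0 he] := cc 0 U nU.
pose s := Num.min (e / 2) (1 / 2).
have s0 : 0 < s by rewrite lt_min !divr_gt0.
have s1 : s <= 1 / 2 by rewrite ge_min lexx orbT.
have se : s < e by rewrite gt_min; apply/orP; left; lra.
have Us : U (c s) by apply: he; rewrite /ball_ /= sub0r normrN gtr0_norm.
have [hr hx hy] := DT3_bounds (XP p).
have [k1 k2 k3 k4 k5] := shrink_bounds eps1 s0 s1 hr hx hy.
have hs : DT3 eps (c s) by split=> //; have [] := DT3_norms (XP p).
have hsX : c s \in @DT3 R eps by rewrite inE.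
apply: (B'B (exist _ (c s) hsX)); first by rewrite -UB'.
exact: hZ.
Qed.

End domain.

(** * Operator norm bounds for 4 x 4 matrices *)

Section operator_bounds.
Variable R : realType.
Local Notation C := (Cplx R).
Local Notation H := (euclid R).
Implicit Types M N : 'M[C]_4.

(** The operator norm on C^4, kept as a relation so that no supremum is formed for a single
    matrix. *)
Definition opb M (c : C) := forall x : H, `|mxop M x| <= c * `|x|.

Lemma opbW M c c' : c <= c' -> opb M c -> opb M c'.
Proof. by move=> cc' h x; rewrite (le_trans (h x)) // ler_wpM2r. Qed.

Lemma opbD M N c d : opb M c -> opb N d -> opb (M + N) (c + d).
Proof.
by move=> hM hN x; rewrite -mxop_add (le_trans (ler_normD _ _)) // mulrDl lerD.
Qed.

Lemma opbZ k M c : opb M c -> opb (k *: M) (`|k| * c).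
Proof.
move=> hM x; rewrite /mxop -scalemxAl normrZ -mulrA.
exact: ler_wpM2l (normr_ge0 k) _ _ (hM x).
Qed.

Lemma opbN M c : opb M c -> opb (- M) c.
Proof. by move=> /(opbZ (-1)); rewrite normrN1 mul1r scaleN1r. Qed.

Lemma opbM M N c d : 0 <= c -> opb M c -> opb N d -> opb (M *m N) (c * d).
Proof.
by move=> c0 hM hN x; rewrite -mxop_comp (le_trans (hM _)) // -mulrA ler_wpM2l.
Qed.

Lemma opb1 : opb 1%:M 1. Proof. by move=> x; rewrite /mxop mul1mx mul1r. Qed.

Lemma opb_adj M c : 0 <= c -> opb M c -> opb (M ^t*) c.
Proof.
move=> c0 hM x; set y := mxop _ x.
have [->|y0] := eqVneq y 0; first by rewrite normr0 mulr_ge0.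
have yp : 0 < `|y| by rewrite normr_gt0.
have : `|y| * `|y| <= `|y| * (c * `|x|).
  rewrite -expr2 sqr_normE {1}/y mxop_adj trmxCK -[leLHS]ger0_norm; last first.
    by rewrite -{1}(trmxCK M) -mxop_adj -sqr_normE exprn_ge0.
  rewrite (le_trans (Cauchy_Schwarz _ _)) // mulrC mulrCA [leRHS]mulrA.
  by rewrite ler_wpM2r // mulrC.
by rewrite ler_pM2l.
Qed.

Lemma opb_sqr M (x : H) (c : C) : opb (M ^t* *m M) c -> `|mxop M x| ^+ 2 <= c * `|x| ^+ 2.
Proof.
move=> hM; have E : `|mxop M x| ^+ 2 = dot x (mxop (M ^t* *m M) x).
  by rewrite sqr_normE mxop_adj mxop_comp.
have -> : `|mxop M x| ^+ 2 = `|dot x (mxop (M ^t* *m M) x)| by rewrite -E ger0_norm // exprn_ge0.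
by rewrite (le_trans (Cauchy_Schwarz _ _)) // mulrC expr2 mulrA ler_wpM2r.
Qed.

Lemma euclid_delta (j : 'I_4) : `|(delta_mx j 0 : H)| = 1.
Proof.
apply/eqP; rewrite -sqrp_eq1 // sqr_normE /dot /= /euclid_dot dotcvE (bigD1 j) //=.
rewrite big1 => [|i ij]; first by rewrite mxE !eqxx normr1 expr1n addr0.
by rewrite mxE (negPf ij) normr0 expr0n.
Qed.

Lemma opb_entry M c i j : opb M c -> `|M i j| <= c.
Proof.
move=> /(_ (delta_mx j 0)); rewrite euclid_delta mulr1; apply: le_trans.
by have := ler_coord_euclid (mxop M (delta_mx j 0)) i; rewrite /mxop -colE mxE.
Qed.

Lemma euclid_l1 (x : H) : `|x| <= \sum_i `|x i 0|.
Proof.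
have {1}-> : x = \sum_i x i 0 *: (delta_mx i 0 : H).
  by rewrite {1}[x]matrix_sum_delta; apply: eq_bigr => i _; rewrite big_ord1.
rewrite (le_trans (ler_norm_sum _ _ _)) //; apply: ler_sum => i _.
by rewrite normrZ euclid_delta mulr1.
Qed.

Lemma opb_entries M : opb M (\sum_i \sum_j `|M i j|).
Proof.
move=> x; rewrite (le_trans (euclid_l1 _)) // mulr_suml; apply: ler_sum => i _.
rewrite mxE (le_trans (ler_norm_sum _ _ _)) // mulr_suml; apply: ler_sum => j _.
by rewrite normrM ler_wpM2l // ler_coord_euclid.
Qed.

Lemma opb_entries_le M c : (forall i j, `|M i j| <= c) -> opb M (16 * c).
Proof.
move=> h; apply: opbW (opb_entries M).
rewrite (@le_trans _ _ (\sum_(i < 4) \sum_(j < 4) c)) //.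
  by apply: ler_sum => i _; apply: ler_sum.
by rewrite !sumr_const !card_ord -mulrnA mulr_natl lexx.
Qed.

End operator_bounds.

Lemma small_zero (R : realType) (M : 'M[Cplx R]_4) :
  (forall d : Cplx R, 0 < d -> opb M d) -> M = 0.
Proof.
move=> h; apply/matrixP => i j; rewrite mxE; apply/eqP; rewrite -normr_le0.
by apply/ler_addgt0Pr => d d0; rewrite add0r; exact: opb_entry (h _ d0).
Qed.

Lemma uniform_limit_cts (K : numFieldType) (T : topologicalType) (f : T -> K) :
  (forall e, 0 < e -> exists2 g : T -> K, continuous g & forall x, `|f x - g x| <= e) ->
  continuous f.
Proof.
move=> hf x; apply/cvgrPdist_lt => e e0.
have e3 : 0 < e / 3 by rewrite divr_gt0.
have [g gc hg] := hf _ e3.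
have /cvgrPdist_lt/(_ _ e3) h := gc x.
apply: filterS h => y hy.
have -> : f x - f y = (f x - g x) + (g x - g y) + - (f y - g y) by ring.
have -> : e = e / 3 + e / 3 + e / 3 by field.
by rewrite (le_lt_trans (ler_normD _ _)) // normrN ltr_leD // (le_lt_trans (ler_normD _ _)) // ler_ltD.
Qed.

(** * The C*-algebra of good functions *)

Section good_functions.
Variables (R : realType) (eps : R).
Local Notation C := (Cplx R).
Local Notation H := (euclid R).
Local Notation X := (set_type (@DT3 R eps)).
Local Notation dl i j := (delta_mx i j : 'M[C]_2).

(** The non-scalar part of the commutant of the model has the form 1 (x) B: all B where the odd part
    vanishes, the multiples of G where it is a multiple of grading (x) G. Elsewhere the model
    generates M_4 and the set is empty. *)
Definition fib (p : point6 R) : set 'M[C]_2 :=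
  [set B | pdel p = 0 \/ px2 p = 1 / 2 /\ exists c, B = c *: (dl 1 0 + pu2 p *: dl 0 1)].

Lemma fib_adj p B : DT3 eps p -> fib p B -> fib p (B ^t*).
Proof.
move=> hp [d0|[x2 [c ->]]]; first by left.
right; split=> //; exists (c^* * (pu2 p)^*).
have [_ _ /norm1_mulC u2] := DT3_norms hp.
rewrite adjmxZ adjmxD adjmxZ !adjmx_delta -scalerA; congr (_ *: _).
by rewrite scalerDr scalerA mulrC u2 scale1r addrC.
Qed.

(** The function algebra without coordinates: equality on points with equal invariants, and
    commutation. In this form it is visibly stable under sums, products, adjoints and uniform
    limits. *)
Definition good (f : X -> 'M[C]_4) :=
  [/\ continuous f,
      forall p q : X, pkey (val p) = pkey (val q) -> f p = f q
    & forall (p : X) B, fib (val p) B -> f p *m tens2 1%:M B = tens2 1%:M B *m f p].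

Lemma good_cst1 : good (fun=> 1%:M).
Proof. by split=> // [|p B _]; [exact: cts_cst|rewrite mul1mx mulmx1]. Qed.

Lemma good_lin c f g : good f -> good g -> good (fun p => c *: f p + g p).
Proof.
move=> [fc fk ff] [gc gk gf]; split.
- by apply: cts_add gc; apply: cts_scale fc; exact: cts_cst.
- by move=> p q e; rewrite (fk _ _ e) (gk _ _ e).
- move=> p B hB; rewrite mulmxDl mulmxDr -scalemxAl -scalemxAr.
  by rewrite (ff _ _ hB) (gf _ _ hB).
Qed.

Lemma good_mul f g : good f -> good g -> good (fun p => f p *m g p).
Proof.
move=> [fc fk ff] [gc gk gf]; split; first exact: (@mulmx_continuous R X 3 3 3 f g fc gc).
  by move=> p q e; rewrite (fk _ _ e) (gk _ _ e).
by move=> p B hB; rewrite -mulmxA (gf _ _ hB) !mulmxA (ff _ _ hB).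
Qed.

Lemma tens2_1adj (B : 'M[C]_2) : (tens2 1%:M B) ^t* = tens2 1%:M (B ^t*).
Proof. by rewrite tens2_adj adjmx1. Qed.

Lemma good_adj f : good f -> good (fun p => (f p) ^t*).
Proof.
move=> [fc fk ff]; split; first exact: (@adjmx_continuous R X 3 3 f fc).
  by move=> p q e; rewrite (fk _ _ e).
move=> p B /(fib_adj (XP p)) /(ff p) h.
by rewrite -[B in LHS]trmxCK -[B in RHS]trmxCK -tens2_1adj -!adjmxM h.
Qed.

Lemma good_zero : good (fun=> 0).
Proof.
have := good_lin (-1) good_cst1 good_cst1.
by congr good; apply/funext => p; rewrite scaleN1r addNr.
Qed.

Lemma good_limit f : (forall e : C, 0 < e -> exists2 g, good g & forall p, opb (f p - g p) e) -> good f.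
Proof.
move=> hf; split.
- apply: mx_coord_continuous => i j; apply: uniform_limit_cts => e e0.
  have [g [gc _ _] hg] := hf _ e0; exists (fun p => g p i j).
    exact: (@coord_mx_continuous R X 3 3 g i j gc).
  by move=> p; have := opb_entry i j (hg p); rewrite !mxE.
- move=> p q e; apply/eqP; rewrite -subr_eq0; apply/eqP/small_zero => d d0.
  have d2 : 0 < d / 2 by rewrite divr_gt0.
  have [g [_ gk _] hg] := hf _ d2.
  have -> : f p - f q = (f p - g p) + - (f q - g q) by rewrite (gk _ _ e) opprB addrA subrK.
  by rewrite [d]splitr; apply: opbD => //; apply: opbN.
- move=> p B hB; apply/eqP; rewrite -subr_eq0; apply/eqP/small_zero => d d0.
  set Y := tens2 _ _; have hY := opb_entries Y; set c := \sum_i _ in hY.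
  have c0 : 0 <= c by apply: sumr_ge0 => i _; apply: sumr_ge0.
  have e0 : 0 < d / (2 * (c + 1)) by rewrite divr_gt0 // mulr_gt0 // ltr_wpDl.
  have [g [_ _ gf] hg] := hf _ e0.
  have -> : f p *m Y - Y *m f p = (f p - g p) *m Y + - (Y *m (f p - g p)).
    by rewrite mulmxBl mulmxBr (gf _ _ hB) opprB addrA subrK.
  apply: opbW (opbD (opbM (ltW e0) (hg p) hY) (opbN (opbM c0 hY (hg p)))).
  rewrite [c * _]mulrC -mulrDr -mulrA ler_piMr ?(ltW d0) // mulrC ler_pdivrMr ?mulr_gt0 // ?ltr_wpDl //.
  by rewrite mul1r -mulr2n -[c *+ 2]mulr_natl ler_wpM2l // lerDl.
Qed.

Record E0 := MkE0 { fn : X -> 'M[C]_4; fnP : good fn }.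

Lemma E0_eq (f g : E0) : fn f = fn g -> f = g.
Proof.
case: f g => [f hf] [g hg] /= e; rewrite e in hf *.
by congr MkE0; exact: Prop_irrelevance.
Qed.

HB.instance Definition _ := gen_eqMixin E0.
HB.instance Definition _ := gen_choiceMixin E0.

Definition E0_lin c (f g : E0) : E0 := MkE0 (good_lin c (fnP f) (fnP g)).
Definition E0_zero : E0 := MkE0 good_zero.
Definition E0_add f g := E0_lin 1 f g.
Definition E0_opp f := E0_lin (-1) f E0_zero.
Definition E0_scale c f := E0_lin c f E0_zero.

Fact E0_addA : associative E0_add.
Proof. by move=> f g h; apply/E0_eq/funext => p /=; rewrite !scale1r addrA. Qed.
Fact E0_addC : commutative E0_add.
Proof. by move=> f g; apply/E0_eq/funext => p /=; rewrite !scale1r addrC. Qed.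
Fact E0_add0 : left_id E0_zero E0_add.
Proof. by move=> f; apply/E0_eq/funext => p /=; rewrite scale1r add0r. Qed.
Fact E0_addN : left_inverse E0_zero E0_opp E0_add.
Proof. by move=> f; apply/E0_eq/funext => p /=; rewrite scale1r addr0 scaleN1r addNr. Qed.
HB.instance Definition _ := GRing.isZmodule.Build E0 E0_addA E0_addC E0_add0 E0_addN.

Lemma fnD (f g : E0) p : fn (f + g) p = fn f p + fn g p.
Proof. by rewrite /= scale1r. Qed.

Fact E0_scaleA c d f : E0_scale c (E0_scale d f) = E0_scale (c * d) f.
Proof. by apply/E0_eq/funext => p /=; rewrite !addr0 scalerA. Qed.
Fact E0_scale1 : left_id 1 E0_scale.
Proof. by move=> f; apply/E0_eq/funext => p /=; rewrite addr0 scale1r. Qed.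
Fact E0_scaleDr : right_distributive E0_scale +%R.
Proof.
by move=> c f g; apply/E0_eq/funext => p; rewrite fnD /= !addr0 scale1r scalerDr.
Qed.
Fact E0_scaleDl f : {morph E0_scale^~ f : c d / c + d}.
Proof. by move=> c d; apply/E0_eq/funext => p; rewrite fnD /= !addr0 scalerDl. Qed.
HB.instance Definition _ := GRing.Zmodule_isLmodule.Build C E0
  E0_scaleA E0_scale1 E0_scaleDr E0_scaleDl.

Lemma fnZ c (f : E0) p : fn (c *: f) p = c *: fn f p.
Proof. by rewrite /= addr0. Qed.
Lemma fn0 p : fn 0 p = 0. Proof. by []. Qed.
Lemma fnN (f : E0) p : fn (- f) p = - fn f p.
Proof. by rewrite -scaleN1r fnZ scaleN1r. Qed.

End good_functions.

(** * The supremum norm and the C*-identity *)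

Section sup_norm.
Variables (R : realType) (eps : R).
Local Notation C := (Cplx R).
Local Notation H := (euclid R).
Local Notation X := (set_type (@DT3 R eps)).
Local Notation E := (E0 eps).
Implicit Types f g : E.

Lemma fn_bounded f : exists2 c : C, 0 <= c & forall p, opb (fn f p) c.
Proof.
have [fc _ _] := fnP f.
have h (ij : 'I_4 * 'I_4) : exists c : C, 0 <= c /\ forall p, `|fn f p ij.1 ij.2| <= c.
  have [c c0 hc] := @compact_norm_bound C X C^o (fun p => fn f p ij.1 ij.2)
    (@X_compact R eps) (@coord_mx_continuous R X 3 3 (fn f) ij.1 ij.2 fc).
  by exists c.
have {h} [c hc] := choice h.
have s0 : 0 <= \sum_i \sum_j c (i, j).
  by apply: sumr_ge0 => i _; apply: sumr_ge0 => j _; have [] := hc (i, j).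
exists (\sum_i \sum_j c (i, j)) => // p; apply: opbW (opb_entries _).
apply: ler_sum => i _; apply: ler_sum => j _.
by have [_] := hc (i, j).
Qed.

(** Norms take values in the complex numbers; [re] moves them to the reals, where suprema exist. *)
Definition cnorm_set f : set R :=
  [set y | exists (p : X) (x : H), `|x| <= 1 /\ y = re `|mxop (fn f p) x|].
Definition cnorm f : C := Cr (sup (cnorm_set f)).

Lemma cnorm_le f (c : C) : 0 <= c -> (forall p, opb (fn f p) c) -> cnorm f <= c.
Proof.
move=> c0 hc; rewrite -(Cr_re_ge0 c0) ler_Cr.
have hub : ubound (cnorm_set f) (re c).
  move=> _ [p [x [x1 ->]]]; rewrite -ler_Cr !Cr_re_ge0 //.
  by rewrite (le_trans (hc p x)) // ler_piMr.
(* For a domain without points the set is empty and its supremum is 0 by convention. *)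
have [->|/set0P n0] := eqVneq (cnorm_set f) set0; first by rewrite sup0 re_ge0.
exact: ge_sup.
Qed.

Lemma cnorm_ub f p : opb (fn f p) (cnorm f).
Proof.
move=> x; have [->|x0] := eqVneq x 0; first by rewrite raddf0 normr0 mulr0.
have xp : 0 < `|x| by rewrite normr_gt0.
have [c c0 hc] := fn_bounded f.
pose y := `|x|^-1 *: x.
have y1 : `|y| = 1 by rewrite normrZ normfV normr_id mulVf // gt_eqF.
have : `|mxop (fn f p) y| <= cnorm f.
  rewrite -[leLHS]Cr_re_ge0 // ler_Cr; apply: ub_le_sup; last first.
    by exists p, y; rewrite y1.
  exists (re c) => _ [q [z [z2 ->]]]; rewrite -ler_Cr !Cr_re_ge0 //.
  by rewrite (le_trans (hc q z)) // ler_piMr.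
by rewrite linearZ_LR /= normrZ normfV normr_id mulrC ler_pdivrMr.
Qed.

Lemma cnorm_ge0 f : 0 <= cnorm f.
Proof.
rewrite Cr_ge0; have [->|/set0P [y Sy]] := eqVneq (cnorm_set f) set0; first by rewrite sup0.
have [p [x [x1 yE]]] := Sy.
apply: (@le_trans _ _ y); first by rewrite yE re_ge0.
have [c c0 hc] := fn_bounded f.
apply: ub_le_sup => //; exists (re c) => _ [q [z [z2 ->]]]; rewrite -ler_Cr !Cr_re_ge0 //.
by rewrite (le_trans (hc q z)) // ler_piMr.
Qed.

Fact cnormD f g : cnorm (f + g) <= cnorm f + cnorm g.
Proof.
apply: cnorm_le => [|p]; first by rewrite addr_ge0 ?cnorm_ge0.
by rewrite fnD; apply: opbD; exact: cnorm_ub.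
Qed.

Lemma cnormZ_le c f : cnorm (c *: f) <= `|c| * cnorm f.
Proof.
apply: cnorm_le => [|p]; first by rewrite mulr_ge0 ?cnorm_ge0.
by rewrite fnZ; apply: opbZ; exact: cnorm_ub.
Qed.

Fact cnorm_eq0 f : cnorm f = 0 -> f = 0.
Proof.
move=> f0; apply/E0_eq/funext => p; apply: small_zero => d d0.
by apply: opbW (cnorm_ub f p); rewrite f0 ltW.
Qed.

Lemma cnorm0 : cnorm 0 = 0.
Proof.
apply/eqP; rewrite eq_le cnorm_ge0 andbT; apply: cnorm_le => // p x.
by rewrite fn0 /mxop mul0mx mul0r normr0.
Qed.

Fact cnormZ c f : cnorm (c *: f) = `|c| * cnorm f.
Proof.
apply/eqP; rewrite eq_le cnormZ_le /=; have [->|c0] := eqVneq c 0.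
  by rewrite scale0r normr0 mul0r cnorm0.
have := cnormZ_le c^-1 (c *: f); rewrite scalerA mulVf // scale1r normfV.
by rewrite ler_pdivlMl // normr_gt0.
Qed.

HB.instance Definition _ := Lmodule_isNormed.Build C E cnormD cnormZ cnorm_eq0.

Lemma E0_normE f : `|f| = cnorm f. Proof. by []. Qed.

(** Entries are dominated by the norm, so entrywise limits exist; the convergence is uniform, hence
    the limit is good by [good_limit]. *)
Lemma E0_complete (F : set_system E) : ProperFilter F -> cauchy F -> cvg F.
Proof.
move=> FF cF.
have entry f g p i j : `|fn f p i j - fn g p i j| <= `|f - g|.
  by have := opb_entry i j (cnorm_ub (f - g) p); rewrite fnD fnN !mxE.
have coord (pij : X * ('I_4 * 'I_4)) : exists l : C,
    (fun f : E => fn f pij.1 pij.2.1 pij.2.2) @ F --> l.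
  apply/cvg_ex; apply: Cplx_complete; apply: cauchy_exP => e e0.
  have [f Ff] := cauchy_ex_ball FF cF e0.
  exists (fn f pij.1 pij.2.1 pij.2.2).
  apply: (@filterS _ F _ (ball f e) ((fun g : E => fn g pij.1 pij.2.1 pij.2.2) @^-1`
    ball (fn f pij.1 pij.2.1 pij.2.2) e) _ Ff) => g; rewrite -!ball_normE /= => h.
  exact: le_lt_trans (entry _ _ _ _ _) h.
have [l hl] := choice coord.
pose L (p : X) : 'M[C]_4 := \matrix_(i, j) l (p, (i, j)).
have unif (e : C) : 0 < e -> exists2 f : E, F (ball f e) & forall p, opb (L p - fn f p) (16 * e).
  move=> e0; have [f Ff] := cauchy_ex_ball FF cF e0; exists f => // p.
  apply: opb_entries_le => i j; rewrite !mxE; apply/ler_addgt0Pr => d d0.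
  have /cvgrPdist_lt/(_ _ d0) h := hl (p, (i, j)).
  have [g [/= hg]] := filter_ex (filterI h Ff); rewrite -ball_normE /= => fg.
  rewrite -(subrK (fn g p i j) (l _)) -addrA (le_trans (ler_normD _ _)) // [leRHS]addrC lerD //.
    exact: ltW.
  by rewrite distrC (le_trans (entry _ _ _ _ _)) // ltW.
have gL : good L.
  apply: good_limit => e e0; have e16 : 0 < e / 16 by rewrite divr_gt0.
  have [f _ hf] := unif _ e16; exists (fn f); first exact: fnP.
  by move=> p; have := hf p; rewrite mulrCA divff ?mulr1 // pnatr_eq0.
apply/cvg_ex; exists (MkE0 gL); apply/cvgrPdist_lt => e e0.
(* 18 = 16 + 2: the limit is within 16 e / 18 of f because there are sixteen entries, and the
   remaining 2 e / 18 covers f - g. *)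
have e17 : 0 < e / 18 by rewrite divr_gt0.
have [f Ff hf] := unif _ e17.
apply: (@filterS _ F _ (ball f (e / 18)) _ _ Ff) => g; rewrite -ball_normE /= => fg.
rewrite -(subrK f (MkE0 gL)) -addrA (le_lt_trans (ler_normD _ _)) //.
have -> : e = 16 * (e / 18) + 2 * (e / 18) by field.
rewrite ler_ltD //.
  apply: cnorm_le => [|p]; first by rewrite mulr_ge0 // ltW.
  by rewrite fnD fnN; exact: hf.
by rewrite (lt_le_trans fg) // ler_peMl ?(ltW e17) // ler1n.
Qed.

HB.instance Definition _ := Uniform_isComplete.Build E E0_complete.

Definition E0_mul f g : E := MkE0 (good_mul (fnP f) (fnP g)).
Definition E0_one : E := MkE0 (@good_cst1 R eps).
Definition E0_star f : E := MkE0 (good_adj (fnP f)).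

Fact E0_mulA : associative E0_mul.
Proof. by move=> f g h; apply/E0_eq/funext => p /=; rewrite mulmxA. Qed.
Fact E0_mul1 : left_id E0_one E0_mul.
Proof. by move=> f; apply/E0_eq/funext => p /=; rewrite mul1mx. Qed.
Fact E0_1mul : right_id E0_one E0_mul.
Proof. by move=> f; apply/E0_eq/funext => p /=; rewrite mulmx1. Qed.
Fact E0_mulDl : left_distributive E0_mul +%R.
Proof. by move=> f g h; apply/E0_eq/funext => p; rewrite fnD /= !scale1r mulmxDl. Qed.
Fact E0_mulDr : right_distributive E0_mul +%R.
Proof. by move=> f g h; apply/E0_eq/funext => p; rewrite fnD /= !scale1r mulmxDr. Qed.
Fact E0_mulZl (c : C) f g : E0_mul (c *: f) g = c *: E0_mul f g.
Proof. by apply/E0_eq/funext => p; rewrite fnZ /= addr0 scalemxAl. Qed.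
Fact E0_mulZr (c : C) f g : E0_mul f (c *: g) = c *: E0_mul f g.
Proof. by apply/E0_eq/funext => p; rewrite fnZ /= addr0 scalemxAr. Qed.
Fact E0_starK : involutive E0_star.
Proof. by move=> f; apply/E0_eq/funext => p /=; rewrite trmxCK. Qed.
Fact E0_starD : {morph E0_star : f g / f + g}.
Proof. by move=> f g; apply/E0_eq/funext => p; rewrite fnD /= scale1r adjmxD. Qed.
Fact E0_starZ (c : C) f : E0_star (c *: f) = c^* *: E0_star f.
Proof. by apply/E0_eq/funext => p; rewrite fnZ /= addr0 adjmxZ. Qed.
Fact E0_starM f g : E0_star (E0_mul f g) = E0_mul (E0_star g) (E0_star f).
Proof. by apply/E0_eq/funext => p /=; rewrite adjmxM. Qed.
Fact E0_normM f g : `|E0_mul f g| <= `|f| * `|g|.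
Proof.
apply: cnorm_le => [|p]; first by rewrite mulr_ge0.
by apply: opbM => //; exact: cnorm_ub.
Qed.

Lemma E0_norm_star_le f : `|E0_star f| <= `|f|.
Proof. by apply: cnorm_le => // p; apply: opb_adj => //; exact: cnorm_ub. Qed.

(** One inequality is submultiplicativity; the other holds pointwise, from |M x|^2 = <x, M^* M x> in
    [opb_sqr]. *)
Fact E0_cstar f : `|E0_mul (E0_star f) f| = `|f| ^+ 2.
Proof.
apply/eqP; rewrite eq_le (le_trans (E0_normM _ _)) /=; last first.
  rewrite expr2; exact: ler_wpM2r (normr_ge0 f) _ _ (E0_norm_star_le f).
set g := E0_mul _ f.
have -> : `|g| = sqrtC `|g| ^+ 2 by rewrite sqrtCK.
rewrite ler_sqr ?nnegrE ?sqrtC_ge0 //; apply: cnorm_le => [|p x]; first by rewrite sqrtC_ge0.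
have h : `|mxop (fn f p) x| ^+ 2 <= (sqrtC `|g| * `|x|) ^+ 2.
  by rewrite exprMn [sqrtC _ ^+ 2 in leRHS]sqrtCK; apply: opb_sqr; exact: (cnorm_ub g p).
have q0 : 0 <= sqrtC `|g| * `|x| by rewrite mulr_ge0 // sqrtC_ge0.
rewrite ler_sqr // nnegrE in h. exact: normr_ge0.
Qed.

HB.instance Definition _ := isCStarAlgebra.Build C E E0_mulA E0_mul1 E0_1mul E0_mulDl E0_mulDr
  E0_mulZl E0_mulZr E0_starK E0_starD E0_starZ E0_starM E0_normM E0_cstar.

End sup_norm.

(** * The generators and the two norm estimates *)

Section commutation.
Variables (C : numClosedFieldType) (Y : 'M[C]_4).
Definition cm (X : 'M[C]_4) := X *m Y = Y *m X.
Lemma cmD X Z : cm X -> cm Z -> cm (X + Z).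
Proof. by rewrite /cm mulmxDl mulmxDr => -> ->. Qed.
Lemma cmZ c X : cm X -> cm (c *: X).
Proof. by rewrite /cm -scalemxAl -scalemxAr => ->. Qed.
Lemma cmN X : cm X -> cm (- X).
Proof. by rewrite /cm mulNmx mulmxN => ->. Qed.
End commutation.

Lemma cm_tens (C : numClosedFieldType) (A B D : 'M[C]_2) :
  B *m D = D *m B -> cm (tens2 1%:M D) (tens2 A B).
Proof. by move=> h; rewrite /cm !tens2M mulmx1 mul1mx h. Qed.

Lemma cm_gens (C : numClosedFieldType) (A B t u : C) (h : 'M[C]_4) D :
  cm (tens2 1%:M D) h -> cm (tens2 1%:M D) (h ^t*) ->
  cm (tens2 1%:M D) (gen0 A B t h) /\ cm (tens2 1%:M D) (gen1 A B t u h).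
Proof.
move=> ch chs.
have cE : cm (tens2 1%:M D) (mxE1 C) by apply: cm_tens; rewrite mul1mx mulmx1.
have cEs : cm (tens2 1%:M D) (mxE1s C) by apply: cm_tens; rewrite mul1mx mulmx1.
rewrite /gen0 /gen1; move: (mxE1 C) (mxE1s C) cE cEs => E Es cE cEs.
split; apply: cmZ; apply: cmD; [|by []| |exact: cmN]; apply: cmD; exact: cmZ.
Qed.

Section generators_E0.
Variables (R : realType) (eps : R).
Hypotheses (eps0 : 0 < eps) (eps1 : eps < 1).
Local Notation C := (Cplx R).
Local Notation H := (euclid R).
Local Notation X := (set_type (@DT3 R eps)).
Local Notation E := (E0 eps).
Local Notation dl i j := (delta_mx i j : 'M[C]_2).

(** At x_2 = 1/2 the odd part is a multiple of grading (x) G, and the adjoint of G is a multiple of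
    G; so both commute with 1 (x) G. *)
Lemma podd_fib (p : point6 R) B : DT3 eps p -> fib p B ->
  cm (tens2 1%:M B) (podd p) /\ cm (tens2 1%:M B) ((podd p) ^t*).
Proof.
move=> hp [d0|[x2 [c ->]]].
  have -> : podd p = 0 by rewrite /podd /odd_part d0 sqrtr0 !mul0r Cr0 ?mul0r !scale0r addr0.
  have -> : (0 : 'M[C]_4) ^t* = 0 by apply/matrixP => i j; rewrite !mxE conjC0.
  by rewrite /cm mul0mx mulmx0.
have ab : pb p = pa p.
  by rewrite /pa /pb /ca /cb x2 (_ : 1 - 2 * (1 / 2) = 0) ?sqrtr0 ?addr0 ?subr0 //; field.
have [_ _ /norm1_mulC u2] := DT3_norms hp.
set G := dl 1 0 + pu2 p *: dl 0 1.
have GA : G ^t* = (pu2 p)^* *: G.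
  rewrite /G adjmxD adjmxZ !adjmx_delta scalerDr scalerA [_ * pu2 p]mulrC u2 scale1r.
  by rewrite addrC.
have -> : podd p = Cr (Num.sqrt (pdel p) * pa p) *: tens2 (grading C) G.
  by rewrite /podd ab /odd_part /G tens2Dr tens2Zr scalerDr scalerA.
have cG : cm (tens2 1%:M (c *: G)) (tens2 (grading C) G).
  by apply: cm_tens; rewrite -scalemxAl -scalemxAr.
split; first exact: cmZ.
by rewrite adjmxZ tens2_adj grading_adj GA [tens2 (grading _) _]tens2Zr; do 2 apply: cmZ.
Qed.

Lemma ev_good i : good (fun p : X => ev (val p) i).
Proof.
split; first exact: ev_cts.
  by move=> p q; exact: (ev_same eps0 i (XP p) (XP q)).
move=> p B hB; have [h1 h2] := podd_fib (XP p) hB.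
have [g0 g1] := cm_gens (Cr (pA (val p))) (pB (val p)) (pt (val p)) (pu (val p)) h1 h2.
by rewrite /ev; case: (i == 0); [exact: g0|exact: g1].
Qed.

Definition E0_gen i : E := MkE0 (ev_good i).

Lemma fn_sum (J : Type) (s : seq J) (F : J -> E) p :
  fn (\sum_(j <- s) F j) p = \sum_(j <- s) fn (F j) p.
Proof.
by elim: s => [|j s IH]; [rewrite !big_nil|rewrite !big_cons fnD IH].
Qed.

Lemma fn_starpoly q p : fn (starpoly_eval E0_gen q) p = mx_eval (ev (val p)) q.
Proof.
rewrite /starpoly_eval fn_sum; apply: eq_bigr => m _; rewrite fnZ; congr (_ *: _).
by elim: m.2 => [|[i b] w IH] //=; rewrite -IH; case: b.
Qed.

(** Each representation of the class sits in an ampliation of the model at one point, where the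
    value is bounded by the supremum. *)
Lemma E0_upper q : bounded_on_class (@wcar_annulus R eps) q `|starpoly_eval E0_gen q|.
Proof.
move=> K T hT x.
have [p [hp [J [lJ nJ itJ]]]] := rep_at_point eps0 hT.
apply: (op_eval_bound lJ nJ itJ) => // v.
have pX : p \in @DT3 R eps by rewrite inE.
have := cnorm_ub (starpoly_eval E0_gen q) (exist _ p pX : X) (v : H).
rewrite fn_starpoly /= => h.
have : `|mxop (mx_eval (ev p) q) (v : H)| ^+ 2 <= (`|starpoly_eval E0_gen q| * `|(v : H)|) ^+ 2.
  by rewrite ler_sqr ?nnegrE // mulr_ge0.
by rewrite exprMn !sqr_normE.
Qed.

End generators_E0.

Lemma cts_opb (R : realType) (T : topologicalType) (f : T -> 'M[Cplx R]_4) :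
  continuous f -> forall p (d : Cplx R), 0 < d -> \forall q \near p, opb (f p - f q) d.
Proof.
move=> fc p d d0; have d16 : 0 < d / 16 by rewrite divr_gt0.
have h : \forall q \near p, forall ij : 'I_4 * 'I_4, `|f p ij.1 ij.2 - f q ij.1 ij.2| < d / 16.
  apply: filter_forall => ij.
  by have /cvgrPdist_lt/(_ _ d16) := @coord_mx_continuous R T 3 3 f ij.1 ij.2 fc p.
apply: filterS h => q hq; have -> : d = 16 * (d / 16) by field.
by apply: opb_entries_le => i j; rewrite !mxE ltW // (hq (i, j)).
Qed.

Section lower_bound.
Variables (R : realType) (eps : R).
Hypotheses (eps0 : 0 < eps) (eps1 : eps < 1).
Local Notation C := (Cplx R).
Local Notation H := (euclid R).
Local Notation X := (set_type (@DT3 R eps)).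

(** At interior points the model belongs to the class, so M bounds it there. The set of points where
    M is a bound is closed, hence everything by density. *)
Lemma E0_lower q (M : C) : 0 <= M -> bounded_on_class (@wcar_annulus R eps) q M ->
  `|starpoly_eval (E0_gen eps0) q| <= M.
Proof.
move=> M0 hM; apply: cnorm_le => // p.
pose f := fn (starpoly_eval (E0_gen eps0) q).
have fc : continuous f by have [] := fnP (starpoly_eval (E0_gen eps0) q).
apply: (@interior_dense R eps eps1 [set p | opb (f p) M]) => [p' cl x|p' d0 x2 x].
  apply/ler_addgt0Pr => d dp.
  have nx : 0 < `|x| + 1 by rewrite ltr_wpDl.
  have e0 : 0 < d / (`|x| + 1) by rewrite divr_gt0.
  have [p2 [/= hp2 hd]] := cl _ (cts_opb fc p' e0).
  rewrite -[f p'](subrK (f p2)) -mxop_add (le_trans (ler_normD _ _)) // addrC lerD //.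
  rewrite (le_trans (hd x)) // mulrAC ler_pdivrMr // ler_wpM2l ?(ltW dp) //.
  by rewrite lerDl.
have := interior_bound eps0 (XP p') d0 x2 M0 hM (x : 'cV_4).
rewrite /f fn_starpoly => h.
have M1 : 0 <= M * `|x| by rewrite mulr_ge0.
have : `|mxop (mx_eval (ev (val p')) q) x| ^+ 2 <= (M * `|x|) ^+ 2 by rewrite exprMn !sqr_normE.
by rewrite ler_sqr // nnegrE normr_ge0.
Qed.

End lower_bound.

(** * Uniform approximation by polynomials in the generators *)

Lemma mul_divD1_le (K : numFieldType) (x k : K) : 0 <= x -> 0 <= k -> k * (x / (k + 1)) <= x.
Proof.
move=> x0 k0; have k1 : 0 < k + 1 by rewrite ltr_wpDl.
by rewrite mulrCA ler_piMr // ler_pdivrMr // mul1r lerDl.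
Qed.

Section approximation.
Variables (R : realType) (eps : R).
Hypotheses (eps0 : 0 < eps) (eps1 : eps < 1).
Local Notation C := (Cplx R).
Local Notation H := (euclid R).
Local Notation X := (set_type (@DT3 R eps)).
Local Notation E := (E0 eps).
Local Notation a := (@E0_gen R eps eps0).
Implicit Types (f g : X -> 'M[C]_4) (z w : X -> C).

Definition poly_fn q (p : X) : 'M[C]_4 := fn (starpoly_eval a q) p.

(** Membership in the closed algebra generated by the model generators, stated for arbitrary matrix
    functions so that nothing has to be packed into [E0]. *)
Definition apx f := forall e : C, 0 < e -> exists q, forall p, opb (f p - poly_fn q p) e.

Lemma apx_poly q : apx (poly_fn q).
Proof.
by move=> e e0; exists q => p x; rewrite subrr /mxop mul0mx normr0 mulr_ge0 // ltW.
Qed.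

Lemma apx_ext f g : (forall p, f p = g p) -> apx f -> apx g.
Proof. by move=> fg; have -> : f = g by exact/funext. Qed.

Lemma apx_limit f :
  (forall e : C, 0 < e -> exists2 g, apx g & forall p, opb (f p - g p) e) -> apx f.
Proof.
move=> hf e e0; have e2 : 0 < e / 2 by rewrite divr_gt0.
have [g ag hg] := hf _ e2; have [q hq] := ag _ e2; exists q => p.
rewrite -(subrK (g p) (f p)) -addrA [e]splitr; exact: opbD (hg p) (hq p).
Qed.

Lemma apx_bounded f : apx f -> exists2 c : C, 0 <= c & forall p, opb (f p) c.
Proof.
move=> af; have [q hq] := af _ ltr01; exists (1 + `|starpoly_eval a q|); first by rewrite addr_ge0.
by move=> p; rewrite -(subrK (poly_fn q p) (f p)); apply: opbD (hq p) _; exact: cnorm_ub.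
Qed.

Lemma apx_lin c f g : apx f -> apx g -> apx (fun p => c *: f p + g p).
Proof.
move=> af ag e e0; have e2 : 0 < e / 2 by rewrite divr_gt0.
have c1 : 0 < `|c| + 1 by rewrite ltr_wpDl.
have d0 : 0 < e / 2 / (`|c| + 1) by rewrite divr_gt0.
have [q hq] := af _ d0; have [q' hq'] := ag _ e2; exists (starpoly_lin c q q') => p.
rewrite /poly_fn starpoly_eval_lin fnD fnZ -/(poly_fn q p) -/(poly_fn q' p).
rewrite opprD addrACA -scalerBr [e]splitr; apply: opbD (hq' p).
exact: opbW (mul_divD1_le (ltW e2) (normr_ge0 c)) (opbZ c (hq p)).
Qed.

Lemma apx_mul f g : apx f -> apx g -> apx (fun p => f p *m g p).
Proof.
move=> af ag e e0; have e2 : 0 < e / 2 by rewrite divr_gt0.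
have [b b0 hb] := apx_bounded ag.
have b1 : 0 < b + 1 by rewrite ltr_wpDl.
have [|q hq] := af (e / 2 / (b + 1)); first by rewrite divr_gt0.
set c := `|starpoly_eval a q|; have c0 : 0 <= c by exact: normr_ge0.
have c1 : 0 < c + 1 by rewrite ltr_wpDl.
have [|q' hq'] := ag (e / 2 / (c + 1)); first by rewrite divr_gt0.
exists (starpoly_mul q q') => p.
have -> : poly_fn (starpoly_mul q q') p = poly_fn q p *m poly_fn q' p.
  by rewrite /poly_fn starpoly_eval_mul.
have -> : f p *m g p - poly_fn q p *m poly_fn q' p =
    (f p - poly_fn q p) *m g p + poly_fn q p *m (g p - poly_fn q' p).
  by rewrite mulmxBl mulmxBr addrA subrK.
have d0 : 0 <= e / 2 / (b + 1) by rewrite ltW // divr_gt0.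
rewrite [e]splitr; apply: opbW (opbD (opbM d0 (hq p) (hb p)) (opbM c0 (cnorm_ub _ p) (hq' p))).
by apply: lerD; [rewrite mulrC|]; apply: mul_divD1_le => //; exact: ltW.
Qed.

Lemma apx_adj f : apx f -> apx (fun p => (f p) ^t*).
Proof.
move=> af e e0; have [q hq] := af _ e0; exists (starpoly_star q) => p.
have -> : poly_fn (starpoly_star q) p = (poly_fn q p) ^t* by rewrite /poly_fn starpoly_eval_star.
by rewrite -adjmxN -adjmxD; apply: opb_adj (hq p); exact: ltW.
Qed.

Definition sapx z := apx (fun p => (z p)%:M).

Lemma sapx_ext z w : (forall p, z p = w p) -> sapx z -> sapx w.
Proof. by move=> zw; have -> : z = w by exact/funext. Qed.

Lemma sapx_cst c : sapx (fun=> c).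
Proof.
apply: apx_ext (apx_poly [:: (c, [::])]) => p.
by rewrite /poly_fn fn_starpoly /mx_eval big_seq1 /= scalemx1.
Qed.

Lemma sapx_lin c z w : sapx z -> sapx w -> sapx (fun p => c * z p + w p).
Proof.
move=> az aw; apply: apx_ext (apx_lin c az aw) => p.
by rewrite scale_scalar_mx raddfD.
Qed.

Lemma sapx_add z w : sapx z -> sapx w -> sapx (fun p => z p + w p).
Proof. by move=> az aw; apply: sapx_ext (sapx_lin 1 az aw) => p; rewrite mul1r. Qed.

Lemma sapx_scale c z : sapx z -> sapx (fun p => c * z p).
Proof. by move=> az; apply: sapx_ext (sapx_lin c az (sapx_cst 0)) => p; rewrite addr0. Qed.

Lemma sapx_sub z w : sapx z -> sapx w -> sapx (fun p => z p - w p).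
Proof.
move=> az aw; apply: sapx_ext (sapx_add az (sapx_scale (-1) aw)) => p.
by rewrite mulN1r.
Qed.

Lemma sapx_mul z w : sapx z -> sapx w -> sapx (fun p => z p * w p).
Proof. by move=> az aw; apply: apx_ext (apx_mul az aw) => p; rewrite -scalar_mxM. Qed.

Lemma sapx_conj z : sapx z -> sapx (fun p => (z p)^*).
Proof.
move=> az; apply: apx_ext (apx_adj az) => p; apply/matrixP => i j; rewrite !mxE eq_sym.
by case: (i == j); rewrite ?mulr1n // !mulr0n conjC0.
Qed.

Lemma opb_scalar (c : C) : opb (c%:M) `|c|.
Proof. by rewrite -scalemx1 -[`|c|]mulr1; apply: opbZ; exact: opb1. Qed.

Lemma sapx_limit z :
  (forall e : C, 0 < e -> exists2 w, sapx w & forall p, `|z p - w p| <= e) -> sapx z.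
Proof.
move=> hz; apply: apx_limit => e e0; have [w aw hw] := hz e e0.
exists (fun p => (w p)%:M) => // p; rewrite -raddfB.
exact: opbW (hw p) (opb_scalar _).
Qed.

Lemma sapx_bounded z : sapx z -> exists2 c : C, 0 <= c & forall p, `|z p| <= c.
Proof.
move=> /apx_bounded[c c0 hc]; exists c => // p.
by have := opb_entry 0 0 (hc p); rewrite mxE eqxx mulr1n.
Qed.

Lemma sapx_word2 i j k l z :
  (forall p : X, ev (val p) i *m ev (val p) j + ev (val p) k *m ev (val p) l = (z p)%:M) ->
  sapx z.
Proof.
move=> hz.
apply: apx_ext (apx_poly [:: (1, [:: (i, false); (j, false)]); (1, [:: (k, false); (l, false)])]) => p.
by rewrite /poly_fn fn_starpoly /mx_eval !big_cons big_nil addr0 !scale1r /= !mulmx1 hz.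
Qed.

(** The invariants are anticommutators of generators, so they lie in the generated algebra as scalar
    functions. *)
Lemma sapx_key : [/\ sapx (fun p => (pkey (val p)).1.1), sapx (fun p => (pkey (val p)).1.2)
  & sapx (fun p => (pkey (val p)).2)].
Proof.
split.
- exact: (sapx_word2 (fun p => ev_scalar eps0 (XP p))).
- exact: (sapx_word2 (fun p => ev0_sqr eps0 (XP p))).
- exact: (sapx_word2 (fun p => ev1_sqr eps0 (XP p))).
Qed.

End approximation.

(** * Absolute values and bump functions *)

Section scalar_sqrt.
Variable R : realType.

(* Newton's scheme for the smaller root [L = 1 - sqrt (1 - b)] of [2 L = b + L^2]. *)
Fixpoint sqrt_approx (b : R) (n : nat) : R :=
  if n is m.+1 then (b + sqrt_approx b m ^+ 2) / 2 else 0.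

(** With L the limit, the error obeys L - y' = (L - y)(L + y) / 2. Since L <= 1 and y <= s, it stays
    below the worst case b = 1, which is the gap of [sqrt_iter]. *)
Lemma sqrt_approx_err (b : R) n : 0 <= b <= 1 ->
  `|(1 - Num.sqrt (1 - b)) - sqrt_approx b n| <= 1 - sqrt_iter R n.
Proof.
move=> /andP[b0 b1]; set q := Num.sqrt _.
have q0 : 0 <= q by exact: sqrtr_ge0.
have q2 : q ^+ 2 = 1 - b by rewrite sqr_sqrtr // subr_ge0.
have q1 : q <= 1 by nra.
have y0 m : 0 <= sqrt_approx b m.
  by case: m => [|m] //=; rewrite divr_ge0 // addr_ge0 // sqr_ge0.
have ys m : sqrt_approx b m <= sqrt_iter R m.
  elim: m => [|m IH] //=; have := y0 m; nra.
have yl m : sqrt_approx b m <= 1 - q.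
  elim: m => [|m IH] /=; first by rewrite subr_ge0.
  have := y0 m; nra.
rewrite ger0_norm ?subr_ge0 //; elim: n => [|n IH] /=; first by lra.
have := y0 n; have := ys n; have := yl n; have := sqrt_iter_le1 R n.
move: IH; move: (sqrt_approx b n) (sqrt_iter R n) => y s.
nra.
Qed.

End scalar_sqrt.

Section real_approximation.
Variables (R : realType) (eps : R).
Hypotheses (eps0 : 0 < eps) (eps1 : eps < 1).
Local Notation C := (Cplx R).
Local Notation X := (set_type (@DT3 R eps)).
Implicit Types (x y : X -> R).

Definition rapx x := sapx eps0 (fun p => Cr (x p)).

Lemma rapx_ext x y : (forall p, x p = y p) -> rapx x -> rapx y.
Proof. by move=> xy; have -> : x = y by exact/funext. Qed.
Lemma rapx_cst (c : R) : rapx (fun=> c). Proof. exact: sapx_cst. Qed.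
Lemma rapx_add x y : rapx x -> rapx y -> rapx (fun p => x p + y p).
Proof. by move=> ax ay; apply: sapx_ext (sapx_add ax ay) => p; rewrite CrD. Qed.
Lemma rapx_sub x y : rapx x -> rapx y -> rapx (fun p => x p - y p).
Proof. by move=> ax ay; apply: sapx_ext (sapx_sub ax ay) => p; rewrite CrB. Qed.
Lemma rapx_mul x y : rapx x -> rapx y -> rapx (fun p => x p * y p).
Proof. by move=> ax ay; apply: sapx_ext (sapx_mul ax ay) => p; rewrite CrM. Qed.

Lemma rapx_sqrt_approx x n : rapx x -> rapx (fun p => sqrt_approx (x p) n).
Proof.
move=> ax; elim: n => [|n IH] /=; first exact: rapx_cst.
have sq : rapx (fun p => sqrt_approx (x p) n ^+ 2).
  by apply: rapx_ext (rapx_mul IH IH) => p; rewrite expr2.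
exact: rapx_mul (rapx_add ax sq) (rapx_cst 2^-1).
Qed.

(** With m bounding |x| and b = 1 - (x / m)^2 in [0, 1], |x| = m sqrt (1 - b), a uniform limit of
    polynomials in b. *)
Lemma rapx_abs x : rapx x -> rapx (fun p => `|x p|).
Proof.
move=> ax; have [c c0 hc] := sapx_bounded ax.
pose m := re c + 1; have m0 : 0 < m by rewrite ltr_wpDl // re_ge0.
have xm p : `|x p| <= m.
  rewrite -ler_Cr -norm_Cr (le_trans (hc p)) // /m CrD Cr_re_ge0 // lerDl.
  by rewrite Cr1.
pose b p := 1 - (x p / m) * (x p / m).
have ab : rapx b.
  by apply: rapx_sub (rapx_cst 1) _; apply: rapx_mul; apply: rapx_mul ax (rapx_cst _).
have b01 p : 0 <= b p <= 1.
  have : `|x p / m| <= 1 by rewrite normrM normfV [`|m|]gtr0_norm // ler_pdivrMr // mul1r.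
  by rewrite ler_norml /b => /andP[h1 h2]; apply/andP; split; nra.
apply: sapx_limit => e e0; have e1 : 0 < re e by exact: re_gt0.
have [|n hn] := @sqrt_iter_cvg1 R (re e / m); first by rewrite divr_gt0.
exists (fun p => Cr (m * (1 - sqrt_approx (b p) n))).
  exact: rapx_mul (rapx_cst m) (rapx_sub (rapx_cst 1) (rapx_sqrt_approx n ab)).
move=> p; rewrite -CrB norm_Cr -[leRHS]Cr_re_ge0 ?(ltW e0) // ler_Cr.
have -> : `|x p| = m * (1 - (1 - Num.sqrt (1 - b p))).
  rewrite /b !subKr -expr2 sqrtr_sqr normrM normfV [`|m|]gtr0_norm //.
  by rewrite mulrC divfK // gt_eqF.
move: (sqrt_approx_err n (b01 p)); set q := Num.sqrt _; set y := sqrt_approx _ _ => hy.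
have -> : m * (1 - (1 - q)) - m * (1 - y) = - (m * ((1 - q) - y)) by ring.
rewrite normrN normrM gtr0_norm //.
rewrite (le_trans (ler_wpM2l (ltW m0) hy)) //.
by rewrite mulrC -ler_pdivlMr // ltW.
Qed.

(** Truncation to [0, 1], written with absolute values so that [rapx_abs] applies. *)
Definition clamp (v : R) : R := (`|v| - `|v - 1| + 1) / 2.

Lemma clamp_bounds v : 0 <= clamp v <= 1.
Proof. by rewrite /clamp; apply/andP; split; case: (ger0P v); case: (ger0P (v - 1)); lra. Qed.
Lemma clamp_le0 v : v <= 0 -> clamp v = 0.
Proof. by move=> h; rewrite /clamp; case: (ger0P v); case: (ger0P (v - 1)); lra. Qed.
Lemma clamp_ge1 v : 1 <= v -> clamp v = 1.
Proof. by move=> h; rewrite /clamp; case: (ger0P v); case: (ger0P (v - 1)); lra. Qed.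

Lemma rapx_clamp x : rapx x -> rapx (fun p => clamp (x p)).
Proof.
move=> ax; have ax1 := rapx_abs (rapx_sub ax (rapx_cst 1)).
exact: rapx_mul (rapx_add (rapx_sub (rapx_abs ax) ax1) (rapx_cst 1)) (rapx_cst 2^-1).
Qed.

(** The squared Euclidean distance of the invariants; the square keeps it polynomial in them and
    their conjugates. *)
Definition key_dist (p0 p : X) : R :=
  re (`|(pkey (val p)).1.1 - (pkey (val p0)).1.1| ^+ 2 +
      `|(pkey (val p)).1.2 - (pkey (val p0)).1.2| ^+ 2 +
      `|(pkey (val p)).2 - (pkey (val p0)).2| ^+ 2).

Lemma rapx_key_dist p0 : rapx (key_dist p0).
Proof.
have sq (z : X -> C) c : sapx eps0 z -> sapx eps0 (fun p => `|z p - c| ^+ 2).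
  move=> az; have aw := sapx_sub az (sapx_cst eps0 c).
  by apply: sapx_ext (sapx_mul aw (sapx_conj aw)) => p; rewrite normCK.
have [k1 k2 k3] := @sapx_key R eps eps0.
apply: sapx_ext (sapx_add (sapx_add (sq _ _ k1) (sq _ _ k2)) (sq _ _ k3)) => p.
by rewrite /key_dist Cr_re_ge0 // !addr_ge0 // exprn_ge0.
Qed.

Lemma key_dist_ge0 p0 p : 0 <= key_dist p0 p.
Proof. by apply: re_ge0; rewrite !addr_ge0 // exprn_ge0. Qed.

Lemma key_dist_eq0 p0 p : key_dist p0 p = 0 -> pkey (val p) = pkey (val p0).
Proof.
move=> h; have : Cr (key_dist p0 p) = 0 :> C by rewrite h Cr0.
rewrite /key_dist Cr_re_ge0 ?addr_ge0 ?exprn_ge0 // => /eqP.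
rewrite !paddr_eq0 ?addr_ge0 ?exprn_ge0 // !expf_eq0 /= !normr_eq0 !subr_eq0.
move=> /andP[/andP[/eqP h1 /eqP h2] /eqP h3].
exact: (congr2 pair (congr2 pair h1 h2) h3).
Qed.

Lemma key_dist_self p0 : key_dist p0 p0 = 0.
Proof. by rewrite /key_dist !subrr normr0 expr0n /= !addr0. Qed.

Lemma key_dist_cts p0 : continuous (key_dist p0).
Proof.
have kc := pkey_cts eps0.
have nc (z : X -> C) c : continuous z -> continuous (fun p => `|z p - c| ^+ 2 : C).
  move=> zc; have wc : continuous (fun p => z p - c) by apply: cts_add zc _; exact: cts_cst.
  have -> : (fun p => `|z p - c| ^+ 2 : C) = fun p => (z p - c) * (z p - c)^*.
    by apply/funext => p; rewrite normCK.
  exact: cts_mul wc (cts_conj wc).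
have h1 : continuous (fun p : X => (pkey (val p)).1.1) by do 2 apply: cts_fst; exact: kc.
have h2 : continuous (fun p : X => (pkey (val p)).1.2) by apply: cts_snd; apply: cts_fst; exact: kc.
have h3 : continuous (fun p : X => (pkey (val p)).2) by apply: cts_snd; exact: kc.
rewrite /key_dist; apply: cts_comp; first exact: re_continuous.
exact: cts_add (cts_add (nc _ _ h1) (nc _ _ h2)) (nc _ _ h3).
Qed.

End real_approximation.

(** * Commutants in block form *)

Section block_commutation.
Variable C : numClosedFieldType.
Local Notation dl i j := (delta_mx i j : 'M[C]_2).
Implicit Types (A B : 'M[C]_2) (X Z : 'M[C]_4).

Lemma mx_block_tens (A B : 'M[C]_2) i j : mx_block (tens2 A B) i j = A i j *: B.
Proof. by apply/matrixP => k l; rewrite !mxE !mxtens_indexK. Qed.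

Lemma mx_blockD (X Y : 'M[C]_4) i j : mx_block (X + Y) i j = mx_block X i j + mx_block Y i j.
Proof. by apply/matrixP => k l; rewrite !mxE. Qed.

Lemma sum2E (V : nmodType) (F : 'I_2 -> V) : \sum_i F i = F 0 + F 1.
Proof. by rewrite !big_ord_recl big_ord0 addr0; congr (F _ + F _); apply/val_inj. Qed.

Lemma mulmx2E (M N : 'M[C]_2) i j : (M *m N) i j = M i 0 * N 0 j + M i 1 * N 1 j.
Proof. by rewrite mxE sum2E. Qed.

Lemma mx_blockP X Z : (forall i j, mx_block X i j = mx_block Z i j) -> X = Z.
Proof. by move=> h; rewrite (tens2_blocks X) (tens2_blocks Z) !h. Qed.

Lemma mx_block_mulr1 X B i j : mx_block (X *m tens2 1%:M B) i j = mx_block X i j *m B.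
Proof.
rewrite {1}(tens2_blocks X) !mulmxDl !tens2M !mulmx1 !mx_blockD !mx_block_tens !mxE.
by have [->|->] := ord2P i; have [->|->] := ord2P j; rewrite /= !scale0r scale1r ?addr0 ?add0r.
Qed.

Lemma mx_block_mull1 X B i j : mx_block (tens2 1%:M B *m X) i j = B *m mx_block X i j.
Proof.
rewrite {1}(tens2_blocks X) !mulmxDr !tens2M !mul1mx !mx_blockD !mx_block_tens !mxE.
by have [->|->] := ord2P i; have [->|->] := ord2P j; rewrite /= !scale0r scale1r ?addr0 ?add0r.
Qed.

Lemma mx_block_mulr X A i j :
  mx_block (X *m tens2 A 1%:M) i j = A 0 j *: mx_block X i 0 + A 1 j *: mx_block X i 1.
Proof.
rewrite {1}(tens2_blocks X) !mulmxDl !tens2M !mulmx1 !mx_blockD !mx_block_tens !mulmx2E !mxE.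
by have [->|->] := ord2P i; rewrite /= !(mul1r, mul0r, addr0, add0r, scale0r).
Qed.

Lemma mx_block_mull X A i j :
  mx_block (tens2 A 1%:M *m X) i j = A i 0 *: mx_block X 0 j + A i 1 *: mx_block X 1 j.
Proof.
rewrite {1}(tens2_blocks X) !mulmxDr !tens2M !mul1mx !mx_blockD !mx_block_tens !mulmx2E !mxE.
by have [->|->] := ord2P j; rewrite /= !(mulr1, mulr0, addr0, add0r, scale0r).
Qed.

Lemma block_diag_tens2 A B : block_mx A 0 0 B = tens2 (dl 0 0) A + tens2 (dl 1 1) B.
Proof.
have l (k : 'I_2) : @mxtens_index 2 2 (0, k) = lshift 2 k by apply/val_inj.
have r (k : 'I_2) : @mxtens_index 2 2 (1, k) = rshift 2 k by apply/val_inj.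
apply: mx_blockP => i j; rewrite mx_blockD !mx_block_tens.
apply/matrixP => k m; rewrite [LHS]mxE.
have [->|->] := ord2P i; have [->|->] := ord2P j; rewrite ?l ?r
  ?(block_mxEul A 0 0 B) ?(block_mxEur A 0 0 B)
  ?(block_mxEdl A 0 0 B) ?(block_mxEdr A 0 0 B) !mxE /=; ring.
Qed.

Lemma block_diag_commute A B :
  block_mx A 0 0 B *m tens2 (grading C) 1%:M = tens2 (grading C) 1%:M *m block_mx A 0 0 B.
Proof.
rewrite block_diag_tens2 mulmxDl mulmxDr !tens2M !mulmx1 !mul1mx.
by congr (tens2 _ _ + tens2 _ _); rewrite /grading mulmxBl mulmxBr !mul_delta2 /= !scale0r ?scale1r ?subr0 ?sub0r.
Qed.

Lemma commute_grading_blocks X : X *m tens2 (grading C) 1%:M = tens2 (grading C) 1%:M *m X ->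
  X = block_mx (mx_block X 0 0) 0 0 (mx_block X 1 1).
Proof.
move=> h; have e i j := congr1 (fun Y => mx_block Y i j) h.
have := e 0 1; have := e 1 0; rewrite !mx_block_mulr !mx_block_mull !mxE /=.
rewrite !(subr0, sub0r, scale0r, addr0, add0r, scale1r, scaleN1r) => e10 e01.
have z (M : 'M[C]_2) : M = - M -> M = 0.
  by move=> /eqP; rewrite -addr_eq0 -mulr2n -scaler_nat scaler_eq0 pnatr_eq0 => /eqP.
rewrite block_diag_tens2 {1}(tens2_blocks X).
have -> : mx_block X 0 1 = 0 by apply: z.
have -> : mx_block X 1 0 = 0 by apply: z.
by rewrite !tens20r !addr0.
Qed.

Lemma mx_block_commute (X : 'M[C]_4) (B : 'M[C]_2) i j :
  X *m tens2 1%:M B = tens2 1%:M B *m X -> mx_block X i j *m B = B *m mx_block X i j.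
Proof. by move=> h; rewrite -mx_block_mulr1 h mx_block_mull1. Qed.

Lemma commute_all_scalar (M : 'M[C]_2) : (forall B, M *m B = B *m M) -> M = (M 0 0)%:M.
Proof.
move=> h; have e N i j : (M *m N) i j = (N *m M) i j by rewrite h.
have := e (dl 0 1) 0 0; have := e (dl 0 1) 0 1; have := e (dl 1 0) 0 0.
rewrite !mulmx2E !mxE /= !(mulr0, mul0r, mulr1, mul1r, addr0, add0r) => a01 a11 a10.
apply/matrixP => i j; rewrite mxE.
by have [->|->] := ord2P i; have [->|->] := ord2P j; rewrite /= ?mulr1n ?mulr0n.
Qed.

(** G is not scalar, so its commutant in M_2 is spanned by 1 and G. *)
Lemma commute_swap (M : 'M[C]_2) u : u != 0 ->
  M *m (dl 1 0 + u *: dl 0 1) = (dl 1 0 + u *: dl 0 1) *m M ->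
  M = M 0 0 *: 1%:M + M 1 0 *: (dl 1 0 + u *: dl 0 1).
Proof.
move=> u0 h; have e i j := congr1 (fun N : 'M[C]_2 => N i j) h.
have := e 0 0; have := e 1 0.
rewrite !mulmx2E !mxE /= !(mulr0, mul0r, mulr1, mul1r, addr0, add0r) => a11 a01.
apply/matrixP => i j; rewrite !mxE.
have [->|->] := ord2P i; have [->|->] := ord2P j; rewrite /= ?mulr1n ?mulr0n ?mulr0 ?mulr1 ?addr0 ?add0r //.
all: by rewrite ?a11 ?a01 ?mulr0 ?mulr1 ?addr0 // mulrC.
Qed.

End block_commutation.

(** * Density of the polynomials *)

Section density.
Variables (R : realType) (eps : R).
Hypotheses (eps0 : 0 < eps) (eps1 : eps < 1).
Local Notation C := (Cplx R).
Local Notation H := (euclid R).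
Local Notation X := (set_type (@DT3 R eps)).
Local Notation E := (E0 eps).
Local Notation a := (@E0_gen R eps eps0).
Local Notation P := (@poly_fn R eps eps0).

(** A double commutant statement at one point. The attained values form an algebra containing M_2
    (x) 1. Commutation with 1 (x) [fib p] makes the blocks of f p scalars when del = 0 and
    combinations of 1 and G when x_2 = 1/2, and the algebra contains 1 (x) such blocks; otherwise it
    is all of M_4. *)
Lemma fiber_value (f : X -> 'M[C]_4) (p : X) : good f -> exists q, P q p = f p.
Proof.
move=> [fc fk ff].
pose S : set 'M[C]_4 := [set M | exists q, P q p = M].
have lS c M N : S M -> S N -> S (c *: M + N).
  move=> [q <-] [q' <-]; exists (starpoly_lin c q q').
  by rewrite /poly_fn starpoly_eval_lin fnD fnZ.
have mS M N : S M -> S N -> S (M *m N).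
  by move=> [q <-] [q' <-]; exists (starpoly_mul q q'); rewrite /poly_fn starpoly_eval_mul.
have hS : mx_closed S by [].
have Sg i : S (ev (val p) i) /\ S ((ev (val p) i) ^t*).
  split; first by exists [:: (1, [:: (i, false)])]; rewrite /poly_fn starpoly_eval_gen.
  exists (starpoly_star [:: (1, [:: (i, false)])]).
  by rewrite /poly_fn starpoly_eval_star starpoly_eval_gen.
have [SE SEs] := closed_E eps0 (XP p) hS Sg.
have S1 : S (tens2 1%:M 1%:M) by exact: (mx_closed_tens1 hS SE SEs).
have S0 : S 0 by rewrite -(addNr (mxE1 C)) -scaleN1r; exact: lS.
have SZ c M : S M -> S (c *: M) by move=> SM; rewrite -[c *: M]addr0; exact: lS.
rewrite -[exists q, _]/(S (f p)).
have [d0|dN] := eqVneq (pdel (val p)) 0.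
  apply: (@mx_closed_blocks _ S [set B | exists c, B = c%:M]) => // [B [c ->]|i j].
    by rewrite -[c%:M]scalemx1 tens2Zr; exact: SZ.
  exists (mx_block (f p) i j 0 0); apply: commute_all_scalar => B.
  by apply: mx_block_commute; apply: ff; left.
have d0 : 0 < pdel (val p) by rewrite lt_neqAle eq_sym dN (pdel_ge0 (XP p)).
have [_ _ /andP[_ x2]] := DT3_bounds (XP p).
have [x2h|x2n] := eqVneq (px2 (val p)) (1 / 2); last first.
  by apply: (closed_full eps0 (XP p) hS Sg d0); rewrite lt_neqAle x2n.
have SG := closed_half eps0 (XP p) hS Sg d0 x2h.
set G := delta_mx 1 0 + _ in SG.
apply: (@mx_closed_blocks _ S [set B | exists c d, B = c *: 1%:M + d *: G]) => // [B [c [d ->]]|i j].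
  by rewrite tens2Dr !tens2Zr; apply: lS => //; exact: SZ.
exists (mx_block (f p) i j 0 0), (mx_block (f p) i j 1 0); apply: commute_swap.
  have [_ _ u2] := DT3_norms (XP p).
  by rewrite -normr_eq0 u2 oner_eq0.
apply: mx_block_commute; apply: ff; right; split=> //; exists 1.
by rewrite scale1r.
Qed.

(** A polynomial that matches f at p0 matches it on all points with the invariants of p0, both
    functions being good. By compactness it stays close where the invariants are close. *)
Lemma local_approx (f : X -> 'M[C]_4) (p0 : X) (e : C) : good f -> 0 < e ->
  exists q (d : R), 0 < d /\ forall p, key_dist p0 p < d -> opb (f p - P q p) e.
Proof.
move=> gf e0; have [q hq] := fiber_value p0 gf; exists q.
have gP : good (P q) by exact: fnP.
have gD : good (fun p => (-1) *: P q p + f p) by exact: good_lin.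
have [Dc Dk _] := gD.
have [|d d0 hd] := @compact_level R X (key_dist p0) (fun p => opb (f p - P q p) e)
  (@X_compact R eps) (@key_dist_cts R eps eps0 p0).
  move=> p; have [h0|hN] := eqVneq (key_dist p0 p) 0; last first.
    by left; rewrite lt_neqAle eq_sym hN key_dist_ge0.
  right; have Dp : (-1) *: P q p + f p = 0.
    by rewrite (Dk p p0) ?(key_dist_eq0 h0) // hq scaleN1r addNr.
  have := cts_opb Dc p e0; rewrite Dp; apply: filterS => p' h.
  by have := opbN h; rewrite sub0r opprK scaleN1r addrC.
by exists d.
Qed.

Lemma key_bump (y : X) (d : R) : 0 < d -> exists phi : X -> R,
  [/\ rapx eps0 phi, forall p, 0 <= phi p <= 1, forall p, d <= key_dist y p -> phi p = 0
    & forall p, key_dist y p < d / 2 -> phi p = 1].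
Proof.
move=> d0; exists (fun p => clamp (2 - 2 / d * key_dist y p)); split.
- apply: rapx_clamp; apply: rapx_sub (rapx_cst _ _) _.
  exact: rapx_mul (rapx_cst _ _) (rapx_key_dist _ _).
- by move=> p; exact: clamp_bounds.
- move=> p h; apply: clamp_le0.
  by rewrite subr_le0 mulrAC ler_pdivlMr // ler_pM2l.
- move=> p h; apply: clamp_ge1.
  have : 2 / d * key_dist y p <= 1; last by lra.
  by rewrite mulrAC ler_pdivrMr // mul1r mulrC -ler_pdivlMr // ltW.
Qed.

(** If F approximates th f, then phi N + (1 - phi) F approximates (phi + (1 - phi) th) f, the error
    being weighted in the same way; where phi = 0 the quality of N is irrelevant. *)
Lemma convex_step (phi th : R) (M N F : 'M[C]_4) (e : C) : 0 <= phi <= 1 -> 0 <= th ->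
  (phi = 0 \/ opb (M - N) e) -> opb (Cr th *: M - F) (Cr th * e) ->
  opb (Cr (phi + (1 - phi) * th) *: M - ((Cr phi)%:M *m N + (Cr (1 - phi))%:M *m F))
    (Cr (phi + (1 - phi) * th) * e).
Proof.
move=> /andP[h1 h2] h3 hN hF.
have k1 : 0 <= Cr phi :> C by rewrite Cr_ge0.
have k2 : 0 <= Cr (1 - phi) :> C by rewrite Cr_ge0 subr_ge0.
have -> : Cr (phi + (1 - phi) * th) *: M - ((Cr phi)%:M *m N + (Cr (1 - phi))%:M *m F) =
    Cr phi *: (M - N) + Cr (1 - phi) *: (Cr th *: M - F).
  rewrite !mul_scalar_mx CrD CrM; move: (Cr phi) (Cr (1 - phi)) (Cr th) => x y z.
  by rewrite scalerDl !scalerBr scalerA opprD addrACA.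
have -> : Cr (phi + (1 - phi) * th) * e = `|Cr phi : C| * e + `|Cr (1 - phi) : C| * (Cr th * e).
  by rewrite !ger0_norm // CrD CrM mulrDl mulrA.
apply: opbD; last exact: opbZ.
case: hN => [->|hN]; last exact: opbZ.
by move=> x; rewrite Cr0 scale0r /mxop mul0mx !normr0 !mul0r.
Qed.

(** A partition of unity built one bump at a time: 1 - th is the product of the factors 1 - phi, so
    no division by a sum of bumps occurs, and th = 1 wherever some bump is 1. *)
Lemma cover_approx (f : X -> 'M[C]_4) (e : C) (q : X -> starpoly C 'I_2) (d : X -> R) (s : seq X) :
  0 <= e -> (forall y, 0 < d y) ->
  (forall y p, key_dist y p < d y -> opb (f p - P (q y) p) e) ->
  exists (F : X -> 'M[C]_4) (th : X -> R),
    [/\ apx eps0 F, forall p, 0 <= th p <= 1,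
        forall p, opb (Cr (th p) *: f p - F p) (Cr (th p) * e)
      & forall p y, y \in s -> key_dist y p < d y / 2 -> th p = 1].
Proof.
move=> e0 d0 hd; elim: s => [|y s [F [th [aF th01 hF th1]]]].
  exists (fun=> 0), (fun=> 0); split=> //.
  - by apply: apx_ext (sapx_cst eps0 0) => p; rewrite raddf0.
  - by move=> p; rewrite lexx ler01.
  - by move=> p x; rewrite Cr0 scale0r subrr /mxop mul0mx normr0 !mul0r.
have [phi [aphi phi01 phi0 phi1]] := key_bump y (d0 y).
exists (fun p => (Cr (phi p))%:M *m P (q y) p + (Cr (1 - phi p))%:M *m F p).
exists (fun p => phi p + (1 - phi p) * th p); split.
- have a1 := apx_mul aphi (apx_poly eps0 (q y)).
  have a2 := apx_mul (rapx_sub (rapx_cst _ 1) aphi) aF.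
  by apply: apx_ext (apx_lin 1 a1 a2) => p; rewrite scale1r.
- move=> p; have /andP[h1 h2] := phi01 p; have /andP[h3 h4] := th01 p.
  by apply/andP; split; nra.
- move=> p; have /andP[h3 h4] := th01 p; apply: convex_step => //.
  have [hp|hp] := ltP (key_dist y p) (d y); last by left; exact: phi0.
  by right; exact: hd.
- move=> p y'; rewrite in_cons => /orP[/eqP ->|ys] h.
    by rewrite (phi1 _ h) subrr mul0r addr0.
  by rewrite (th1 _ _ ys h) mulr1 addrC subrK.
Qed.

Lemma good_apx (f : X -> 'M[C]_4) : good f -> apx eps0 f.
Proof.
move=> gf; apply: apx_limit => e e0.
have h p0 : exists qd : starpoly C 'I_2 * R,
    0 < qd.2 /\ forall p, key_dist p0 p < qd.2 -> opb (f p - P qd.1 p) e.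
  by have [q [d hd]] := local_approx p0 gf e0; exists (q, d).
have {h} [qd hqd] := choice h.
pose d y := (qd y).2; have d0 y : 0 < d y by have [] := hqd y.
have [p|s hs] := @compact_finite_cover X (fun y => [set p | key_dist y p < d y / 2]) (@X_compact R eps).
  have h : key_dist p p < d p / 2 by rewrite key_dist_self divr_gt0.
  exact: (cvgr_lt (key_dist p p) (@key_dist_cts R eps eps0 p p) _ h).
have [|F [th [aF _ hF th1]]] := @cover_approx f e (fun y => (qd y).1) d s (ltW e0) d0.
  by move=> y p; have [_] := hqd y; apply.
exists F => // p; have [y ys hy] := hs p.
by have := hF p; rewrite (th1 p y ys hy) Cr1 scale1r mul1r.
Qed.

Lemma E0_enveloping : is_E eps a.
Proof.
split.
- apply/seteqP; split=> // x _ B /nbhs_ballP[e /= e0 he].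
  have e2 : 0 < e / 2 by rewrite divr_gt0.
  have [q hq] := good_apx (fnP x) e2; exists (starpoly_eval a q); split; first by exists q.
  apply: he; rewrite -ball_normE /=.
  apply: (@le_lt_trans _ _ (e / 2)); last by rewrite ltr_pdivrMr // ltr_pMr // ltr1n.
  by apply: cnorm_le => [|p]; [exact: ltW|rewrite fnD fnN; exact: hq].
- exact: E0_upper.
- move=> q M; exact: E0_lower.
Qed.

End density.

(** * The matrix boundary conditions as commutation relations *)

Section blocks.
Variable R : realType.
Local Notation C := (Cplx R).
Local Notation dl i j := (delta_mx i j : 'M[C]_2).
Implicit Types (A B : 'M[C]_2) (X Z : 'M[C]_4).

Lemma commute_tensor1P X :
  M2_tensor_1 X <-> forall B, X *m tens2 1%:M B = tens2 1%:M B *m X.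
Proof.
split=> [[A ->] B|h]; first by rewrite -/(tens2 A 1%:M) !tens2M !mul1mx !mulmx1.
exists (\matrix_(i, j) mx_block X i j 0 0); apply: mx_blockP => i j.
rewrite -/(tens2 _ _) mx_block_tens mxE scalemx1; apply: commute_all_scalar => B.
by rewrite -mx_block_mulr1 h mx_block_mull1.
Qed.

Lemma commute_block_diagP X :
  M2_plus_M2 X <-> X *m tens2 (grading C) 1%:M = tens2 (grading C) 1%:M *m X.
Proof.
split=> [[A [B ->]]|/commute_grading_blocks e]; first exact: block_diag_commute.
by exists (mx_block X 0 0), (mx_block X 1 1).
Qed.

End blocks.

Section swap.
Variable C : numClosedFieldType.
Local Notation dl i j := (delta_mx i j : 'M[C]_2).

Definition swap4 : 'M[C]_4 := tens2 (dl 0 0) (dl 0 0) + tens2 (dl 0 1) (dl 1 0) +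
  (tens2 (dl 1 0) (dl 0 1) + tens2 (dl 1 1) (dl 1 1)).

Lemma swap4_adj : swap4 ^t* = swap4.
Proof. by rewrite /swap4 !adjmxD !tens2_adj !adjmx_delta addrACA. Qed.

Lemma mx_block_swap4 i j : mx_block swap4 i j = dl j i.
Proof.
rewrite /swap4 !mx_blockD !mx_block_tens !mxE.
by have [->|->] := ord2P i; have [->|->] := ord2P j;
  rewrite /= !scale0r scale1r ?addr0 ?add0r.
Qed.

Lemma swap4_tens2 (B : 'M[C]_2) : tens2 1%:M B *m swap4 = swap4 *m tens2 B 1%:M.
Proof.
apply: mx_blockP => i j; rewrite mx_block_mull1 mx_block_mulr !mx_block_swap4.
apply/matrixP => k l; rewrite mulmx2E !mxE.
by have [->|->] := ord2P i; have [->|->] := ord2P j; have [->|->] := ord2P k;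
  have [->|->] := ord2P l; rewrite /=; ring.
Qed.

Lemma delta2_sum : dl 0 0 + dl 1 1 = 1%:M.
Proof. by apply/matrixP => i j; rewrite !mxE; have [->|->] := ord2P i; have [->|->] := ord2P j; rewrite /= ?addr0 ?add0r. Qed.

Lemma swap4K : swap4 *m swap4 = 1%:M.
Proof.
rewrite /swap4 !mulmxDl !mulmxDr !tens2M !mul_delta2 /= !scale0r !scale1r !tens20l !tens20r.
by rewrite !addr0 !add0r -!tens2Dr delta2_sum -tens2Dl delta2_sum tens2_11.
Qed.

End swap.

(** Conjugation by u takes D to k G, and a nonzero factor does not affect commutation. *)
Lemma commute_similar (C : fieldType) n (X D G u v : 'M[C]_n) (k : C) :
  v *m u = 1%:M -> u *m v = 1%:M -> k != 0 -> u *m D = k *: (G *m u) ->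
  (v *m X *m u) *m D = D *m (v *m X *m u) <-> X *m G = G *m X.
Proof.
move=> vu uv k0 sw; have sw' : D *m v = k *: (v *m G).
  transitivity (v *m (u *m D) *m v); first by rewrite !mulmxA vu mul1mx.
  by rewrite sw -scalemxAr -scalemxAl -!mulmxA uv mulmx1.
have -> : v *m X *m u *m D = k *: (v *m (X *m G) *m u).
  by rewrite -!mulmxA sw -!scalemxAr.
have -> : D *m (v *m X *m u) = k *: (v *m (G *m X) *m u).
  by rewrite !mulmxA sw' -!scalemxAl -!mulmxA.
split=> [/(scalerI k0) e|->//].
have := congr1 (fun Y => u *m Y *m v) e.
by rewrite !mulmxA uv !mul1mx -!mulmxA uv !mulmx1.
Qed.

Section nu.
Variables (R : realType) (phi : R).
Local Notation C := (Cplx R).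
Local Notation dl i j := (delta_mx i j : 'M[C]_2).

Lemma flipE : flip R = swap4 C.
Proof. by rewrite /flip !sum2E. Qed.

Local Notation h := (expi (phi / 2) : C).

Lemma hh : h * h^* = 1. Proof. by apply: norm1_mulC; exact: expi_norm. Qed.

Lemma expiD (x y : R) : expi x * expi y = expi (x + y).
Proof.
apply/eqP; rewrite eq_complex /= cosD sinD.
by apply/andP; split; apply/eqP; ring.
Qed.

Lemma h2 : h * h = expi phi.
Proof. by rewrite expiD; congr expi; field. Qed.

Lemma VE : exists s : C, [/\ s * s = 2^-1, s^* = s &
  [/\ V phi 0 0 = s * h, V phi 0 1 = - (s * h), V phi 1 0 = s & V phi 1 1 = s]].
Proof.
exists (Cr (Num.sqrt 2)^-1); split; last by rewrite /V !mxE /= !mulr1 mulrN.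
  by rewrite -CrM -invfM -expr2 sqr_sqrtr // CrV Cr_nat.
exact: conj_Cr.
Qed.

Lemma V_unitary : (V phi) ^t* *m V phi = 1%:M.
Proof.
have [s [q2 sc [v00 v01 v10 v11]]] := VE.
have q1 : (s * h)^* * (s * h) = 2^-1.
  have -> : (s * h)^* = s * h^* by rewrite -{2}sc; exact: rmorphM.
  by rewrite mulrACA q2 [h^* * _]mulrC hh mulr1.
have t1 : 2^-1 + 2^-1 = 1 :> C by field.
move: (s * h) (V phi) v00 v01 v10 v11 q1 => m W v00 v01 v10 v11 q1.
apply/matrixP => i j; rewrite mulmx2E !mxE.
have [->|->] := ord2P i; have [->|->] := ord2P j; rewrite ?v00 ?v01 ?v10 ?v11 ?rmorphN ?sc.
- by rewrite q1 q2 t1.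
- by rewrite mulrN q1 q2 addNr.
- by rewrite mulNr q1 q2 addNr.
- by rewrite mulrNN q1 q2 t1.
Qed.

(** The columns of V are eigenvectors of G for the eigenvalues h and -h, where h is the chosen
    square root of [expi phi]; [grading] is diag(-1, 1). *)
Lemma V_swap : V phi *m grading C = - h^* *: (dl 1 0 + expi phi *: dl 0 1) *m V phi.
Proof.
have [s [_ _ [v00 v01 v10 v11]]] := VE; rewrite -h2.
have q : h * h * h^* = h by rewrite -mulrA hh mulr1.
have q1 := hh.
move: (V phi) v00 v01 v10 v11 => W v00 v01 v10 v11.
apply/matrixP => i j; rewrite !mulmx2E !mxE.
have [->|->] := ord2P i; have [->|->] := ord2P j; rewrite ?v00 ?v01 ?v10 ?v11 /=.
- by transitivity (- (s * (h * h * h^*))); [rewrite q|]; ring.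
- by transitivity (- (s * (h * h * h^*))); [rewrite q|]; ring.
- by transitivity (- (s * (h * h^*))); [rewrite q1|]; ring.
- by transitivity (s * (h * h^*)); [rewrite q1|]; ring.
Qed.

Lemma nu2_unitary : (nu2 phi) ^t* *m nu2 phi = 1%:M /\ nu2 phi *m (nu2 phi) ^t* = 1%:M.
Proof.
suff h1 : (nu2 phi) ^t* *m nu2 phi = 1%:M by split=> //; exact: mulmx1C.
rewrite /nu2 -/(tens2 _ _) flipE adjmxM swap4_adj mulmxA -[_ *m swap4 C *m swap4 C]mulmxA swap4K mulmx1.
by rewrite tens2_adj adjmx1 tens2M V_unitary mulmx1 tens2_11.
Qed.

Lemma nu2_swap : nu2 phi *m tens2 (grading C) 1%:M =
  - h^* *: (tens2 1%:M (dl 1 0 + expi phi *: dl 0 1) *m nu2 phi).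
Proof.
have -> : nu2 phi = swap4 C *m tens2 (V phi) 1%:M by rewrite /nu2 flipE.
have := V_swap; move: (V phi) (dl 1 0 + _) (- h^*) => W G k sw.
rewrite -mulmxA tens2M sw mulmxA swap4_tens2 -mulmxA tens2M !mulmx1.
by rewrite -scalemxAl tens2Zl scalemxAr.
Qed.

(** Block-diagonal matrices are the commutant of grading (x) 1. The factor V of [nu2] takes grading
    to a multiple of G, and the flip moves it to the second tensor factor. *)
Lemma nu2_block_diagP (X : 'M[C]_4) : M2_plus_M2 ((nu2 phi) ^t* *m X *m nu2 phi) <->
  X *m tens2 1%:M (dl 1 0 + expi phi *: dl 0 1) = tens2 1%:M (dl 1 0 + expi phi *: dl 0 1) *m X.
Proof.
have [u1 u2] := nu2_unitary; rewrite commute_block_diagP.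
apply: commute_similar u1 u2 _ nu2_swap.
by rewrite oppr_eq0 conjC_eq0 -normr_eq0 expi_norm oner_eq0.
Qed.

End nu.

(** * Good functions are the functions of the theorem *)

Section function_algebra.
Variables (R : realType) (eps : R).
Hypotheses (eps0 : 0 < eps).
Local Notation C := (Cplx R).
Local Notation X := (set_type (@DT3 R eps)).
Implicit Types (p q : point6 R) (f : X -> 'M[C]_4).

Lemma pkey_ext p q : pr p = pr q -> pu p = pu q -> ptau p = ptau q -> pt p = pt q ->
  pw' p = pw' q -> pkey p = pkey q.
Proof. by move=> er eu etau et ew; rewrite /pkey /pD /pw er eu etau et ew. Qed.

Lemma point6E p : p = (pr p, px1 p, px2 p, pu p, pu1 p, pu2 p).
Proof. by case: p => [[[[[]]]]]. Qed.

Lemma pdel_eq0 p : pdel p = 0 -> px1 p = (1 - pr p) / 2.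
Proof. by rewrite /pdel; lra. Qed.

(** Each gluing condition relates points with equal invariants: t = 0 at x_1 = 0, and w' = 0 when
    x_2 = 0 or del = 0, the latter including the face r = 1. *)
Lemma good_fun_algebra f : good f -> fun_algebra f.
Proof.
move=> [fc fk ff]; split=> // r x1 x2 u u1 u2 p q.
have T0 (v : R) : 2 * 0 / v = 0 by rewrite mulr0 mul0r.
have D0 : 1 - r - 2 * ((1 - r) / 2) = 0 by field.
split.
- move=> ep eq; apply: fk; apply: pkey_ext; rewrite ep eq //.
  by rewrite /pt /ptau /px1 /= T0 sqrtr0 Cr0 !mul0r.
- move=> ep eq; apply: fk; apply: pkey_ext; rewrite ep eq //.
  by rewrite /pw' /px2 /= mulr0 Cr0 !mul0r.
- move=> ep eq; split.
    apply: fk; apply: pkey_ext; rewrite ep eq //.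
    by rewrite /pw' /pdel /px1 /pr /= D0 !mul0r ?Cr0 ?mul0r.
  apply/commute_tensor1P => B; apply: ff; left.
  by rewrite ep /pdel /px1 /pr /=.
- move=> ep eq; apply: fk; apply: pkey_ext; rewrite ep eq //.
    by rewrite /pt /ptau /px1 /= T0 sqrtr0 Cr0 !mul0r.
  by rewrite /pw' /pdel /px1 /pr /= subrr sub0r mulr0 oppr0 !mul0r ?Cr0 ?mul0r.
- move=> phi2 _ ep; apply/nu2_block_diagP; apply: ff; right; rewrite ep; split=> //.
  by exists 1; rewrite scale1r.
Qed.

Definition unit_of (b : bool) (u : C) : C := if b then 1 else u.

(** A canonical point among those with the same invariants: the coordinates left undetermined are
    reset to 0 or 1. *)
Definition normal_form p : point6 R :=
  (pr p, px1 p, if pdel p == 0 then 0 else px2 p, pu p, unit_of (px1 p == 0) (pu1 p),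
   unit_of ((pdel p == 0) || (px2 p == 0)) (pu2 p)).

Lemma normal_form_DT3 p : DT3 eps p -> DT3 eps (normal_form p).
Proof.
move=> hp; have [h1 h2 h3] := DT3_bounds hp; have [n0 n1 n2] := DT3_norms hp.
split=> //.
  by case: (pdel p == 0) => //; rewrite lexx divr_ge0.
by split=> //; rewrite /unit_of; case: ifP; rewrite ?normr1.
Qed.

Lemma normal_form_eq p q : DT3 eps p -> DT3 eps q -> pkey p = pkey q ->
  normal_form p = normal_form q.
Proof.
move=> hp hq e; have [er eu et ew] := pkey_inj eps0 hp hq e.
have [etau ed] := same_pdel eps0 hp hq er et.
have e1 : px1 p = px1 q.
  apply: (@mulfI _ 2); first by rewrite pnatr_eq0.
  by rewrite -(ptauE eps0 hp) -(ptauE eps0 hq) er etau.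
have ev1 : unit_of (px1 p == 0) (pu1 p) = unit_of (px1 q == 0) (pu1 q).
  rewrite -e1 /unit_of; have [//|x0] := eqVneq (px1 p) 0.
  have s0 : Cr (Num.sqrt (ptau p)) != 0 :> C.
    rewrite fmorph_eq0 gt_eqF // sqrtr_gt0 lt_neqAle eq_sym (ptau_ge0 eps0 hp) andbT.
    apply: contra_neq x0 => t0; have := ptauE eps0 hp; rewrite t0 mul0r.
    by move=> /esym/eqP; rewrite mulf_eq0 pnatr_eq0 => /eqP.
  by apply: (mulfI s0); move: et; rewrite /pt etau.
rewrite /normal_form ev1 er eu e1 -ed; have [d0|dN] := eqVneq (pdel p) 0; first by [].
have dp : 0 < pdel p by rewrite lt_neqAle eq_sym dN (pdel_ge0 hp).
have [ex eu2] := same_x2 hp hq ed dp ew.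
rewrite -ex /=; congr (_, _); rewrite /unit_of.
by case: eu2 => [->|->]; rewrite ?eqxx.
Qed.

Definition in_DT3 p (hp : DT3 eps p) : X := exist _ p (mem_set hp).

(** The gluing conditions lead from a point to its normal form in two moves, first in u_1, then in
    x_2 and u_2. *)
Lemma fun_algebra_normal f (p : X) (hN : DT3 eps (normal_form (val p))) :
  fun_algebra f -> f p = f (in_DT3 hN).
Proof.
move=> [_ hf]; have hp := XP p; have [n0 n1 n2] := DT3_norms hp.
have [h1 h2 h3] := DT3_bounds hp; have ep := point6E (val p).
pose v1 := unit_of (px1 (val p) == 0) (pu1 (val p)).
(* The intermediate point, with only u_1 normalised. *)
pose p1 : point6 R := (pr (val p), px1 (val p), px2 (val p), pu (val p), v1, pu2 (val p)).
have hp1 : DT3 eps p1.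
  by split=> //; split=> //; rewrite /v1 /unit_of; case: ifP; rewrite ?normr1.
have -> : f p = f (in_DT3 hp1).
  have [x0|x0] := eqVneq (px1 (val p)) 0.
    have [h _ _ _ _] := hf (pr (val p)) 0 (px2 (val p)) (pu (val p)) (pu1 (val p)) (pu2 (val p))
      p (in_DT3 hp1).
    by apply: h; [rewrite [LHS]ep x0|rewrite /= /p1 /v1 x0 eqxx].
  by congr f; apply: val_inj; rewrite [LHS]ep /= /p1 /v1 (negPf x0).
have [d0|dN] := eqVneq (pdel (val p)) 0.
  have e1 : px1 (val p) = (1 - pr (val p)) / 2 by exact: pdel_eq0.
  have [_ _ h _ _] := hf (pr (val p)) 0 (px2 (val p)) (pu (val p)) v1 (pu2 (val p))
    (in_DT3 hp1) (in_DT3 hN).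
  by have [] := h; rewrite /= /p1 /normal_form -/v1 ?d0 ?eqxx -?e1.
have [x0|x0] := eqVneq (px2 (val p)) 0.
  have [_ h _ _ _] := hf (pr (val p)) (px1 (val p)) 0 (pu (val p)) v1 (pu2 (val p))
    (in_DT3 hp1) (in_DT3 hN).
  by apply: h; rewrite /= /p1 /normal_form -/v1 ?(negPf dN) x0 ?eqxx.
by congr f; apply: val_inj; rewrite /= /p1 /normal_form -/v1 (negPf dN) (negPf x0).
Qed.

(** Points with equal invariants share their normal form, where f takes the same value as at either
    of them. The commutation conditions are the two matrix conditions, with an angle for u_2
    supplied by [expi_surj]. *)
Lemma fun_algebra_good f : fun_algebra f -> good f.
Proof.
move=> gf; have [fc hf] := gf; split=> //.
- move=> p q e.
  have Np := normal_form_DT3 (XP p); have Nq := normal_form_DT3 (XP q).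
  have E : in_DT3 Np = in_DT3 Nq by apply: val_inj; exact: normal_form_eq (XP p) (XP q) e.
  by rewrite (fun_algebra_normal Np gf) (fun_algebra_normal Nq gf) E.
- move=> p B hB; have ep := point6E (val p).
  have [n0 n1 n2] := DT3_norms (XP p); have [h1 h2 h3] := DT3_bounds (XP p).
  case: hB => [d0|[x2 [c ->]]].
    have e1 : px1 (val p) = (1 - pr (val p)) / 2 by exact: pdel_eq0.
    have hq : DT3 eps (pr (val p), px1 (val p), 0, pu (val p), pu1 (val p), 1).
      by split=> //; [rewrite lexx divr_ge0|rewrite normr1].
    have [_ _ h _ _] := hf (pr (val p)) 0 (px2 (val p)) (pu (val p)) (pu1 (val p)) (pu2 (val p))
      p (in_DT3 hq).
    have [||_ /commute_tensor1P] := h; [by rewrite -e1|by rewrite -e1|exact].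
  have [t t2 te] := expi_surj n2.
  have [_ _ _ _ h] := hf (pr (val p)) (px1 (val p)) 0 (pu (val p)) (pu1 (val p)) 0 p p.
  have := h t t2; rewrite te -x2 => /(_ ep) /nu2_block_diagP; rewrite te => k.
  by rewrite tens2Zr -scalemxAr -scalemxAl k.
Qed.

End function_algebra.

Theorem theorem3p5 (R : realType) (eps : R) (heps : 0 < eps < 1) :
  (exists (E : cstarAlgType (Cplx R)) (a : 'I_2 -> E), is_E eps a) /\
  (forall (E : cstarAlgType (Cplx R)) (a : 'I_2 -> E),
     is_E eps a -> star_isomorphic E (fun_algebra (eps := eps))).
Proof.
have /andP[eps0 eps1] := heps; have env := E0_enveloping eps0 eps1.
split; first by exists (E0 eps : cstarAlgType (Cplx R)), (E0_gen eps0).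
move=> E a hE; have [Phi [Phil Phim Phis Phii Phio]] := enveloping_iso hE env.
exists (fun x p => fn (Phi x) p); split.
- by move=> c x y p; rewrite Phil fnD fnZ.
- by move=> x y p; rewrite Phim.
- by move=> x p; rewrite Phis.
- by move=> x y e; apply: Phii; apply: E0_eq; exact: e.
apply/seteqP; split=> [_ [x _ <-]|f /= /fun_algebra_good gf].
  by apply: good_fun_algebra; exact: (fnP (Phi x)).
by have [x xE] := Phio (MkE0 (gf eps0)); exists x => //; apply/funext => p; rewrite xE.
Qed.
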